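(* Let $\Delta$ be the unit disk in $\mathbb C$ and let $E\subset\Delta$ be a subset with strictly positive Lebesgue measure. Let $\{D_x\}_{x\in E}$ be a measurable family of pairwise disjoint holomorphic disks $D_x=\rho_x(\Delta)$, given by holomorphic maps $\rho_x:\Delta\to\Delta^2$ that are transverse to $\{0\}\times\Delta$ and satisfy $\rho_x(0)=(0,x)$ for every $x\in E$. Then the union $\bigcup_{x\in E}D_x$ has strictly positive Lebesgue measure in $\Delta^2$.
   Context: The family is measurable if $x\mapsto\rho_x$ is measurable on $E$ as a map into the space of holomorphic maps $\Delta\to\Delta^2$ with the topology of locally uniform convergence. Writing $\pi_1:\Delta^2\to\Delta$ for the first projection, $\rho_x$ is transverse to $\{0\}\times\Delta$ if $(\pi_1\circ\rho_x)'(t)\neq0$ at every $t\in\Delta$ with $\rho_x(t)\in\{0\}\times\Delta$ (in particular at $t=0$). *)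

(* Defs.v *)
From HB Require Import structures.
From mathcomp Require Import all_boot all_order all_algebra.
From mathcomp Require Import complex.
From mathcomp Require Import all_classical all_reals all_analysis.
Set Implicit Arguments.
Unset Strict Implicit.
Unset Printing Implicit Defensive.
Import Order.TTheory GRing.Theory Num.Theory.
Import numFieldNormedType.Exports.
Local Open Scope classical_set_scope.
Local Open Scope complex_scope.
Local Open Scope ring_scope.

Section lebesgue_measure_complex.
Variable R : realType.

(** Lebesgue measure on the Borel sets of [R^2] and of [R^2 * R^2 = R^4]. *)
Definition area2 := (@lebesgue_measure R \x @lebesgue_measure R)%E.

HB.instance Definition _ := Measure.on area2.

Let area2_sigma_finite : sigma_finite setT area2.
Proof.
have /sigma_finiteP[F [TF ndF Foo]] := sigma_finiteT (@lebesgue_measure R).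
exists (fun n => F n `*` F n).
  rewrite -setXTT TF predeqE => -[x y]; split.
    move=> [/= [n _ Fnx] [k _ Fky]]; exists (maxn n k) => //; split.
    - by move: x Fnx; exact/subsetPset/ndF/leq_maxl.
    - by move: y Fky; exact/subsetPset/ndF/leq_maxr.
  by move=> [n _ []/= ? ?]; split; exists n.
move=> k; have [? ?] := Foo k; split; first exact: measurableX.
by rewrite /area2 product_measure1E// lte_mul_pinfty// ge0_fin_numE.
Qed.

HB.instance Definition _ :=
  Measure_isSigmaFinite.Build _ _ _ area2 area2_sigma_finite.

Definition volume4 := (area2 \x area2)%E.

HB.instance Definition _ := Measure.on volume4.

(** The library puts no measurable structure on [R[i]]: subsets of [C] and
    [C * C] are transported along [x + i y |-> (x, y)]. *)
Definition realify (z : R[i]) := (complex.Re z, complex.Im z).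

Definition realify2 (p : R[i] * R[i]) := (realify p.1, realify p.2).

(** A set is Lebesgue measurable when it is Caratheodory measurable for the
    Lebesgue outer measure, that is, when it belongs to the completion of the
    Borel sigma-algebra. *)
Definition lebesgue_measurable1 : set (set R[i]) :=
  [set A | ((area2^*)%mu).-cara.-measurable (realify @` A)].

Definition lebesgue_measurable2 : set (set (R[i] * R[i])) :=
  [set A | ((volume4^*)%mu).-cara.-measurable (realify2 @` A)].

Definition lebesgue1 (A : set R[i]) : \bar R :=
  completed_measure_extension (mu := area2) (realify @` A).

Definition lebesgue2 (A : set (R[i] * R[i])) : \bar R :=
  completed_measure_extension (mu := volume4) (realify2 @` A).

End lebesgue_measure_complex.

(** [R[i]^o] is [C] as a normed module over itself, so [derivable _ _ 1] is
    complex differentiability and ['D_1] the complex derivative. *)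
Section holomorphic_disks.
Variable R : realType.
Notation C := R[i]^o.

Definition disk : set C := [set z | `|z| < 1].

Definition bidisk : set (C * C) := disk `*` disk.

(** [f] is only constrained on [disk]; since [disk] is open, complex
    differentiability at its points does not depend on the values outside. *)
Definition holomorphic_disk (f : C -> C * C) : Prop :=
  (forall t, disk t -> derivable f t 1) /\ (forall t, disk t -> bidisk (f t)).

(** The functions [C -> C * C] with the topology of uniform convergence on the
    compact subsets of [disk].  Its open sets depend only on the restrictions
    of functions to [disk], where this is locally uniform convergence, so on
    holomorphic disks it induces the topology of the space of holomorphic maps
    from [disk] to [bidisk]. *)
Definition disk_maps :=
  {family [set K : set C | compact K /\ K `<=` disk], C -> C * C}.

(** Measurability on [E] of [x |-> rho x], for the Lebesgue measurable sets at
    the source and the Borel sigma-algebra of [disk_maps] at the target. *)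
Definition measurable_family (E : set C) (rho : C -> C -> C * C) : Prop :=
  forall B : set disk_maps, <<s @open disk_maps >> B ->
    lebesgue_measurable1 (E `&` [set x | B (rho x)]).

Definition transverse_to_axis (f : C -> C * C) : Prop :=
  forall t, disk t -> ([set 0] `*` disk) (f t) -> 'D_1 (fst \o f) t != 0.

(** The measure is taken on a measurable subset because no measurability of [A]
    is assumed; for measurable [A] this says [0 < lebesgue2 A]. *)
Definition positive_lebesgue2 (A : set (C * C)) : Prop :=
  exists B, [/\ lebesgue_measurable2 B, B `<=` A & (0 < lebesgue2 B)%E].

End holomorphic_disks.

(* Main.v *)
(** The derivative of the first component of [rho x] at [0] does not vanish, so
    over a small disc around [0] in the first coordinate the disk [D_x] contains
    the graph of a holomorphic function [z |-> h x z] with [h x 0 = x].  By a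
    Lusin argument there is a compact [K] of positive measure, contained in [E],
    on which [rho] is continuous and the radius of the disc is uniform.  Over
    [K] these graphs sweep a compact set, hence a measurable one, and by Fubini
    it is enough to bound the areas of its slices [h K z] from below uniformly
    in [z].

    As the disks are disjoint, [h] is a holomorphic motion of [K]: for [x != y]
    the function [z |-> h x z - h y z] has no zeros.  Schottky's theorem applied
    to [(h x z - h y z) / (h x z - h w z)] shows that the motion distorts ratios
    of distances boundedly, so a separated net of [K] moves to points around
    which there are disjoint squares of size comparable to the distance to the
    nearest neighbour, all within a given neighbourhood of [h K z].  By
    Harnack's inequality for the product of the functions
    [z |-> h x z - h y z] over the pairs of nearest neighbours [x], [y], and by
    the inequality of arithmetic and geometric means, the total area of these
    squares is bounded below by a power of the area of [K]. *)
Require Import Defs.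
From HB Require Import structures.
From mathcomp Require Import all_boot all_order all_algebra.
From mathcomp Require Import complex.
From mathcomp Require Import all_classical all_reals all_analysis.
From mathcomp Require Import ring lra.
Set Implicit Arguments.
Unset Strict Implicit.
Unset Printing Implicit Defensive.
Import Order.TTheory GRing.Theory Num.Theory.
Import numFieldNormedType.Exports.
Local Open Scope classical_set_scope.
Local Open Scope complex_scope.
Local Open Scope ring_scope.

(* Disequalities and equations in [R[i]] make [lra] fail. *)
Ltac clear_complex := repeat match goal with
  | H : is_true (~~ _) |- _ => clear H
  | H : @eq (complex _) _ _ |- _ => clear H
  end.
Ltac rlra := clear_complex; lra.

(** * The modulus with values in [R], whereas the norm of [R[i]] takes values in [R[i]] *)

Section modulus.
Variable R : realType.
Implicit Types z w : R[i].

(** For fixed [z] the map [x |-> h x z] need not be Lipschitz in either direction, so no change of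
    variables bounds the area of a slice. The area has to be recovered from finitely many
    displacements, with a bound that survives refinement of the net.

    Displacements shrink with the mesh [d], so Harnack's inequality for a single one loses a power
    of [d]. For the product of [m] of them the useful upper bound is not a constant to the power [m]
    but [(B / m) ^ m]: disjoint squares of bounded total area bound the sum of the squared
    displacements by a constant [B], and the means inequality passes to the product. Harnack's
    inequality relative to this bound gives, after an [m]-th root, a sum of squared displacements at
    [z] of at least [(m * d ^ 2) ^ 2 / B]. As [m * d ^ 2] is comparable with the area covered by the
    net, [m] and [d] disappear.

    Refinement is needed because the squares must lie in an arbitrarily thin neighbourhood of the
    slice; the slice is closed, so the bound passes to the limit. *)

Definition cabs z : R := complex.Re `|z|.

Lemma cabsE z : `|z| = (cabs z)%:C.
Proof. by rewrite /cabs normc_def. Qed.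

Lemma cabs_sqrt z : cabs z = Num.sqrt (complex.Re z ^+ 2 + complex.Im z ^+ 2).
Proof. by rewrite /cabs normc_def. Qed.

Lemma cabs_ge0 z : 0 <= cabs z.
Proof. by rewrite cabs_sqrt sqrtr_ge0. Qed.

Lemma cabsM z w : cabs (z * w) = cabs z * cabs w.
Proof. by apply: complexI; rewrite rmorphM -!cabsE normrM. Qed.

Lemma cabsN z : cabs (- z) = cabs z.
Proof. by apply: complexI; rewrite -!cabsE normrN. Qed.

Lemma cabs0 : cabs 0 = 0.
Proof. by apply: complexI; rewrite -cabsE normr0. Qed.

Lemma cabs1 : cabs 1 = 1.
Proof. by apply: complexI; rewrite -cabsE normr1. Qed.

Lemma cabs_i : cabs 'i = 1.
Proof. by rewrite cabs_sqrt/= expr0n expr1n/= add0r sqrtr1. Qed.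

Lemma cabsV z : cabs z^-1 = (cabs z)^-1.
Proof. by apply: complexI; rewrite fmorphV -!cabsE normfV. Qed.

Lemma cabsX z n : cabs (z ^+ n) = cabs z ^+ n.
Proof. by apply: complexI; rewrite rmorphXn -!cabsE normrX. Qed.

Lemma cabs_real (x : R) : cabs x%:C = `|x|.
Proof. by rewrite cabs_sqrt/= expr0n/= addr0 sqrtr_sqr. Qed.

Lemma cabs_nat n : cabs (n%:R) = n%:R.
Proof. by rewrite -(rmorph_nat (real_complex R)) cabs_real normr_nat. Qed.

Lemma cabs_eq0 z : (cabs z == 0) = (z == 0).
Proof.
by rewrite -(inj_eq (@complexI R)) -cabsE normr_eq0.
Qed.

Lemma cabs_gt0 z : (0 < cabs z) = (z != 0).
Proof. by rewrite lt_neqAle cabs_ge0 andbT eq_sym cabs_eq0. Qed.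

Lemma cabsD z w : cabs (z + w) <= cabs z + cabs w.
Proof. by rewrite -lecR rmorphD -!cabsE ler_normD. Qed.

Lemma cabsB z w : cabs (z - w) <= cabs z + cabs w.
Proof. by rewrite (le_trans (cabsD _ _))// cabsN. Qed.

Lemma cabsC z w : cabs (z - w) = cabs (w - z).
Proof. by rewrite -cabsN opprB. Qed.

Lemma cabs_dist_tri w z t : cabs (z - t) <= cabs (z - w) + cabs (w - t).
Proof. by rewrite (le_trans _ (cabsD _ _))// addrA subrK. Qed.

Lemma cabsB_ge z w : cabs z - cabs w <= cabs (z - w).
Proof. by rewrite lerBlDr (le_trans _ (cabsD _ _))// subrK. Qed.

Lemma Re_le_cabs z : `|complex.Re z| <= cabs z.
Proof. by rewrite -lecR -cabsE normc_ge_Re. Qed.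

Lemma Im_le_cabs z : `|complex.Im z| <= cabs z.
Proof.
have := Re_le_cabs (z * 'i); rewrite ReiNIm normrN cabsM cabs_i mulr1.
by [].
Qed.

Lemma cabs_le_ReIm z : cabs z <= `|complex.Re z| + `|complex.Im z|.
Proof.
rewrite {1}(complexE z) (le_trans (cabsD _ _))// cabsM cabs_i mul1r.
by rewrite !cabs_real.
Qed.

Lemma cReD z w : complex.Re (z + w) = complex.Re z + complex.Re w.
Proof. by case: z w => [? ?] []. Qed.
Lemma cImD z w : complex.Im (z + w) = complex.Im z + complex.Im w.
Proof. by case: z w => [? ?] []. Qed.
Lemma cReN z : complex.Re (- z) = - complex.Re z.
Proof. by case: z. Qed.
Lemma cImN z : complex.Im (- z) = - complex.Im z.
Proof. by case: z. Qed.
Lemma cReB z w : complex.Re (z - w) = complex.Re z - complex.Re w.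
Proof. by rewrite cReD cReN. Qed.
Lemma cImB z w : complex.Im (z - w) = complex.Im z - complex.Im w.
Proof. by rewrite cImD cImN. Qed.
Lemma cReM z w : complex.Re (z * w) =
  complex.Re z * complex.Re w - complex.Im z * complex.Im w.
Proof. by case: z w => [? ?] []. Qed.
Lemma cImM z w : complex.Im (z * w) =
  complex.Re z * complex.Im w + complex.Im z * complex.Re w.
Proof. by case: z w => [? ?] []. Qed.
Lemma complex_eq z w : complex.Re z = complex.Re w ->
  complex.Im z = complex.Im w -> z = w.
Proof. by case: z w => [? ?] [? ?] /= -> ->. Qed.

End modulus.

(** * Differentiability of functions into [C] and the rules of calculus *)

Section derivatives.
Variable R : realType.
Local Notation C := R[i].

(** For [i] the identity of [C] this is complex differentiability at [x]; for
    [i] the inclusion of [R] it is differentiability of a curve in [C]. *)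
Definition gderiv (T : Type) (i : T -> C) (F : T -> C) (x : T) (d : C) :=
  forall e : R, 0 < e -> exists2 r : R, 0 < r & forall y, cabs (i y - i x) < r ->
    cabs (F y - F x - d * (i y - i x)) <= e * cabs (i y - i x).

Definition cderiv (f : C -> C) := gderiv id f.
Definition rderiv (f : R -> C) := gderiv (real_complex R) f.

Section rules.
Variables (T : Type) (i : T -> C).
Implicit Types (F G : T -> C) (x : T).

(** Rescaling [e] absorbs a constant factor, so the rules below may prove the estimate up to any [K]
    and only for [e <= 1]. *)
Lemma gderiv_bigeps F x d (K : R) : 0 <= K ->
  (forall e : R, 0 < e -> e <= 1 -> exists2 r : R, 0 < r &
    forall y, cabs (i y - i x) < r ->
    cabs (F y - F x - d * (i y - i x)) <= K * e * cabs (i y - i x)) ->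
  gderiv i F x d.
Proof.
move=> K0 H e e0.
have K1 : 0 < K + 1 by rewrite ltr_pwDr.
have m0 : 0 < Num.min 1 (e / (K + 1)) by rewrite lt_min ltr01 divr_gt0.
have [|r r0 Hr] := H _ m0; first by rewrite ge_min lexx.
exists r => // y /Hr /le_trans; apply; apply: ler_wpM2r; first exact: cabs_ge0.
apply: (@le_trans _ _ ((K + 1) * (e / (K + 1)))).
  by apply: ler_pM => //; [exact: ltW|rewrite lerDl|rewrite ge_min lexx orbT].
by rewrite mulrCA divff ?mulr1// gt_eqF.
Qed.

Lemma gderiv_lip F x d : gderiv i F x d -> exists2 r : R, 0 < r &
  forall y, cabs (i y - i x) < r ->
    cabs (F y - F x) <= (cabs d + 1) * cabs (i y - i x).
Proof.
move=> /(_ 1 ltr01)[r r0 H]; exists r => // y /H; rewrite mul1r => {}H.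
rewrite -[F y - F x](subrK (d * (i y - i x))) (le_trans (cabsD _ _))//.
by rewrite mulrDl mul1r addrC cabsM lerD2l.
Qed.

Lemma gderiv_cont F x d : gderiv i F x d -> forall e : R, 0 < e ->
  exists2 r : R, 0 < r & forall y, cabs (i y - i x) < r -> cabs (F y - F x) < e.
Proof.
move=> /gderiv_lip[r r0 H] e e0.
have d0 : 0 < cabs d + 1 by rewrite ltr_wpDl// cabs_ge0.
exists (Num.min r (e / (cabs d + 1))); first by rewrite lt_min r0 divr_gt0.
move=> y; rewrite lt_min => /andP[/H /le_lt_trans h yr]; apply: h.
by rewrite mulrC -ltr_pdivlMr.
Qed.

Lemma gderiv_cst c x : gderiv i (fun=> c) x 0.
Proof.
move=> e e0; exists 1 => // y _.
by rewrite subrr mul0r subrr cabs0 mulr_ge0 ?cabs_ge0// ltW.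
Qed.

Lemma gderiv_id x : gderiv i i x 1.
Proof.
move=> e e0; exists 1 => // y _.
by rewrite mul1r subrr cabs0 mulr_ge0 ?cabs_ge0// ltW.
Qed.

Lemma gderivD F G x d d' : gderiv i F x d -> gderiv i G x d' ->
  gderiv i (fun y => F y + G y) x (d + d').
Proof.
move=> HF HG; apply: (@gderiv_bigeps _ _ _ 2) => // e e0 _.
have [r r0 H] := HF _ e0; have [s s0 H'] := HG _ e0.
exists (Num.min r s); first by rewrite lt_min r0.
move=> y; rewrite lt_min => /andP[/H {}H /H' {}H'].
have -> : F y + G y - (F x + G x) - (d + d') * (i y - i x) =
  (F y - F x - d * (i y - i x)) + (G y - G x - d' * (i y - i x)) by ring.
by rewrite (le_trans (cabsD _ _))// -mulrA mulr2n mulrDl mul1r lerD.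
Qed.

Lemma gderivM F G x d d' : gderiv i F x d -> gderiv i G x d' ->
  gderiv i (fun y => F y * G y) x (d * G x + F x * d').
Proof.
move=> HF HG.
apply: (@gderiv_bigeps _ _ _
  ((cabs (G x) + 1) + (cabs (F x) + cabs d) + cabs (d * d'))).
  by rewrite !addr_ge0// cabs_ge0.
move=> e e0 e1.
have [r r0 H] := HF _ e0; have [s s0 H'] := HG _ e0.
have [t t0 H''] := gderiv_cont HG ltr01.
exists (Num.min (Num.min r s) (Num.min t e)); first by rewrite !lt_min r0 s0 t0.
move=> y; rewrite !lt_min => /andP[/andP[/H {}H /H' {}H'] /andP[/H'' {}H'' ye]].
set h := i y - i x in H H' ye *.
have -> : F y * G y - F x * G x - (d * G x + F x * d') * h =
  (F y - F x - d * h) * G y + (F x + d * h) * (G y - G x - d' * h)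
  + d * d' * h * h by ring.
have Gy : cabs (G y) <= cabs (G x) + 1.
  rewrite -[G y](subrK (G x)) (le_trans (cabsD _ _))// addrC lerD2l.
  exact: ltW.
have Fd : cabs (F x + d * h) <= cabs (F x) + cabs d.
  rewrite (le_trans (cabsD _ _))// lerD2l cabsM ler_piMr ?cabs_ge0//.
  by rewrite (le_trans (ltW ye)).
have p1 := ler_pM (cabs_ge0 _) (cabs_ge0 _) H Gy.
have p2 := ler_pM (cabs_ge0 _) (cabs_ge0 _) Fd H'.
have p3 := ler_wpM2l (mulr_ge0 (cabs_ge0 (d * d')) (cabs_ge0 h)) (ltW ye).
apply: (le_trans (cabsD _ _)); apply: (le_trans (lerD (cabsD _ _) (lexx _))).
rewrite (cabsM (d * d' * h)) (cabsM (d * d')) !(cabsM (_ - _ - _)).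
rewrite !(cabsM (_ + _)); lra.
Qed.

Lemma gderiv_comp f F x d d' : gderiv i F x d -> cderiv f (F x) d' ->
  gderiv i (fun y => f (F y)) x (d' * d).
Proof.
move=> HF Hf; apply: (@gderiv_bigeps _ _ _ (cabs d + 1 + cabs d')).
  by rewrite !addr_ge0// cabs_ge0.
move=> e e0 e1.
have [r r0 H] := HF _ e0; have [s s0 H'] := Hf _ e0.
have [t t0 H''] := gderiv_cont HF s0.
have [u u0 H3] := gderiv_lip HF.
exists (Num.min r (Num.min t u)); first by rewrite !lt_min r0 t0.
move=> y; rewrite !lt_min => /andP[/H {}H /andP[/H'' /H' {}H' /H3 {}H3]].
set h := i y - i x in H H3 *.
have -> : f (F y) - f (F x) - d' * d * h =
  (f (F y) - f (F x) - d' * (F y - F x)) + d' * (F y - F x - d * h) by ring.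
have p2 := ler_wpM2l (ltW e0) H3; have p3 := ler_wpM2l (cabs_ge0 d') H.
by apply: (le_trans (cabsD _ _)); rewrite (cabsM d'); move: H' => /= ?; lra.
Qed.

End rules.

Lemma cderiv_inv (u : C) : u != 0 -> cderiv GRing.inv u (- (u ^+ 2)^-1).
Proof.
move=> u0; have cu0 : 0 < cabs u by rewrite cabs_gt0.
apply: (@gderiv_bigeps _ _ _ _ _ (2 / cabs u ^+ 3)).
  by rewrite divr_ge0// exprn_ge0// ltW.
move=> e e0 _.
exists (Num.min e (cabs u / 2)); first by rewrite lt_min e0 divr_gt0.
move=> w /=; rewrite lt_min => /andP[/ltW we wu].
have cw : cabs u / 2 <= cabs w.
  by have := cabsB_ge u w; rewrite (cabsC u) => ?; rlra.
have cw0 : 0 < cabs w by apply: lt_le_trans cw; rewrite divr_gt0.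
have w0 : w != 0 by rewrite -cabs_gt0.
have -> : w^-1 - u^-1 - - (u ^+ 2)^-1 * (w - u) = (w - u) * (w - u) / (u ^+ 2 * w).
  by field; rewrite w0.
rewrite !cabsM cabsV cabsM cabsX mulrAC ler_wpM2r ?cabs_ge0//.
rewrite [leRHS]mulrC; apply: ler_pM => //; rewrite ?cabs_ge0 ?invr_ge0//.
  by rewrite mulr_ge0 ?exprn_ge0// ltW.
have -> : 2 / cabs u ^+ 3 = (cabs u ^+ 2 * (cabs u / 2))^-1.
  by field; rewrite gt_eqF.
by rewrite lef_pV2 ?posrE ?mulr_gt0 ?exprn_gt0// ler_wpM2l// exprn_ge0// ltW.
Qed.

Lemma gderivN (T : Type) (i : T -> C) F x d : gderiv i F x d ->
  gderiv i (fun y => - F y) x (- d).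
Proof.
move=> H e /H[r r0 {}H]; exists r => // y /H.
by rewrite -cabsN; congr (cabs _ <= _); ring.
Qed.

Lemma gderivB (T : Type) (i : T -> C) F G x d d' : gderiv i F x d ->
  gderiv i G x d' -> gderiv i (fun y => F y - G y) x (d - d').
Proof. by move=> HF HG; apply: gderivD => //; apply: gderivN. Qed.

Lemma gderivZ (T : Type) (i : T -> C) F x d c : gderiv i F x d ->
  gderiv i (fun y => c * F y) x (c * d).
Proof.
move=> HF; have := gderivM (gderiv_cst i c x) HF.
by rewrite mul0r add0r.
Qed.

Lemma gderiv_eq (T : Type) (i : T -> C) F x d d' : gderiv i F x d -> d = d' ->
  gderiv i F x d'.
Proof. by move=> ? <-. Qed.

Lemma cderivV (T : Type) (i : T -> C) F x d : gderiv i F x d -> F x != 0 ->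
  gderiv i (fun y => (F y)^-1) x (- d / F x ^+ 2).
Proof.
move=> HF F0; apply: gderiv_eq (gderiv_comp HF (cderiv_inv F0)) _; ring.
Qed.

Lemma gderiv_div (T : Type) (i : T -> C) F G x d d' : gderiv i F x d ->
  gderiv i G x d' -> G x != 0 ->
  gderiv i (fun y => F y / G y) x ((d * G x - F x * d') / G x ^+ 2).
Proof.
move=> HF HG G0; apply: gderiv_eq (gderivM HF (cderivV HG G0)) _.
by field.
Qed.

Lemma cderiv_unique f z d d' : cderiv f z d -> cderiv f z d' -> d = d'.
Proof.
move=> H H'; apply/eqP/negPn; rewrite -subr_eq0 -cabs_gt0.
apply/negP => k0; have e0 : 0 < cabs (d - d') / 4 by rewrite divr_gt0.
have [r r0 {}H] := H _ e0; have [s s0 {}H'] := H' _ e0.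
pose t := Num.min r s / 2; have t0 : 0 < t by rewrite divr_gt0// lt_min r0.
have tr : t < r by rewrite ltr_pdivrMr// gt_min ltr_pMr// ltr1n.
have ts : t < s by rewrite ltr_pdivrMr// gt_min orbC ltr_pMr// ltr1n.
have ct : cabs (z + t%:C - z) = t by rewrite addrAC subrr add0r cabs_real ger0_norm// ltW.
have := H (z + t%:C); rewrite /= ct => /(_ tr) h1.
have := H' (z + t%:C); rewrite /= ct => /(_ ts) h2.
have : cabs (d - d') * t <= cabs (d - d') / 4 * t + cabs (d - d') / 4 * t.
  rewrite -{1}ct -cabsM; apply: le_trans (lerD h2 h1).
  rewrite -[X in _ <= _ + X]cabsN; apply: le_trans (cabsD _ _).
  by rewrite le_eqVlt; apply/orP; left; apply/eqP; congr cabs; ring.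
by have := mulr_gt0 k0 t0 => ? ?; rlra.
Qed.

(** A total function with default value [0], so that the derivative can itself be differentiated. *)
Definition cder f z : C := xget 0 [set d | cderiv f z d].

Lemma cderP f z : (exists d, cderiv f z d) -> cderiv f z (cder f z).
Proof. by case=> d H; rewrite /cder; case: xgetP => [? ->//|/(_ d)/(_ H)]. Qed.

Lemma cder_val f z d : cderiv f z d -> cder f z = d.
Proof. by move=> H; apply: cderiv_unique (H); apply: cderP; exists d. Qed.

End derivatives.

(** * Curves in [C] and the real derivatives of their components *)

Section real_derivative.
Variable R : realType.
Implicit Types f : R -> R.

Lemma is_derive_eps f (x d : R) : is_derive x 1 f d <->
  forall e, 0 < e -> exists2 r, 0 < r & forall y, `|y - x| < r ->
    `|f y - f x - d * (y - x)| <= e * `|y - x|.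
Proof.
have E (h X : R) : h != 0 -> h^-1 *: X - d = (X - d * h) / h.
  by move=> h0; rewrite /GRing.scale/=; field.
have one (h : R) : h *: (1 : R) = h by rewrite /GRing.scale/= mulr1.
split=> [[/cvg_ex[/= l fl] dl] e e0|H].
  have dE : l = d by rewrite -dl /derive; apply/esym; exact: cvg_lim.
  rewrite {l dl}dE in fl.
  move/cvgrPdist_le : fl => /(_ e e0)[r /= r0 H]; exists r => // y yr.
  have [->|yx] := eqVneq y x; first by rewrite !subrr mulr0 subr0 normr0 mulr0.
  have yx0 : y - x != 0 by rewrite subr_eq0.
  have := H (y - x); rewrite /ball/= sub0r normrN => /(_ yr yx0).
  by rewrite one subrK distrC E// normrM normfV ler_pdivrMr ?normr_gt0.
have D : (fun h : R => h^-1 *: (((f \o shift x) (h *: 1)) - f x)) @ 0^' --> d.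
  apply/cvgrPdist_le => e e0; have [r r0 {}H] := H _ e0.
  exists r => //= h; rewrite /ball/= sub0r normrN => hr h0.
  have := H (h + x); rewrite addrK => /(_ hr) h1.
  by rewrite one distrC E// normrM normfV ler_pdivrMr ?normr_gt0.
split; first by apply/cvg_ex; exists d.
exact: cvg_lim.
Qed.

Lemma rderiv_Re (F : R -> R[i]) x d : rderiv F x d ->
  is_derive x 1 (fun y => complex.Re (F y)) (complex.Re d).
Proof.
move=> H; apply/is_derive_eps => e /H[r r0 {}H]; exists r => // y yr.
have := H y; rewrite /= -rmorphB/= cabs_real => /(_ yr).
apply: le_trans; apply: le_trans (Re_le_cabs _).
by rewrite !cReB cReM/= mulr0 subr0.
Qed.

Lemma rderiv_Im (F : R -> R[i]) x d : rderiv F x d ->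
  is_derive x 1 (fun y => complex.Im (F y)) (complex.Im d).
Proof.
move=> H; apply/is_derive_eps => e /H[r r0 {}H]; exists r => // y yr.
have := H y; rewrite /= -rmorphB/= cabs_real => /(_ yr).
apply: le_trans; apply: le_trans (Im_le_cabs _).
by rewrite !cImB cImM/= mulr0 add0r.
Qed.

Lemma rderiv_pair (u v : R -> R) (x du dv : R) : is_derive x 1 u du ->
  is_derive x 1 v dv -> rderiv (fun y => u y +i* v y) x (du +i* dv).
Proof.
move=> /is_derive_eps Hu /is_derive_eps Hv.
apply: (@gderiv_bigeps _ _ _ _ _ _ 2) => // e e0 _.
have [r r0 {}Hu] := Hu _ e0; have [s s0 {}Hv] := Hv _ e0.
exists (Num.min r s); first by rewrite lt_min r0.
move=> y; rewrite -rmorphB/= cabs_real lt_min => /andP[/Hu {}Hu /Hv {}Hv].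
apply: (le_trans (cabs_le_ReIm _)); rewrite !cReB !cImB cReM cImM/=.
by rewrite !(mulr0,subr0,add0r) -mulrA mulr_natl mulr2n lerD.
Qed.

Lemma rderiv_horiz (c x : R) : rderiv (fun x => x +i* c) x 1.
Proof.
by apply: (gderiv_eq (rderiv_pair (is_derive_id _ _) (is_derive_cst _ _ _))).
Qed.

Lemma rderiv_vert (c x : R) : rderiv (fun y => c +i* y) x 'i.
Proof.
by apply: (gderiv_eq (rderiv_pair (is_derive_cst _ _ _) (is_derive_id _ _))).
Qed.

End real_derivative.

(** * Integrals of complex-valued functions of a real variable *)

Section complex_integral.
Variable R : realType.
Local Notation C := R[i].
Local Notation mu := (@lebesgue_measure R).
Implicit Types (F G : R -> C) (a b c : R).

Definition rdble a b F := forall x, a <= x <= b -> exists d, rderiv F x d.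

Definition cint a b F : C := (\int[mu]_(x in `[a, b]) complex.Re (F x))
  +i* (\int[mu]_(x in `[a, b]) complex.Im (F x)).

Lemma rdble_within a b F : rdble a b F ->
  {within `[a, b], continuous (fun x => complex.Re (F x))} /\
  {within `[a, b], continuous (fun x => complex.Im (F x))}.
Proof.
move=> H; split; apply: continuous_in_subspaceT => x;
  rewrite inE/= in_itv/= => /H[d].
  by move/rderiv_Re => -[/derivable1_diffP/differentiable_continuous].
by move/rderiv_Im => -[/derivable1_diffP/differentiable_continuous].
Qed.

Lemma rdble_integrable a b F : rdble a b F ->
  mu.-integrable `[a, b] (EFin \o (fun x => complex.Re (F x))) /\
  mu.-integrable `[a, b] (EFin \o (fun x => complex.Im (F x))).
Proof.
move=> /rdble_within[H1 H2]; split; apply: continuous_compact_integrable => //;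
  exact: segment_compact.
Qed.

Lemma eq_cint a b F G : (forall x, a <= x <= b -> F x = G x) ->
  cint a b F = cint a b G.
Proof.
by move=> FG; congr (_ +i* _); apply: eq_Rintegral => x;
  rewrite inE/= in_itv/= => /FG ->.
Qed.

Lemma cintD a b F G : rdble a b F -> rdble a b G ->
  cint a b (fun x => F x + G x) = cint a b F + cint a b G.
Proof.
move=> /rdble_integrable[f1 f2] /rdble_integrable[g1 g2].
apply: complex_eq; rewrite ?cReD ?cImD/= -RintegralD//; apply: eq_Rintegral => x _.
  by rewrite cReD.
by rewrite cImD.
Qed.

Lemma cintZ a b F k : rdble a b F -> cint a b (fun x => k * F x) = k * cint a b F.
Proof.
move=> /rdble_integrable[f1 f2].
have i1 (h : R -> R) r : mu.-integrable `[a, b] (EFin \o h) ->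
  mu.-integrable `[a, b] (EFin \o (fun x => r * h x)).
  by move=> ih; have := integrableZl _ r ih; apply.
apply: complex_eq; rewrite ?cReM ?cImM/= -!RintegralZl//.
  rewrite -RintegralB//; [|exact: i1|exact: i1].
  by apply: eq_Rintegral => x _; rewrite cReM.
rewrite -RintegralD//; [|exact: i1|exact: i1].
by apply: eq_Rintegral => x _; rewrite cImM.
Qed.

Lemma cintB a b F G : rdble a b F -> rdble a b G ->
  cint a b (fun x => F x - G x) = cint a b F - cint a b G.
Proof.
move=> hF hG; rewrite -mulN1r -cintZ// -cintD//.
  by apply: eq_cint => x _; rewrite mulN1r.
by move=> x /hG[d hd]; exists (-1 * d); exact: gderivZ.
Qed.

(** The factor [2] comes from bounding the real and imaginary parts separately; the estimates on
    circles below inherit it. *)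
Lemma cint_le a b F M : a <= b -> rdble a b F ->
  (forall x, a <= x <= b -> cabs (F x) <= M) -> cabs (cint a b F) <= 2 * (M * (b - a)).
Proof.
move=> ab /rdble_integrable[f1 f2] FM.
have muab : fine (mu `[a, b]) = b - a.
  rewrite lebesgue_measure_itv/= lte_fin; move: ab; rewrite le_eqVlt.
  by case/predU1P => [->|->//]; rewrite ltxx subrr.
have key (h : R -> R) : mu.-integrable `[a, b] (EFin \o h) ->
    (forall x, a <= x <= b -> `|h x| <= M) ->
    `|\int[mu]_(x in `[a, b]) h x| <= M * (b - a).
  move=> ih hM; rewrite -muab -Rintegral_cst//.
  apply: (le_trans (le_normr_Rintegral _ ih)) => //.
  apply: le_Rintegral => //.
  - exact: integrable_norm.
  - apply: continuous_compact_integrable; first exact: segment_compact.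
    by apply: continuous_subspaceT => x; exact: cvg_cst.
apply: (le_trans (cabs_le_ReIm _)); rewrite mulr_natl mulr2n.
by rewrite lerD//=; apply: key => // x /FM; apply: le_trans;
  rewrite ?Re_le_cabs ?Im_le_cabs.
Qed.

Lemma cint_chasles a b c F : a <= c -> c <= b -> rdble a b F ->
  cint a b F = cint a c F + cint c b F.
Proof.
move=> ac cb hF; have [f1 f2] := rdble_integrable hF.
have key (h : R -> R) : mu.-integrable `[a, b] (EFin \o h) ->
    \int[mu]_(x in `[a, b]) h x =
    \int[mu]_(x in `[a, c]) h x + \int[mu]_(x in `[c, b]) h x.
  move=> ih; have := @Rintegral_itvB R h (BLeft a) (BRight b) c ih.
  rewrite bnd_simp => /(_ ac); rewrite bnd_simp => /(_ cb) /eqP.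
  rewrite subr_eq => /eqP ->; rewrite addrC; congr (_ + _).
  apply: Rintegral_itv_obnd_cbnd.
  apply: integrableS ih => //.
  by apply: subset_itv; rewrite bnd_simp.
by apply: complex_eq; rewrite ?cReD ?cImD/=; apply: key.
Qed.

Lemma cint_FTC a b F G : a <= b -> rdble a b F ->
  (forall x, a <= x <= b -> rderiv G x (F x)) -> cint a b F = G b - G a.
Proof.
rewrite le_eqVlt => /predU1P[<- _ _|ab hF FG].
  by rewrite subrr /cint set_itv1 !Rintegral_set1.
have [f1 f2] := rdble_within hF.
have key (g f : R -> R) : {within `[a, b], continuous f} ->
    (forall x, a <= x <= b -> is_derive x 1 g (f x)) ->
    \int[mu]_(x in `[a, b]) f x = g b - g a.
  move=> fc fg; rewrite /Rintegral (continuous_FTC2 (F := g))//.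
  - split.
    + move=> x; rewrite in_itv/= => /andP[x1 x2].
      by have [] : is_derive x 1 g (f x) by apply: fg; rewrite !ltW.
    + apply: cvg_at_right_filter.
      have [/derivable1_diffP/differentiable_continuous] : is_derive a 1 g (f a).
        by apply: fg; rewrite lexx ltW.
      by [].
    + apply: cvg_at_left_filter.
      have [/derivable1_diffP/differentiable_continuous] : is_derive b 1 g (f b).
        by apply: fg; rewrite lexx ltW.
      by [].
  - move=> x; rewrite in_itv/= => /andP[x1 x2]; rewrite derive1E.
    by have [] : is_derive x 1 g (f x) by apply: fg; rewrite !ltW.
apply: complex_eq; rewrite ?cReB ?cImB/=.
  apply: (key (fun x => complex.Re (G x)) (fun x => complex.Re (F x))) => // x.
  by move/FG; exact: rderiv_Re.
apply: (key (fun x => complex.Im (G x)) (fun x => complex.Im (F x))) => // x.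
by move/FG; exact: rderiv_Im.
Qed.

End complex_integral.

(** * Goursat's theorem for rectangles *)

Section goursat.
Variable R : realType.
Local Notation C := R[i].
Implicit Types (f : C -> C) (a b c d : R).

(** The contour integral along the boundary, counterclockwise; ['i] is the velocity of the vertical
    sides. *)
Definition rect_int f a b c d : C :=
  cint a b (fun x => f (x +i* c)) + 'i * cint c d (fun y => f (b +i* y))
  - cint a b (fun x => f (x +i* d)) - 'i * cint c d (fun y => f (a +i* y)).

Definition rect_hol f a b c d :=
  forall x y, a <= x <= b -> c <= y <= d -> exists l, cderiv f (x +i* y) l.

Lemma rdble_horiz f a b c d y : rect_hol f a b c d -> c <= y <= d ->
  rdble a b (fun x => f (x +i* y)).
Proof.
move=> H yH x xH; have [l Hl] := H _ _ xH yH.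
by exists (l * 1); apply: gderiv_comp (rderiv_horiz _ _) Hl.
Qed.

Lemma rdble_vert f a b c d x : rect_hol f a b c d -> a <= x <= b ->
  rdble c d (fun y => f (x +i* y)).
Proof.
move=> H xH y yH; have [l Hl] := H _ _ xH yH.
by exists (l * 'i); apply: gderiv_comp (rderiv_vert _ _) Hl.
Qed.

Lemma rect_holS f a b c d a' b' c' d' : a <= a' -> b' <= b -> c <= c' ->
  d' <= d -> rect_hol f a b c d -> rect_hol f a' b' c' d'.
Proof.
move=> ha hb hc hd H x y /andP[x1 x2] /andP[y1 y2]; apply: H.
  by rewrite (le_trans ha x1) (le_trans x2 hb).
by rewrite (le_trans hc y1) (le_trans y2 hd).
Qed.

Lemma rect_int_split f a m b c n d : a <= m <= b -> c <= n <= d ->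
  rect_hol f a b c d ->
  rect_int f a b c d = rect_int f a m c n + rect_int f m b c n +
    rect_int f a m n d + rect_int f m b n d.
Proof.
move=> /andP[am mb] /andP[cn nd] H.
have ab := le_trans am mb; have cd := le_trans cn nd.
rewrite /rect_int.
rewrite (cint_chasles am mb (rdble_horiz (y := c) H _)) ?lexx//.
rewrite (cint_chasles am mb (rdble_horiz (y := d) H _)) ?lexx ?andbT//.
rewrite (cint_chasles cn nd (rdble_vert (x := a) H _)) ?lexx//.
rewrite (cint_chasles cn nd (rdble_vert (x := b) H _)) ?lexx ?andbT//.
ring.
Qed.

Lemma rect_intB f g a b c d : a <= b -> c <= d ->
  rect_hol f a b c d -> rect_hol g a b c d ->
  rect_int (fun z => f z - g z) a b c d = rect_int f a b c d - rect_int g a b c d.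
Proof.
move=> ab cd hf hg; rewrite /rect_int.
rewrite (cintB (rdble_horiz (y := c) hf _) (rdble_horiz (y := c) hg _)) ?lexx//.
rewrite (cintB (rdble_horiz (y := d) hf _) (rdble_horiz (y := d) hg _)) ?lexx ?andbT//.
rewrite (cintB (rdble_vert (x := a) hf _) (rdble_vert (x := a) hg _)) ?lexx//.
rewrite (cintB (rdble_vert (x := b) hf _) (rdble_vert (x := b) hg _)) ?lexx ?andbT//.
ring.
Qed.

Lemma rect_int_primitive f F a b c d : a <= b -> c <= d -> rect_hol f a b c d ->
  (forall z, cderiv F z (f z)) -> rect_int f a b c d = 0.
Proof.
move=> ab cd hf HF; rewrite /rect_int.
have hor y : c <= y <= d ->
    cint a b (fun x => f (x +i* y)) = F (b +i* y) - F (a +i* y).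
  move=> yH; apply: (cint_FTC ab (rdble_horiz hf yH) (G := fun x => F (x +i* y))).
  move=> x _; apply: (gderiv_eq (gderiv_comp (rderiv_horiz _ _) (HF _))).
  by rewrite mulr1.
have ver x : a <= x <= b ->
    'i * cint c d (fun y => f (x +i* y)) = F (x +i* d) - F (x +i* c).
  move=> xH; have hv := rdble_vert hf xH.
  rewrite -cintZ//; apply: (cint_FTC cd _ (G := fun y => F (x +i* y))).
    by move=> y /hv[l hl]; exists ('i * l); exact: gderivZ.
  move=> y _; apply: (gderiv_eq (gderiv_comp (rderiv_vert _ _) (HF _))).
  by rewrite mulrC.
rewrite !hor ?lexx ?cd// !ver ?lexx ?ab//; ring.
Qed.

Lemma rect_int_le f a b c d M : a <= b -> c <= d -> rect_hol f a b c d ->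
  (forall x y, a <= x <= b -> c <= y <= d -> cabs (f (x +i* y)) <= M) ->
  cabs (rect_int f a b c d) <= 4 * (M * ((b - a) + (d - c))).
Proof.
move=> ab cd hf HM.
have hor y : c <= y <= d -> cabs (cint a b (fun x => f (x +i* y))) <= 2 * (M * (b - a)).
  by move=> yH; apply: cint_le (rdble_horiz hf yH) _ => // x xH; exact: HM.
have ver x : a <= x <= b -> cabs ('i * cint c d (fun y => f (x +i* y))) <= 2 * (M * (d - c)).
  move=> xH; rewrite cabsM cabs_i mul1r.
  by apply: cint_le (rdble_vert hf xH) _ => // y yH; exact: HM.
have := hor c; have := hor d; have := ver a; have := ver b.
rewrite !lexx ab cd => /(_ isT) h1 /(_ isT) h2 /(_ isT) h3 /(_ isT) h4.
rewrite /rect_int; apply: (le_trans (cabsB _ _)).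
have := cabsB (cint a b (fun x => f (x +i* c)) + 'i * cint c d (fun y => f (b +i* y)))
 (cint a b (fun x => f (x +i* d))).
have := cabsD (cint a b (fun x => f (x +i* c))) ('i * cint c d (fun y => f (b +i* y))).
by move=> ? ?; lra.
Qed.

(** The numbers [u n] are the left ends of intervals obtained by keeping one half at each step;
    their supremum lies in all of the intervals. *)
Lemma nested_halvings (u : nat -> R) (L : R) : 0 <= L ->
  (forall n, u n.+1 = u n \/ u n.+1 = u n + L / 2 ^+ n.+1) ->
  exists p, forall n, u n <= p <= u n + L / 2 ^+ n.
Proof.
move=> L0 H.
have H2 n : L / 2 ^+ n = L / 2 ^+ n.+1 + L / 2 ^+ n.+1.
  by rewrite exprS; field; rewrite expf_neq0.
have pos n : 0 <= L / 2 ^+ n by rewrite divr_ge0// exprn_ge0.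
have inc n m : u n <= u (m + n)%N.
  elim: m => //= m IH; apply: (le_trans IH); rewrite addSn.
  by case: (H (m + n)%N) => ->; rewrite ?lerDl.
have dec n m : u (m + n)%N + L / 2 ^+ (m + n) <= u n + L / 2 ^+ n.
  elim: m => //= m IH; apply: le_trans IH; rewrite addSn.
  rewrite (H2 (m + n)%N); have := pos (m + n).+1.
  by case: (H (m + n)%N) => ->; lra.
have ub n : ubound (range u) (u n + L / 2 ^+ n).
  move=> _ [m _ <-]; have [mn|/ltnW nm] := leqP m n.
    rewrite (le_trans (inc m (n - m)%N))// subnK// lerDl; exact: pos.
  apply: le_trans (dec n (m - n)%N); rewrite subnK// lerDl; exact: pos.
have hs : has_sup (range u).
  by split; [exists (u 0%N), 0%N|exists (u 0%N + L / 2 ^+ 0); exact: ub].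
exists (sup (range u)) => n; apply/andP; split.
  by apply: sup_upper_bound => //; exists n.
by apply: sup_le_ub; [case: hs|exact: ub].
Qed.

(** The integrals over the four quarters add up to the whole, so one of them has modulus at least a
    quarter of it. *)
Lemma goursat_quarter f a c l h : 0 <= l -> 0 <= h ->
  rect_hol f a (a + l) c (c + h) -> exists p : R * R,
  [/\ p.1 = a \/ p.1 = a + l / 2, p.2 = c \/ p.2 = c + h / 2 &
    cabs (rect_int f a (a + l) c (c + h)) <=
    4 * cabs (rect_int f p.1 (p.1 + l / 2) p.2 (p.2 + h / 2))].
Proof.
move=> l0 h0 H.
have := rect_int_split (m := a + l / 2) (n := c + h / 2) _ _ H.
rewrite !lerD2l !lerDl => ->; [|lra..].
have e1 : a + l = a + l / 2 + l / 2 by lra.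
have e2 : c + h = c + h / 2 + h / 2 by lra.
rewrite e1 e2.
set I1 := rect_int _ _ _ _ _; set I2 := rect_int _ _ _ _ _.
set I3 := rect_int _ _ _ _ _; set I4 := rect_int _ _ _ _ _.
have tri : cabs (I1 + I2 + I3 + I4) <= cabs I1 + cabs I2 + cabs I3 + cabs I4.
  apply: (le_trans (cabsD _ _)); rewrite lerD2r.
  by apply: (le_trans (cabsD _ _)); rewrite lerD2r cabsD.
have [h1|h1] := leP (cabs (I1 + I2 + I3 + I4)) (4 * cabs I1).
  by exists (a, c); split => //=; left.
have [h2|h2] := leP (cabs (I1 + I2 + I3 + I4)) (4 * cabs I2).
  by exists (a + l / 2, c); split => //=; [right|left].
have [h3|h3] := leP (cabs (I1 + I2 + I3 + I4)) (4 * cabs I3).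
  by exists (a, c + h / 2); split => //=; [left|right].
have [h4|h4] := leP (cabs (I1 + I2 + I3 + I4)) (4 * cabs I4).
  by exists (a + l / 2, c + h / 2); split => //=; right.
by exfalso; lra.
Qed.

(** The quarters chosen successively keep at least [4 ^- n] of the integral, whereas
    differentiability at their common point makes it of smaller order than that. *)
Lemma goursat f a b c d : a <= b -> c <= d -> rect_hol f a b c d ->
  rect_int f a b c d = 0.
Proof.
move=> ab cd H; apply/eqP/negPn; rewrite -cabs_gt0; apply/negP => k0.
pose l n := (b - a) / 2 ^+ n; pose h n := (d - c) / 2 ^+ n.
have l0 n : 0 <= l n by rewrite divr_ge0 ?subr_ge0// exprn_ge0.
have h0 n : 0 <= h n by rewrite divr_ge0 ?subr_ge0// exprn_ge0.
have lS n : l n / 2 = l n.+1 by rewrite /l exprS; field; rewrite expf_neq0.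
have hS n : h n / 2 = h n.+1 by rewrite /h exprS; field; rewrite expf_neq0.
pose I n (p : R * R) := rect_int f p.1 (p.1 + l n) p.2 (p.2 + h n).
pose hol n (p : R * R) := rect_hol f p.1 (p.1 + l n) p.2 (p.2 + h n).
(* The step index is part of the argument because the side lengths depend on it. Holomorphy is a
   premise, so that the sequence can be built before it is shown to stay in the rectangle. *)
have /choice[next nextP] : forall np : nat * (R * R), exists q : R * R,
  hol np.1 np.2 -> [/\ q.1 = np.2.1 \/ q.1 = np.2.1 + l np.1.+1,
    q.2 = np.2.2 \/ q.2 = np.2.2 + h np.1.+1 &
    cabs (I np.1 np.2) <= 4 * cabs (I np.1.+1 q)].
  move=> [n p]/=; have [hp|hp] := pselect (hol n p); last by exists p => /hp.
  have [q] := goursat_quarter (l0 n) (h0 n) hp.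
  by rewrite lS hS => ?; exists q.
pose p := fix p n := if n is m.+1 then next (m, p m) else (a, c).
have hb : b = a + l 0%N by rewrite /l expr0; lra.
have hd : d = c + h 0%N by rewrite /h expr0; lra.
have holp n : hol n (p n).
  elim: n => [|n IH]; first by rewrite /hol/= -hb -hd.
  have [/= q1 q2 _] := nextP (n, p n) IH.
  apply: rect_holS IH; rewrite -?lS -?hS.
  - by case: q1 => ->; have := l0 n; rewrite -?lS; lra.
  - by case: q1 => ->; have := l0 n; rewrite -?lS; lra.
  - by case: q2 => ->; have := h0 n; rewrite -?hS; lra.
  - by case: q2 => ->; have := h0 n; rewrite -?hS; lra.
have stepp n := nextP (n, p n) (holp n).
have Ige n : cabs (rect_int f a b c d) <= 4 ^+ n * cabs (I n (p n)).
  elim: n => [|n IH]; first by rewrite expr0 mul1r /I/= -hb -hd.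
  apply: (le_trans IH); rewrite exprSr -mulrA ler_wpM2l ?exprn_ge0//.
  by have [] := stepp n.
have [x xP] : exists x, forall n, (p n).1 <= x <= (p n).1 + l n.
  apply: (@nested_halvings (fun n => (p n).1) (b - a)); first by rewrite subr_ge0.
  by move=> n; have [] := stepp n.
have [y yP] : exists y, forall n, (p n).2 <= y <= (p n).2 + h n.
  apply: (@nested_halvings (fun n => (p n).2) (d - c)); first by rewrite subr_ge0.
  by move=> n; have [] := stepp n.
have [t ft] := holp 0%N x y (xP 0%N) (yP 0%N).
set k := cabs (rect_int f a b c d) in k0 Ige.
pose s := (b - a) + (d - c).
have s0 : 0 <= s by rewrite addr_ge0 ?subr_ge0.
(* This error leads to [k <= k * (s ^+ 2 / (2 * (s ^+ 2 + 1)))], which is absurd; the summand [1]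
   covers a rectangle reduced to a point. *)
have e0 : 0 < k / (8 * (s ^+ 2 + 1)).
  by rewrite divr_gt0// mulr_gt0// ltr_wpDl// sqr_ge0.
have [r r0 fr] := ft _ e0.
have [n nr] : exists n, s / 2 ^+ n < r.
  exists (Num.bound (s / r)); rewrite ltr_pdivrMr ?exprn_gt0// mulrC.
  by rewrite -ltr_pdivrMr//; exact: upper_nthrootP.
have sn : l n + h n = s / 2 ^+ n by rewrite /l /h -mulrDl.
set P := x +i* y in ft fr.
(* The affine approximation at [P] has the primitive [G], so subtracting it does not change the
   integral. *)
pose g w := f P + t * (w - P).
pose G w := (f P - t * P) * w + t / 2 * (w * w).
have Gg w : cderiv G w (g w).
  have idw := gderiv_id (id : C -> C) w.
  apply: (gderiv_eq (gderivD (gderivZ _ idw) (gderivZ _ (gderivM idw idw)))).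
  by rewrite /g; field.
have holg : rect_hol g (p n).1 ((p n).1 + l n) (p n).2 ((p n).2 + h n).
  move=> u v _ _; exists (0 + t * (1 - 0)).
  apply: gderivD; [exact: gderiv_cst|apply: gderivZ; apply: gderivB].
    exact: gderiv_id.
  exact: gderiv_cst.
have le1 : (p n).1 <= (p n).1 + l n by rewrite lerDl.
have le2 : (p n).2 <= (p n).2 + h n by rewrite lerDl.
have Ig : I n (p n) = rect_int (fun z => f z - g z) (p n).1 ((p n).1 + l n)
    (p n).2 ((p n).2 + h n).
  rewrite rect_intB//; last exact: holp.
  by rewrite (rect_int_primitive le1 le2 holg Gg) subr0.
have Ile : cabs (I n (p n)) <=
    4 * (k / (8 * (s ^+ 2 + 1)) * (s / 2 ^+ n) * (s / 2 ^+ n)).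
  rewrite Ig -{2}sn.
  have -> : l n + h n = ((p n).1 + l n - (p n).1) + ((p n).2 + h n - (p n).2) by lra.
  apply: rect_int_le => //.
    move=> u v uH vH; have [t1 ht1] := holp n u v uH vH.
    by have [t2 ht2] := holg u v uH vH; exists (t1 - t2); exact: gderivB.
  move=> u v uH vH.
  have uv : cabs ((u +i* v) - P) <= s / 2 ^+ n.
    rewrite (le_trans (cabs_le_ReIm _))//= -sn lerD//.
      by have := xP n; rewrite ler_norml; lra.
    by have := yP n; rewrite ler_norml; lra.
  have := fr (u +i* v) (le_lt_trans uv nr); rewrite /g opprD addrA.
  by move/le_trans; apply; rewrite ler_wpM2l// ltW.
have := Ige n; apply/negP; rewrite -ltNge.
apply: (@le_lt_trans _ _ (4 ^+ n * (4 * (k / (8 * (s ^+ 2 + 1)) * (s / 2 ^+ n) * (s / 2 ^+ n))))).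
  by rewrite ler_wpM2l// exprn_ge0.
have s1 : 0 < s ^+ 2 + 1 by rewrite ltr_wpDl// sqr_ge0.
have p4 : 4 ^+ n = (2 ^+ n) ^+ 2 :> R by rewrite -exprM mulnC exprM; congr (_ ^+ _); ring.
have -> : 4 ^+ n * (4 * (k / (8 * (s ^+ 2 + 1)) * (s / 2 ^+ n) * (s / 2 ^+ n))) =
  k * (s ^+ 2 / (2 * (s ^+ 2 + 1))).
  by rewrite p4; field; rewrite expf_neq0//= gt_eqF.
rewrite gtr_pMr// ltr_pdivrMr ?mulr_gt0//.
by have := sqr_ge0 s => ?; lra.
Qed.

End goursat.

(** * The complex exponential *)

Section complex_exponential.
Variable R : realType.
Local Notation C := R[i].
Implicit Types (z w : C) (x y : R).

Definition cis y : C := cos y +i* sin y.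
Definition cexp z : C := (expR (complex.Re z))%:C * cis (complex.Im z).

Lemma cis0 : cis 0 = 1.
Proof. by rewrite /cis cos0 sin0. Qed.

Lemma cisD x y : cis (x + y) = cis x * cis y.
Proof.
apply: complex_eq; rewrite ?cReM ?cImM/=; first by rewrite cosD.
by rewrite sinD addrC; ring.
Qed.

Lemma cis2pi : cis (2 * pi) = 1.
Proof. by rewrite /cis mulr_natl cos2pi sin2pi. Qed.

Lemma cabs_cis y : cabs (cis y) = 1.
Proof. by rewrite cabs_sqrt/= cos2Dsin2 sqrtr1. Qed.

Lemma cis_neq0 y : cis y != 0.
Proof. by rewrite -cabs_gt0 cabs_cis. Qed.

Lemma cexp0 : cexp 0 = 1.
Proof. by rewrite /cexp/= expR0 cis0 mulr1. Qed.

Lemma cexpD z w : cexp (z + w) = cexp z * cexp w.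
Proof. by rewrite /cexp cReD cImD cisD expRD rmorphM/=; ring. Qed.

Lemma cabs_cexp z : cabs (cexp z) = expR (complex.Re z).
Proof. by rewrite /cexp cabsM cabs_cis mulr1 cabs_real ger0_norm// expR_ge0. Qed.

Lemma cexp_neq0 z : cexp z != 0.
Proof. by rewrite -cabs_gt0 cabs_cexp expR_gt0. Qed.

Lemma cexpN z : cexp (- z) = (cexp z)^-1.
Proof.
apply: (mulfI (cexp_neq0 z)); rewrite -cexpD subrr cexp0 divff//.
exact: cexp_neq0.
Qed.

(** The addition law reduces the claim to the point [0], where the real derivatives of [expR], [cos]
    and [sin] give it. *)
Lemma cderiv_cexp z : cderiv cexp z (cexp z).
Proof.
have e1 : 0 < expR (1 : R) by exact: expR_gt0.
have cz := cabs_ge0 (cexp z).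
apply: (@gderiv_bigeps _ _ _ _ _ _ (cabs (cexp z) * (2 + 2 * expR 1))).
  by rewrite mulr_ge0// addr_ge0// mulr_ge0// ltW.
move=> e e0 _.
have dexp := is_derive_expR (0 : R); rewrite expR0 in dexp.
have dcos := is_derive_cos (0 : R); rewrite sin0 oppr0 in dcos.
have dsin := is_derive_sin (0 : R); rewrite cos0 in dsin.
have [r1 r10 h1] := (is_derive_eps _ _ _).1 dexp _ e0.
have [r2 r20 h2] := (is_derive_eps _ _ _).1 dcos _ e0.
have [r3 r30 h3] := (is_derive_eps _ _ _).1 dsin _ e0.
have [r4 r40 h4] := (is_derive_eps _ _ _).1 dexp _ ltr01.
exists (Num.min (Num.min r1 r2) (Num.min (Num.min r3 r4) (Num.min 1 (e / 2)))).
  by rewrite !lt_min r10 r20 r30 r40 ltr01 divr_gt0.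
move=> w /=; rewrite !lt_min => /andP[/andP[w1 w2] /andP[/andP[w3 w4] /andP[w5 w6]]].
have -> : cexp w - cexp z - cexp z * (w - z) =
    cexp z * (cexp (w - z) - 1 - (w - z)).
  have -> : cexp w = cexp z * cexp (w - z) by rewrite -cexpD addrC subrK.
  by ring.
rewrite cabsM -!mulrA ler_wpM2l//.
move: (w - z) w1 w2 w3 w4 w5 w6 => h w1 w2 w3 w4 w5 w6.
have [hx hy] := (Re_le_cabs h, Im_le_cabs h).
set x := complex.Re h in hx *; set y := complex.Im h in hy *.
have := h1 x; have := h2 y; have := h3 y; have := h4 x.
rewrite !subr0 sin0 cos0 expR0 !mul1r mul0r !subr0.
move=> /(_ (le_lt_trans hx w4)) g4 /(_ (le_lt_trans hy w3)) g3.
move=> /(_ (le_lt_trans hy w2)) g2 /(_ (le_lt_trans hx w1)) g1.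
apply: (le_trans (cabs_le_ReIm _)).
have ex : expR x <= expR 1.
  by rewrite ler_expR; move: hx; rewrite ler_norml => /andP[_ /le_trans]; apply; exact: ltW.
have ex0 := expR_ge0 x.
have -> : complex.Re (cexp h - 1 - h) = (expR x - 1 - x) + expR x * (cos y - 1).
  rewrite !cReB (_ : complex.Re (cexp h) = expR x * cos y); last first.
    by rewrite cReM/= mul0r subr0.
  by rewrite (_ : complex.Re 1 = 1 :> R)// -/x; ring.
have -> : complex.Im (cexp h - 1 - h) = (expR x - 1) * y + expR x * (sin y - y).
  rewrite !cImB (_ : complex.Im (cexp h) = expR x * sin y); last first.
    by rewrite cImM/= mul0r addr0.
  by rewrite (_ : complex.Im 1 = 0 :> R)// -/y; ring.
have q1 := ler_normD (expR x - 1 - x) (expR x * (cos y - 1)).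
have q2 := ler_normD ((expR x - 1) * y) (expR x * (sin y - y)).
have q3 : `|expR x * (cos y - 1)| <= expR 1 * (e * cabs h).
  rewrite normrM ger0_norm// ler_pM//; apply: (le_trans g2).
  by rewrite ler_wpM2l// ltW.
have q4 : `|expR x * (sin y - y)| <= expR 1 * (e * cabs h).
  rewrite normrM ger0_norm// ler_pM//; apply: (le_trans g3).
  by rewrite ler_wpM2l// ltW.
have q5 : `|(expR x - 1) * y| <= e * cabs h.
  rewrite normrM ler_pM//.
  have := ler_normD (expR x - 1 - x) x; rewrite subrK => /le_trans; apply.
  by lra.
have q6 : `|expR x - 1 - x| <= e * cabs h.
  by apply: (le_trans g1); rewrite ler_wpM2l// ltW.
by apply: (le_trans (lerD q1 q2)); lra.
Qed.

End complex_exponential.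

(** * Cauchy's formulas on circles *)

Section cauchy.
Variable R : realType.
Local Notation C := R[i].
Implicit Types (f : C -> C) (a z : C) (r s : R).

Definition hol f a r := forall z, cabs (z - a) < r -> exists d, cderiv f z d.

Lemma hol_cder f a r z : hol f a r -> cabs (z - a) < r -> cderiv f z (cder f z).
Proof. by move=> H /H /cderP. Qed.

Lemma hol_sub f a r b s : (forall z, cabs (z - b) < s -> cabs (z - a) < r) ->
  hol f a r -> hol f b s.
Proof. by move=> S H z /S /H. Qed.

Lemma disc_sub a b r s z : cabs (b - a) + s <= r -> cabs (z - b) < s ->
  cabs (z - a) < r.
Proof.
by move=> h1 h2; apply: le_lt_trans (cabs_dist_tri b _ _) _; lra.
Qed.

Lemma cis_path (r x : R) : rderiv (fun y => r%:C * cis y) x (r%:C * ('i * cis x)).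
Proof.
apply: gderivZ.
apply: (gderiv_eq (rderiv_pair (is_derive_cos _) (is_derive_sin _))).
by apply: complex_eq; rewrite ?cReM ?cImM/=; ring.
Qed.

(** The exponential maps a rectangle of height [2 * pi] onto the annulus. In Goursat's theorem for
    [f \o cexp] the horizontal sides cancel by periodicity and the vertical ones are the two
    circles. A singularity at the centre is allowed. *)
Lemma circle_mean_const f r s : 0 < r -> r <= s ->
  (forall z, r <= cabs z <= s -> exists d, cderiv f z d) ->
  cint 0 (2 * pi) (fun y => f (r%:C * cis y)) =
  cint 0 (2 * pi) (fun y => f (s%:C * cis y)).
Proof.
move=> r0 rs H; have s0 := lt_le_trans r0 rs.
have pi0 : 0 <= 2 * pi :> R by rewrite mulr_ge0// pi_ge0.
have cexpE (t y : R) : 0 < t -> cexp (ln t +i* y) = t%:C * cis y.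
  by move=> t0; rewrite /cexp/= lnK.
have hF : rect_hol (fun w => f (cexp w)) (ln r) (ln s) 0 (2 * pi).
  move=> x y /andP[x1 x2] _.
  have [|d hd] := H (cexp (x +i* y)).
    rewrite cabs_cexp/=; apply/andP; split.
      by rewrite -(lnK r0) ler_expR.
    by rewrite -(lnK s0) ler_expR.
  by exists (d * cexp (x +i* y)); apply: (gderiv_comp (cderiv_cexp _) hd).
have := goursat _ pi0 hF; rewrite ler_ln// => /(_ rs).
rewrite /rect_int.
rewrite (@eq_cint _ _ _ (fun x => f (cexp (x +i* (2 * pi)))) (fun x => f (cexp (x +i* 0)))).
  set A := cint _ _ _; set B := cint _ _ _; set D := cint _ _ _ => E0.
  have E1 : 'i * (B - D) = 0 by rewrite -E0; ring.
  have E : B = D.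
    apply/eqP; rewrite -subr_eq0 -cabs_eq0.
    by have := congr1 (@cabs R) E1; rewrite cabsM cabs_i mul1r cabs0 => ->.
  rewrite (@eq_cint _ _ _ (fun y => f (r%:C * cis y)) (fun y => f (cexp (ln r +i* y)))).
    rewrite (@eq_cint _ _ _ (fun y => f (s%:C * cis y)) (fun y => f (cexp (ln s +i* y)))).
      exact: (esym E).
    by move=> y _; rewrite cexpE.
  by move=> y _; rewrite cexpE.
by move=> x _; rewrite /cexp/= cis2pi cis0.
Qed.

Lemma cabs_small_eq0 (z : C) (K : R) : 0 <= K ->
  (forall e : R, 0 < e -> cabs z <= K * e) -> z = 0.
Proof.
move=> K0 H; apply/eqP; rewrite -cabs_eq0 eq_le cabs_ge0 andbT.
apply/ler_addgt0Pr => e e0; rewrite add0r.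
have K1 : 0 < K + 1 by rewrite ltr_pwDr.
apply: (le_trans (H (e / (K + 1)) _)); first by rewrite divr_gt0.
by rewrite mulrCA ger_pMr// ler_pdivrMr// mul1r lerDl.
Qed.

Lemma cabs_scaled_cis r y : 0 <= r -> cabs (r%:C * cis y) = r.
Proof. by move=> r0; rewrite cabsM cabs_cis mulr1 cabs_real ger0_norm. Qed.

Let pi2 : C := (2 * pi)%:C.

Let pi_pos : 0 < 2 * pi :> R.
Proof. by rewrite mulr_gt0// pi_gt0. Qed.

Lemma rdble_circle f r (a : C) : 0 <= r ->
  (forall z, cabs (z - a) = r -> exists d, cderiv f z d) ->
  rdble 0 (2 * pi) (fun y => f (a + r%:C * cis y)).
Proof.
move=> r0 H x _; have [|d hd] := H (a + r%:C * cis x).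
  by rewrite addrC addKr cabs_scaled_cis.
exists (d * (0 + r%:C * ('i * cis x))).
exact: (gderiv_comp (gderivD (gderiv_cst _ a x) (cis_path r x)) hd).
Qed.

Lemma cint_circle_cst (c : C) : cint 0 (2 * pi) (fun=> c) = pi2 * c.
Proof.
rewrite (cint_FTC (G := fun y => y%:C * c)) ?ltW//.
- by rewrite mul0r subr0.
- by move=> x _; exists 0; exact: gderiv_cst.
move=> x _; apply: (gderiv_eq (gderivM (gderiv_id _ x) (gderiv_cst _ c x))).
by rewrite mul1r mulr0 addr0.
Qed.

(** The mean is independent of the radius, and on a small circle [f] is close to [f a]. *)
Lemma mean_value f a r s : 0 < s < r -> hol f a r ->
  cint 0 (2 * pi) (fun y => f (a + s%:C * cis y)) = pi2 * f a.
Proof.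
move=> /andP[s0 sr] H; apply/eqP; rewrite -subr_eq0; apply/eqP.
apply: (@cabs_small_eq0 _ (2 * (2 * pi))); first by rewrite mulr_ge0// ltW.
move=> e e0; have ra : cabs (a - a) < r by rewrite subrr cabs0 (lt_trans s0).
have [d hd] := H _ ra; have [t t0 ft] := gderiv_cont hd e0.
pose u := Num.min s (t / 2).
have u0 : 0 < u by rewrite lt_min s0 divr_gt0.
have us : u <= s by rewrite ge_min lexx.
have ut : u < t by rewrite /u gt_min; apply/orP; right; lra.
rewrite -(@circle_mean_const (fun w => f (a + w)) u s u0 us); last first.
  move=> z /andP[_ zs]; have [|l hl] := H (a + z).
    by rewrite addrC addKr (le_lt_trans zs).
  exists (l * (0 + 1)).
  exact: (gderiv_comp (gderivD (gderiv_cst _ a z) (gderiv_id _ z)) hl).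
have hu : rdble 0 (2 * pi) (fun y => f (a + u%:C * cis y)).
  apply: rdble_circle; first exact: ltW.
  by move=> z zu; apply: H; rewrite zu (le_lt_trans us).
have hc : rdble 0 (2 * pi) (fun=> f a) by move=> x _; exists 0; exact: gderiv_cst.
rewrite -cint_circle_cst -cintB//.
rewrite (_ : 2 * (2 * pi) * e = 2 * (e * (2 * pi - 0))); last by ring.
apply: cint_le; first exact: ltW.
  move=> x hx; have [p hp] := hu x hx; have [q hq] := hc x hx.
  by exists (p - q); exact: gderivB.
move=> x _; apply/ltW/ft.
by rewrite /= addrC addKr (cabs_scaled_cis _ (ltW u0)).
Qed.

(** The mean of [f (a + w) / w] is independent of the radius. On a small circle this function is
    close to [f a / w + cder f a], whose first term has mean [0]. *)
Lemma cauchy_derivative f a r s : 0 < s < r -> hol f a r ->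
  cint 0 (2 * pi) (fun y => f (a + s%:C * cis y) / (s%:C * cis y)) =
  pi2 * cder f a.
Proof.
move=> /andP[s0 sr] H.
have neq0 (z : C) (t : R) : 0 < t -> t <= cabs z -> z != 0.
  by move=> t0 tz; rewrite -cabs_gt0 (lt_le_trans t0).
(* The mean of [w^-1] is independent of the radius, yet it is halved when the radius doubles. *)
have inv0 : cint 0 (2 * pi) (fun y => (1%:C * cis y)^-1) = 0 :> C.
  have := @circle_mean_const GRing.inv 1 2 ltr01 _ _.
  rewrite (@eq_cint _ _ _ (fun y => (2%:C * cis y)^-1)
    (fun y => 2%:C^-1 * (1%:C * cis y)^-1)); last first.
    by move=> y _; rewrite mul1r invfM.
  rewrite cintZ; last first.
    move=> x _; eexists; apply: (cderivV (cis_path 1 x)).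
    by rewrite mul1r cis_neq0.
  set J := cint _ _ _ => E; have {}E : J = 2%:C^-1 * J.
    apply: E; first by rewrite ler1n.
    move=> z /andP[z1 _]; eexists; apply: cderiv_inv; exact: neq0 z1.
  have : J * (1 - 2%:C^-1) = 0 by rewrite mulrBr mulr1 mulrC -E subrr.
  move/eqP; rewrite mulf_eq0 => /orP[/eqP //|].
  rewrite -fmorphV -(rmorph1 (real_complex R)) -rmorphB/= fmorph_eq0.
  by move=> /eqP h; exfalso; lra.
apply/eqP; rewrite -subr_eq0; apply/eqP.
apply: (@cabs_small_eq0 _ (2 * (2 * pi))); first by rewrite mulr_ge0// ltW.
move=> e e0; have ra : cabs (a - a) < r by rewrite subrr cabs0 (lt_trans s0).
have [t t0 ft] := hol_cder H ra e0.
pose u := Num.min s (t / 2).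
have u0 : 0 < u by rewrite lt_min s0 divr_gt0.
have us : u <= s by rewrite ge_min lexx.
have ut : u < t by rewrite /u gt_min; apply/orP; right; lra.
have shift z : cabs z <= s -> exists d, cderiv (fun w => f (a + w)) z d.
  move=> zs; have [|l hl] := H (a + z); first by rewrite addrC addKr (le_lt_trans zs).
  exists (l * (0 + 1)).
  exact: (gderiv_comp (gderivD (gderiv_cst _ a z) (gderiv_id _ z)) hl).
rewrite -(@circle_mean_const (fun w => f (a + w) / w) u s u0 us); last first.
  move=> z /andP[uz zs]; have [d hd] := shift z zs.
  eexists; apply: (gderiv_div hd (gderiv_id _ z)); exact: neq0 uz.
have uc y : u%:C * cis y != 0 by rewrite -cabs_gt0 cabs_scaled_cis// ltW.
have hu : rdble 0 (2 * pi) (fun y => f (a + u%:C * cis y) / (u%:C * cis y)).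
  move=> x _; have [|d hd] := shift (u%:C * cis x); first by rewrite cabs_scaled_cis// ltW.
  eexists; exact: (gderiv_div (gderiv_comp (cis_path _ _) hd) (cis_path u x) (uc x)).
have hi : rdble 0 (2 * pi) (fun y => f a / u%:C * (1%:C * cis y)^-1).
  move=> x _; eexists; apply: gderivZ; apply: (cderivV (cis_path 1 x)).
  by rewrite mul1r cis_neq0.
have hc : rdble 0 (2 * pi) (fun=> cder f a) by move=> x _; exists 0; exact: gderiv_cst.
have hd : rdble 0 (2 * pi) (fun y => f (a + u%:C * cis y) / (u%:C * cis y)
    - f a / u%:C * (1%:C * cis y)^-1).
  move=> x hx; have [p hp] := hu x hx; have [q hq] := hi x hx.
  by exists (p - q); exact: gderivB.
(* The vanishing integral [inv0], scaled by [f a / u], is inserted to turn the integrand into the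
   difference quotient [(f (a + w) - f a) / w]. *)
rewrite -cint_circle_cst -[X in X - _]subr0 -(mulr0 (f a / u%:C)) -inv0 -cintZ; last first.
  move=> x _; eexists; apply: (cderivV (cis_path 1 x)).
  by rewrite mul1r cis_neq0.
rewrite -cintB// -cintB//.
rewrite (_ : 2 * (2 * pi) * e = 2 * (e * (2 * pi - 0))); last by ring.
apply: cint_le; first exact: ltW.
  move=> x hx; have [p hp] := hd x hx; have [q hq] := hc x hx.
  by exists (p - q); exact: gderivB.
move=> x _; have := ft (a + u%:C * cis x); rewrite /= [X in X - a]addrC addrK.
rewrite (cabs_scaled_cis _ (ltW u0)) => /(_ ut) h.
rewrite -(@ler_pM2r _ u)//; apply: le_trans h.
rewrite -[X in _ * X <= _](@cabs_scaled_cis u x (ltW u0)) -cabsM.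
rewrite le_eqVlt; apply/orP; left; apply/eqP; congr cabs.
by field; rewrite cis_neq0/= -(rmorph0 (real_complex R)) (inj_eq (@complexI R)) gt_eqF.
Qed.

Lemma mean_value_le f a r s M : 0 < s < r -> hol f a r ->
  (forall z, cabs (z - a) = s -> cabs (f z) <= M) -> cabs (f a) <= 2 * M.
Proof.
move=> /andP[s0 sr] H HM.
rewrite -(@ler_pM2l _ (2 * pi))//.
rewrite (_ : 2 * pi * (2 * M) = 2 * (M * (2 * pi - 0))); last by ring.
rewrite -[X in X * _](@ger0_norm _ (2 * pi)) ?(ltW pi_pos)// -cabs_real -cabsM.
rewrite -(@mean_value f a r s) ?s0//; apply: cint_le; first exact: ltW.
  apply: rdble_circle; first exact: ltW.
  by move=> z zs; apply: H; rewrite zs.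
by move=> x _; apply: HM; rewrite addrC addKr (cabs_scaled_cis _ (ltW s0)).
Qed.

(** The circle of radius [r / 2] and the factor [2] of [cint_le] together give the constant [4]. *)
Lemma cauchy_estimate f a r M : 0 < r -> hol f a r ->
  (forall z, cabs (z - a) < r -> cabs (f z) <= M) -> cabs (cder f a) <= 4 * M / r.
Proof.
move=> r0 H HM; pose s := r / 2.
have s0 : 0 < s by rewrite divr_gt0.
have sr : s < r by rewrite /s; lra.
rewrite -(@ler_pM2l _ (2 * pi))//.
have -> : 2 * pi * (4 * M / r) = 2 * (M / s * (2 * pi - 0)).
  by rewrite /s; field; rewrite gt_eqF.
rewrite -[X in X * _](@ger0_norm _ (2 * pi)) ?(ltW pi_pos)// -cabs_real -cabsM.
rewrite -(@cauchy_derivative f a r s) ?s0//; apply: cint_le; first exact: ltW.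
  have : rdble 0 (2 * pi) (fun y => f (a + s%:C * cis y)).
    apply: rdble_circle; first exact: ltW.
    by move=> z zs; apply: H; rewrite zs.
  move=> h x /h[d hd]; eexists; apply: (gderiv_div hd (cis_path s x)).
  by rewrite -cabs_gt0 cabs_scaled_cis// ltW.
move=> x _; rewrite cabsM cabsV (cabs_scaled_cis _ (ltW s0)) ler_wpM2r ?invr_ge0 ?(ltW s0)//.
by apply: HM; rewrite addrC addKr (cabs_scaled_cis _ (ltW s0)).
Qed.

End cauchy.

(** * Lipschitz and Taylor estimates; the derivative is holomorphic *)

Section cauchy_consequences.
Variable R : realType.
Local Notation C := R[i].
Implicit Types (f : C -> C) (a z u v : C) (r s : R).

Lemma natmul_div_ge0 (n : nat) (x y : R) : 0 <= x -> 0 <= y -> 0 <= n%:R * x / y.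
Proof. by move=> x0 y0; rewrite divr_ge0// mulr_ge0. Qed.

Lemma segment_path u v (t : R) : rderiv (fun t => v + t%:C * (u - v)) t (u - v).
Proof.
apply: (gderiv_eq (gderivD (gderiv_cst _ v t)
  (gderivM (gderiv_id _ t) (gderiv_cst _ (u - v) t)))).
by rewrite mul1r mulr0 addr0 add0r.
Qed.

(** The real mean value theorem applies to the real and imaginary parts, at two different points of
    the segment; hence the factor [2]. *)
Lemma mean_value_inequality f u v (L : R) :
  (forall t : R, 0 <= t <= 1 -> (exists d, cderiv f (v + t%:C * (u - v)) d) /\
    cabs (cder f (v + t%:C * (u - v))) <= L) ->
  cabs (f u - f v) <= 2 * L * cabs (u - v).
Proof.
move=> H; pose F (t : R) := f (v + t%:C * (u - v)).
pose G (t : R) := cder f (v + t%:C * (u - v)) * (u - v).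
have FG t : 0 <= t <= 1 -> rderiv F t (G t).
  by case/H => /cderP hd _; exact: (gderiv_comp (segment_path u v t) hd).
have [c1 c2] : {within `[0, 1], continuous (fun t => complex.Re (F t))} /\
    {within `[0, 1], continuous (fun t => complex.Im (F t))}.
  by apply: rdble_within => t /FG; exists (G t).
have GL t : 0 <= t <= 1 -> cabs (G t) <= L * cabs (u - v).
  by case/H => _ h; rewrite cabsM ler_wpM2r// cabs_ge0.
have F1 : F 1 = f u by rewrite /F mul1r addrC subrK.
have F0 : F 0 = f v by rewrite /F mul0r addr0.
have [|t tI E1] := MVT_segment ler01 _ c1 (df := fun t => complex.Re (G t)).
  move=> t; rewrite in_itv/= => /andP[t0 t1].
  by apply/rderiv_Re/FG; rewrite !ltW.
have [|x xI E2] := MVT_segment ler01 _ c2 (df := fun t => complex.Im (G t)).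
  move=> x; rewrite in_itv/= => /andP[t0 t1].
  by apply/rderiv_Im/FG; rewrite !ltW.
rewrite !in_itv/= in tI xI.
apply: (le_trans (cabs_le_ReIm _)); rewrite -F1 -F0 cReB cImB E1 E2.
rewrite subr0 !mulr1 -mulrA mulr_natl mulr2n lerD//.
  by apply: le_trans (Re_le_cabs _) (GL _ _).
by apply: le_trans (Im_le_cabs _) (GL _ _).
Qed.

Lemma disc_convex a r u v (t : R) : cabs (u - a) < r -> cabs (v - a) < r ->
  0 <= t <= 1 -> cabs (v + t%:C * (u - v) - a) < r.
Proof.
move=> hu hv /andP[t0 t1].
have -> : v + t%:C * (u - v) - a = (1 - t)%:C * (v - a) + t%:C * (u - a).
  by rewrite rmorphB rmorph1; ring.
apply: (le_lt_trans (cabsD _ _)); rewrite !cabsM !cabs_real !ger0_norm ?subr_ge0//.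
pose m := Num.max (cabs (v - a)) (cabs (u - a)).
have mr : m < r by rewrite gt_max hu hv.
have h1 : (1 - t) * cabs (v - a) <= (1 - t) * m.
  by rewrite ler_wpM2l ?subr_ge0// le_max lexx.
have h2 : t * cabs (u - a) <= t * m by rewrite ler_wpM2l// le_max lexx orbT.
lra.
Qed.

Lemma segment_dist u v (t : R) : 0 <= t <= 1 ->
  cabs (v + t%:C * (u - v) - v) <= cabs (u - v).
Proof.
move=> /andP[t0 t1]; rewrite addrC addKr cabsM cabs_real ger0_norm//.
by rewrite ler_piMl// cabs_ge0.
Qed.

Lemma hol_lipschitz f a r L u v : hol f a r ->
  (forall z, cabs (z - a) < r -> cabs (cder f z) <= L) ->
  cabs (u - a) < r -> cabs (v - a) < r -> cabs (f u - f v) <= 2 * L * cabs (u - v).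
Proof.
move=> H HL hu hv; apply: mean_value_inequality => t tH.
have ht := disc_convex hu hv tH.
by split; [exact: H|exact: HL].
Qed.

Lemma hol_shift f a r h : hol f (a + h) r -> hol (fun z => f (z + h)) a r.
Proof.
move=> H z zr; have [|d hd] := H (z + h); first by rewrite opprD addrACA subrr addr0.
by exists (d * (1 + 0));
  exact: (gderiv_comp (gderivD (gderiv_id _ z) (gderiv_cst _ h z)) hd).
Qed.

Lemma cder_shift f z h : (exists d, cderiv f (z + h) d) ->
  cder (fun w => f (w + h)) z = cder f (z + h).
Proof.
move=> /cderP hd; apply: cder_val.
apply: (gderiv_eq (gderiv_comp (gderivD (gderiv_id _ z) (gderiv_cst _ h z)) hd)).
by rewrite addr0 mulr1.
Qed.

Section bounded.
Variables (f : C -> C) (a : C) (r M : R).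
Hypotheses (r0 : 0 < r) (Hf : hol f a r).
Hypothesis HM : forall z, cabs (z - a) < r -> cabs (f z) <= M.

Let M0 : 0 <= M.
Proof.
by apply: le_trans (cabs_ge0 (f a)) (HM _); rewrite subrr cabs0.
Qed.

Lemma cder_le_half z : cabs (z - a) < r / 2 -> cabs (cder f z) <= 8 * M / r.
Proof.
move=> zr; have -> : 8 * M / r = 4 * M / (r / 2) by field; rewrite gt_eqF.
have S w : cabs (w - z) < r / 2 -> cabs (w - a) < r by apply: disc_sub; rlra.
apply: cauchy_estimate; first by rewrite divr_gt0.
  exact: hol_sub Hf.
by move=> w /S /HM.
Qed.

Lemma hol_lip_half u v : cabs (u - a) < r / 2 -> cabs (v - a) < r / 2 ->
  cabs (f u - f v) <= 16 * M / r * cabs (u - v).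
Proof.
move=> hu hv; have -> : 16 * M / r = 2 * (8 * M / r) by ring.
apply: (@hol_lipschitz f a (r / 2)) => //; last exact: cder_le_half.
by apply: hol_sub Hf => z; apply: disc_sub; rewrite subrr cabs0; have := r0 => ?; lra.
Qed.

(** This is Cauchy's estimate on a disc of radius [r / 4] for [w |-> f (w + h) - f w], which is
    small by [hol_lip_half]. *)
Lemma cder_lip u v : cabs (u - a) < r / 4 -> cabs (v - a) < r / 4 ->
  cabs (cder f u - cder f v) <= 256 * M / r ^+ 2 * cabs (u - v).
Proof.
move=> hu hv; pose h := u - v.
have r40 : 0 < r / 4 by rewrite divr_gt0.
have uE : v + h = u by rewrite /h addrC subrK.
have S1 w : cabs (w - v) < r / 4 -> cabs (w - a) < r / 2.
  by apply: disc_sub; rlra.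
have S2 w : cabs (w - v) < r / 4 -> cabs (w + h - a) < r / 2.
  move=> wv; apply: (@disc_sub _ _ u _ (r / 4)); first by rlra.
  by rewrite (_ : w + h - u = w - v)// /h; ring.
have rpos : 0 < r := r0.
have S12 w : cabs (w - a) < r / 2 -> cabs (w - a) < r by move=> ?; rlra.
have hh : hol (fun w => f (w + h)) v (r / 4).
  apply: hol_shift; rewrite uE; apply: hol_sub Hf => z zu.
  by apply/S12/(@disc_sub _ _ u _ (r / 4)) => //; rlra.
have h0 : hol f v (r / 4) by apply: hol_sub Hf => z /S1 /S12.
have hg : hol (fun w => f (w + h) - f w) v (r / 4).
  move=> z zv; have [d hd] := hh z zv; have [d' hd'] := h0 z zv.
  by exists (d - d'); exact: gderivB.
have v0 : cabs (v - v) < r / 4 by rewrite subrr cabs0.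
have -> : cder f u - cder f v = cder (fun w => f (w + h) - f w) v.
  apply/esym/cder_val; apply: gderivB; last exact: hol_cder h0 v0.
  by rewrite -{1}uE -cder_shift; [exact: hol_cder hh v0|rewrite uE; apply/Hf/S12; rlra].
have -> : 256 * M / r ^+ 2 * cabs (u - v) =
    4 * (16 * M / r * cabs (u - v)) / (r / 4) by field; rewrite gt_eqF.
apply: cauchy_estimate => // z zv.
rewrite [in leRHS](_ : u - v = z + h - z); last by rewrite /h; ring.
by apply: hol_lip_half; [exact: S2|exact: S1].
Qed.

(** The mean value inequality is applied to [f] minus its linear part at [v]; [cder_lip] bounds the
    derivative of that difference. *)
Lemma taylor2 u v : cabs (u - a) < r / 4 -> cabs (v - a) < r / 4 ->
  cabs (f u - f v - cder f v * (u - v)) <= 512 * M / r ^+ 2 * cabs (u - v) ^+ 2.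
Proof.
move=> hu hv; pose g w := f w - cder f v * w.
have -> : f u - f v - cder f v * (u - v) = g u - g v by rewrite /g; ring.
have -> : 512 * M / r ^+ 2 * cabs (u - v) ^+ 2 =
  2 * (256 * M / r ^+ 2 * cabs (u - v)) * cabs (u - v) by ring.
apply: mean_value_inequality => t tH.
have ht := disc_convex hu hv tH; set z := v + _ in ht *.
have rpos : 0 < r := r0.
have hz : cderiv f z (cder f z) by apply: (hol_cder Hf); rlra.
have gz : cderiv g z (cder f z - cder f v).
  apply: (gderiv_eq (gderivB hz (gderivZ (cder f v) (gderiv_id _ z)))).
  by rewrite mulr1.
split; first by exists (cder f z - cder f v).
rewrite (cder_val gz); apply: le_trans (cder_lip ht hv) _.
apply: ler_wpM2l; last exact: segment_dist.
exact: natmul_div_ge0 M0 (sqr_ge0 _).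
Qed.

End bounded.

(** Completeness with a rate, for families indexed by small complex increments. In each coordinate
    the limit is the supremum of the lower estimates [p h - K * cabs h]. *)
Lemma cabs_complete (B : set C) (d : C -> C) (K : R) : B !=set0 ->
  (forall h k, B h -> B k -> cabs (d h - d k) <= K * (cabs h + cabs k)) ->
  exists l, forall h, B h -> cabs (d h - l) <= 2 * K * cabs h.
Proof.
move=> [k0 Bk0] H.
have lim (p : C -> R) : (forall h k, B h -> B k ->
    `|p h - p k| <= K * (cabs h + cabs k)) ->
    exists l, forall h, B h -> `|p h - l| <= K * cabs h.
  move=> Hp; pose A := [set p h - K * cabs h | h in B].
  have ubA k : B k -> ubound A (p k + K * cabs k).
    move=> Bk _ [h Bh <-]; have := Hp _ _ Bh Bk.
    by rewrite ler_norml => /andP[h1 h2]; rewrite mulrDr in h2; lra.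
  have A0 : A !=set0 by exists (p k0 - K * cabs k0), k0.
  have sA : has_sup A by split => //; exists (p k0 + K * cabs k0); exact: ubA.
  exists (sup A) => h Bh; rewrite ler_norml.
  have h1 : p h - K * cabs h <= sup A by apply: sup_upper_bound => //; exists h.
  have h2 : sup A <= p h + K * cabs h by apply: sup_le_ub => //; exact: ubA.
  by lra.
have [|x hx] := lim (fun h => complex.Re (d h)).
  move=> h k Bh Bk; rewrite -cReB; exact: le_trans (Re_le_cabs _) (H _ _ Bh Bk).
have [|y hy] := lim (fun h => complex.Im (d h)).
  move=> h k Bh Bk; rewrite -cImB; exact: le_trans (Im_le_cabs _) (H _ _ Bh Bk).
exists (x +i* y) => h Bh; apply: (le_trans (cabs_le_ReIm _)).
rewrite cReB cImB/= -mulrA mulr_natl mulr2n lerD//; [exact: hx|exact: hy].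
Qed.

(* The difference quotients of [f] converge uniformly to [cder f], so by the
   Cauchy estimate their derivatives form a Cauchy family. *)
Lemma hol_cder_hol f a r : hol f a r -> hol (cder f) a r.
Proof.
move=> Hf z zr; pose p := r - cabs (z - a).
have [d0 hd0] := Hf z zr; have [t t0 ft] := gderiv_lip hd0.
pose q := Num.min p t; have q0 : 0 < q by rewrite lt_min t0 subr_gt0 zr.
have Hz : hol f z q.
    apply: hol_sub Hf => w; apply: disc_sub.
  by have : q <= p by [rewrite ge_min lexx]; rewrite /p => ?; lra.
pose M := cabs (f z) + (cabs d0 + 1) * q.
have HM w : cabs (w - z) < q -> cabs (f w) <= M.
  move=> wq; have wt : cabs (w - z) < t.
    by apply: lt_le_trans wq _; rewrite ge_min lexx orbT.
  have := ft w wt => /= h; have := cabsB_ge (f w) (f z).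
  have : (cabs d0 + 1) * cabs (w - z) <= (cabs d0 + 1) * q.
    by rewrite ler_wpM2l ?ltW// ltr_wpDl ?cabs_ge0.
  by rewrite /M => ? ?; rlra.
pose K := 512 * M / q ^+ 2.
have q80 : 0 < q / 8 by rewrite divr_gt0.
pose B := [set h : C | h != 0 /\ cabs h < q / 8].
have S1 w : cabs (w - z) < q / 8 -> cabs (w - z) < q / 4 by move=> ?; lra.
have S2 w h : B h -> cabs (w - z) < q / 8 -> cabs (w + h - z) < q / 4.
  move=> [_ hq] wz; rewrite addrAC (le_lt_trans (cabsD _ _))//; lra.
have S3 w : cabs (w - z) < q / 4 -> cabs (w - z) < q by move=> ?; lra.
pose Q h w := h^-1 * (f (w + h) - f w).
have QE h w : B h -> cabs (w - z) < q / 8 -> cabs (Q h w - cder f w) <= K * cabs h.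
  move=> Bh wz; have h0 : h != 0 by case: Bh.
  have ch : 0 < cabs h by rewrite cabs_gt0.
  have := taylor2 q0 Hz HM (S2 _ _ Bh wz) (S1 _ wz).
  rewrite [w + h]addrC addrK -/K => T.
  rewrite -(ler_pM2r ch) -cabsM.
  rewrite (_ : (Q h w - cder f w) * h = f (h + w) - f w - cder f w * h).
    by rewrite -mulrA -expr2.
  by rewrite /Q [w + h]addrC; field.
have dQ h w : B h -> cabs (w - z) < q / 8 ->
    cderiv (Q h) w (h^-1 * (cder f (w + h) - cder f w)).
  move=> Bh wz; apply: gderivZ; apply: gderivB.
    have hd := hol_cder Hz (S3 _ (S2 _ _ Bh wz)).
    apply: (gderiv_eq (gderiv_comp (gderivD (gderiv_id _ w) (gderiv_cst _ h w)) hd)).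
    by rewrite addr0 mulr1.
  exact: hol_cder Hz (S3 _ (S1 _ wz)).
have zz : cabs (z - z) < q / 8 by rewrite subrr cabs0.
(* [d h] is the difference quotient of [cder f] at [z] and also the derivative of [Q h] there; the
   second reading gives access to Cauchy's estimate for [d h - d k]. *)
pose d h := h^-1 * (cder f (z + h) - cder f z).
have K0 : 0 <= K.
  have := le_trans (cabs_ge0 _) (HM z _); rewrite subrr cabs0 => /(_ q0) M0.
  exact: natmul_div_ge0 M0 (sqr_ge0 _).
have Kq0 : 0 <= 32 * K / q by apply: natmul_div_ge0; [exact: K0|exact: ltW].
have [|h k Bh Bk|l hl] := @cabs_complete B d (32 * K / q).
- exists (q / 16)%:C; split; last by rewrite cabs_real ger0_norm; lra.
  by rewrite -cabs_gt0 cabs_real normr_gt0; apply/eqP => ?; lra.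
- have -> : d h - d k = cder (fun w => Q h w - Q k w) z.
    by apply/esym/cder_val; apply: gderivB; exact: dQ.
  have -> : 32 * K / q * (cabs h + cabs k) = 4 * (K * (cabs h + cabs k)) / (q / 8).
    by field; rewrite gt_eqF.
  apply: cauchy_estimate => //.
    by move=> w wz; eexists; apply: gderivB; exact: dQ.
  move=> w wz; rewrite (_ : Q h w - Q k w = (Q h w - cder f w) - (Q k w - cder f w)).
    by rewrite (le_trans (cabsB _ _))// mulrDr lerD// QE.
  by ring.
exists l; apply: (@gderiv_bigeps _ _ _ _ _ _ (2 * (32 * K / q))).
  by apply: mulr_ge0; [exact: ler0n|exact: Kq0].
move=> e e0 _; exists (Num.min e (q / 8)); first by rewrite lt_min e0.
move=> w /=; rewrite lt_min => /andP[we wq].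
have [->|wz] := eqVneq w z.
  by rewrite !subrr mulr0 subr0 cabs0 mulr0.
have h0 : w - z != 0 by rewrite subr_eq0.
have := hl (w - z) (conj h0 wq).
rewrite (_ : cder f w - cder f z - l * (w - z) = (d (w - z) - l) * (w - z)).
  move=> h; rewrite cabsM; apply: ler_wpM2r; first exact: cabs_ge0.
  apply: le_trans h _; apply: ler_wpM2l; last exact: ltW.
  by apply: mulr_ge0; [exact: ler0n|exact: Kq0].
by rewrite /d [z + _]addrC subrK; field.
Qed.


End cauchy_consequences.

(** * Compactness of closed discs, primitives and logarithms *)

Section compactness_and_logarithms.
Variable R : realType.
Local Notation C := R[i].
Implicit Types (f : C -> C) (a z u v : C) (r s : R).

(** Compactness is taken from a square of [R * R] containing the disc. As the local property holds
    for all large [M], finitely many thresholds merge into one. *)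
Lemma disc_uniform_bound (P : R -> C -> Prop) a s :
  (forall z, cabs (z - a) <= s -> exists2 r, 0 < r &
     exists M0, forall w M, cabs (w - z) < r -> M0 <= M -> P M w) ->
  exists M, forall w, cabs (w - a) <= s -> P M w.
Proof.
move=> H.
pose c (p : R * R) : C := p.1 +i* p.2.
pose B := `[complex.Re a - s, complex.Re a + s]%classic `*`
  `[complex.Im a - s, complex.Im a + s]%classic.
have cB : compact B by apply: compact_setX; exact: segment_compact.
have cdist (p q : R * R) r : ball p (r / 2) q -> cabs (c q - c p) < r.
  move=> [/= b1 b2]; rewrite cabsC; apply: (le_lt_trans (cabs_le_ReIm _)).
  rewrite cReB cImB/=; move: b1 b2; rewrite /ball/= => b1 b2; lra.
pose Q (M : R) (p : R * R) := cabs (c p - a) <= s -> P M (c p).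
have [M [_ HM]] : \forall M \near +oo, B `<=` Q M.
  move/compact_near_coveringP : cB; apply => p Bp.
  have [ps|ps] := leP (cabs (c p - a)) s.
    have [r r0 [M0 HM0]] := H _ ps.
    exists (ball p (r / 2), [set M | M0 <= M]) => /=.
      split; first by apply: nbhsx_ballx; rewrite divr_gt0.
      exact: nbhs_pinfty_ge (num_real M0).
    by move=> [q M] [/= bq MM] _; apply: HM0 => //; exact: cdist.
  exists (ball p ((cabs (c p - a) - s) / 2), setT) => /=.
    split; last exact: filterT.
    by apply: nbhsx_ballx; rewrite divr_gt0// subr_gt0.
  move=> [q M] [/= /cdist bq _] qs; exfalso.
  have := cabs_dist_tri (c q) (c p) a; rewrite (cabsC (c p) (c q)) => ?; rlra.
exists (M + 1) => w ws; have -> : w = c (complex.Re w, complex.Im w) by case: w ws.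
apply: HM; rewrite /= ?ltrDl//; last by rewrite /c; case: w ws.
have [w1 w2] := (Re_le_cabs (w - a), Im_le_cabs (w - a)).
have := le_trans w1 ws; have := le_trans w2 ws.
by rewrite cReB cImB !ler_norml => ? ?; split; rewrite /= in_itv/=; lra.
Qed.

Lemma hol_bounded f a r s : hol f a r -> s < r ->
  exists M, forall w, cabs (w - a) <= s -> cabs (f w) <= M.
Proof.
move=> H sr; apply: (@disc_uniform_bound (fun M w => cabs (f w) <= M)) => z zs.
have [d hd] := H z (le_lt_trans zs sr).
have [t t0 ft] := gderiv_cont hd ltr01.
exists t => //; exists (cabs (f z) + 1) => w M wt; apply: le_trans.
have := ft w wt; have := cabsB_ge (f w) (f z) => ? ?; rlra.
Qed.

(** The primitive is the integral along the radius. The identity [FTC], an integration by parts in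
    [t], shows that differentiating under the integral sign would give [f z]; Taylor's estimate,
    uniform in [t], controls the remainder. *)
Lemma primitive f r : hol f 0 r -> exists P, forall z, cabs z < r -> cderiv P z (f z).
Proof.
move=> Hf.
have Hf' := hol_cder_hol Hf.
have disk0 z : cabs z < r -> forall t : R, 0 <= t <= 1 -> cabs (t%:C * z) <= cabs z.
  by move=> _ t /andP[t0 t1]; rewrite cabsM cabs_real ger0_norm// ler_piMl// cabs_ge0.
have dF z (t : R) : cabs (t%:C * z) < r ->
    rderiv (fun t => f (t%:C * z)) t (cder f (t%:C * z) * z).
  move=> tz; have hd := hol_cder Hf; have := hd (t%:C * z); rewrite subr0 => /(_ tz) {}hd.
  apply: (gderiv_eq (gderiv_comp (gderivM (gderiv_id _ t) (gderiv_cst _ z t)) hd)).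
  by rewrite mul1r mulr0 addr0.
have dF' z (t : R) : cabs (t%:C * z) < r ->
    rderiv (fun t => cder f (t%:C * z)) t (cder (cder f) (t%:C * z) * z).
  move=> tz; have hd := hol_cder Hf'; have := hd (t%:C * z); rewrite subr0 => /(_ tz) {}hd.
  apply: (gderiv_eq (gderiv_comp (gderivM (gderiv_id _ t) (gderiv_cst _ z t)) hd)).
  by rewrite mul1r mulr0 addr0.
have r1 z : cabs z < r -> rdble 0 1 (fun t => z * f (t%:C * z)).
  move=> zr t tI; eexists; apply: gderivZ; apply: dF.
  exact: le_lt_trans (disk0 _ zr _ tI) zr.
have r2 z : cabs z < r -> rdble 0 1 (fun t => f (t%:C * z) + t%:C * (z * cder f (t%:C * z))).
  move=> zr t tI; have tz := le_lt_trans (disk0 _ zr _ tI) zr.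
  eexists; apply: gderivD; first exact: dF.
  apply: gderivM; first exact: gderiv_id.
  by apply: gderivZ; exact: dF'.
have FTC z : cabs z < r ->
    cint 0 1 (fun t => f (t%:C * z) + t%:C * (z * cder f (t%:C * z))) = f z.
  move=> zr; rewrite (cint_FTC ler01 (r2 _ zr) (G := fun t => t%:C * f (t%:C * z))).
    by rewrite !mul1r mul0r subr0.
  move=> t tI; have tz := le_lt_trans (disk0 _ zr _ tI) zr.
  apply: (gderiv_eq (gderivM (gderiv_id _ t) (dF _ _ tz))).
  by rewrite mul1r; ring.
exists (fun z => cint 0 1 (fun t => z * f (t%:C * z))) => z zr.
(* Discs of radius [p] about all points of the segment from [0] to [z] stay in the disc of radius
   [s < r], where [f] is bounded, so the constants [K] and [L] serve every [t]. *)
pose s := (cabs z + r) / 2; pose p := s - cabs z.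
have p0 : 0 < p by rewrite /p /s; lra.
have [|M HM] := @hol_bounded f 0 r s Hf; first by rewrite /s; lra.
pose K := 512 * M / p ^+ 2.
have near (t : R) : 0 <= t <= 1 -> forall w, cabs (w - t%:C * z) < p -> cabs (w - 0) < s.
  move=> tI w; rewrite subr0 => wp; have := disk0 _ zr _ tI.
  by have := cabsB_ge w (t%:C * z); rewrite /p in wp => ? ?; rlra.
have Hol (t : R) : 0 <= t <= 1 -> hol f (t%:C * z) p.
  by move=> tI; apply: hol_sub Hf => w /(near _ tI) ws; apply: lt_trans ws _; rewrite /s; lra.
have Bd (t : R) : 0 <= t <= 1 -> forall w, cabs (w - t%:C * z) < p -> cabs (f w) <= M.
  by move=> tI w /(near _ tI) ws; apply: HM; exact: ltW.
have M0 : 0 <= M.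
  apply: le_trans (cabs_ge0 (f 0)) (HM _ _).
  by rewrite subrr cabs0; have := cabs_ge0 z; rewrite /s => ?; lra.
have K0 : 0 <= K by apply: natmul_div_ge0; [exact: M0|exact: sqr_ge0].
pose L := 16 * M / p.
have L0 : 0 <= L by apply: natmul_div_ge0; [exact: M0|exact: ltW].
apply: (@gderiv_bigeps _ _ _ _ _ _ (2 * (cabs z * K + L))).
  by rewrite mulr_ge0// addr_ge0// mulr_ge0// cabs_ge0.
move=> e e0 _; exists (Num.min e (p / 4)); first by rewrite lt_min e0 divr_gt0.
move=> w /=; rewrite lt_min => /andP[we wp].
have wr : cabs w < r.
  have := cabsB_ge w z; rewrite /p /s in wp => ?; rlra.
set h := w - z in we wp *.
have r3 : rdble 0 1 (fun t => w * f (t%:C * w) - z * f (t%:C * z)).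
  move=> t tI; have [d hd] := r1 _ wr t tI; have [d' hd'] := r1 _ zr t tI.
  by exists (d - d'); exact: gderivB.
have r4 : rdble 0 1 (fun t => h * (f (t%:C * z) + t%:C * (z * cder f (t%:C * z)))).
  move=> t tI; have [d hd] := r2 _ zr t tI; exists (h * d); exact: gderivZ.
have r5 : rdble 0 1 (fun t => w * f (t%:C * w) - z * f (t%:C * z) -
    h * (f (t%:C * z) + t%:C * (z * cder f (t%:C * z)))).
  move=> t tI; have [d hd] := r3 t tI; have [d' hd'] := r4 t tI.
  by exists (d - d'); exact: gderivB.
rewrite -(FTC z zr) -cintB//; try exact: r1.
rewrite [X in _ - X]mulrC -cintZ; last exact: r2.
rewrite -cintB//.
have -> : 2 * (cabs z * K + L) * e * cabs h =
   2 * ((cabs z * K + L) * e * cabs h * (1 - 0)) by ring.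
apply: cint_le => // t tI.
have -> : w * f (t%:C * w) - z * f (t%:C * z) -
    h * (f (t%:C * z) + t%:C * (z * cder f (t%:C * z))) =
  z * (f (t%:C * w) - f (t%:C * z) - cder f (t%:C * z) * (t%:C * w - t%:C * z)) +
  h * (f (t%:C * w) - f (t%:C * z)) by rewrite /h; ring.
have tw : cabs (t%:C * w - t%:C * z) <= cabs h.
  rewrite -mulrBr -/h; case/andP: tI => t0 t1.
  by rewrite cabsM cabs_real ger0_norm// ler_piMl// cabs_ge0.
have tw4 : cabs (t%:C * w - t%:C * z) < p / 4 by exact: le_lt_trans wp.
have tz4 : cabs (t%:C * z - t%:C * z) < p / 4 by rewrite subrr cabs0 divr_gt0.
have tw2 : cabs (t%:C * w - t%:C * z) < p / 2 by lra.
have tz2 : cabs (t%:C * z - t%:C * z) < p / 2 by lra.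
have T := taylor2 p0 (Hol _ tI) (Bd _ tI) tw4 tz4.
have T2 := hol_lip_half p0 (Hol _ tI) (Bd _ tI) tw2 tz2.
rewrite -/K -/L in T T2.
have h0 := cabs_ge0 h; have z0 := cabs_ge0 z.
have q1 : cabs (f (t%:C * w) - f (t%:C * z) - cder f (t%:C * z) * (t%:C * w - t%:C * z))
   <= K * (e * cabs h).
  apply: (le_trans T); apply: ler_wpM2l => //; rewrite expr2.
  apply: ler_pM => //; try exact: cabs_ge0.
  exact: le_trans tw (ltW we).
have q2 : cabs (f (t%:C * w) - f (t%:C * z)) <= L * e.
  apply: (le_trans T2); apply: ler_wpM2l => //; exact: le_trans tw (ltW we).
apply: (le_trans (cabsD _ _)); rewrite (cabsM z) (cabsM h).
have := ler_wpM2l z0 q1; have := ler_wpM2l h0 q2 => ? ?; rlra.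
Qed.

(** The argument is [acos] of the normalised real part, with the sign of the imaginary part. The
    bound by [pi] enters the constant of [schottky]. *)
Lemma cexp_surj (w : C) : w != 0 -> exists2 u, cexp u = w & `|complex.Im u| <= pi.
Proof.
move=> w0; have n0 : 0 < cabs w by rewrite cabs_gt0.
pose c := complex.Re w / cabs w.
have cI : -1 <= c <= 1.
  by rewrite -ler_norml normrM normfV (ger0_norm (cabs_ge0 w)) ler_pdivrMr// mul1r Re_le_cabs.
have sq : (complex.Re w) ^+ 2 + (complex.Im w) ^+ 2 = cabs w ^+ 2.
  by rewrite cabs_sqrt sqr_sqrtr// addr_ge0 ?sqr_ge0.
have sinE : Num.sqrt (1 - c ^+ 2) = `|complex.Im w| / cabs w.
  have -> : 1 - c ^+ 2 = (complex.Im w / cabs w) ^+ 2.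
    by rewrite /c; move: sq => /(canRL (addKr _)) E; rewrite !expr_div_n E; field; rewrite gt_eqF.
  by rewrite sqrtr_sqr normrM normfV (ger0_norm (cabs_ge0 w)).
have cosE : cos (acos c) = c by have [_] := acos_def cI.
have [a0 api] : 0 <= acos c /\ acos c <= pi by have [/andP] := acos_def cI.
have nz : cabs w != 0 by rewrite gt_eqF.
have [i0|i0] := leP 0 (complex.Im w).
  exists (ln (cabs w) +i* acos c); last by rewrite /= ger0_norm.
  rewrite /cexp/= lnK ?posrE// /cis cosE sin_acos// sinE ger0_norm//.
  by apply: complex_eq; rewrite ?cReM ?cImM/= /c; field.
exists (ln (cabs w) +i* (- acos c)); last by rewrite /= normrN ger0_norm.
rewrite /cexp/= lnK ?posrE// /cis cosN sinN cosE sin_acos// sinE ltr0_norm//.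
by apply: complex_eq; rewrite ?cReM ?cImM/= /c; field.
Qed.

(** [L] is a primitive of the logarithmic derivative, adjusted at [0]; then [f * cexp (- L)] has
    derivative [0] and is constant. *)
Lemma hol_log f r (u0 : C) : 0 < r -> hol f 0 r -> (forall z, cabs z < r -> f z != 0) ->
  cexp u0 = f 0 -> exists L, [/\ hol L 0 r, L 0 = u0 &
    forall z, cabs z < r -> cexp (L z) = f z].
Proof.
move=> r0 Hf f0 fu.
have Hf' := hol_cder_hol Hf.
have hd z : cabs z < r -> cderiv f z (cder f z).
  by move=> zr; apply: (hol_cder Hf); rewrite subr0.
have [|P HP] := @primitive (fun z => cder f z / f z) r.
  move=> z; rewrite subr0 => zr; eexists.
  by apply: (gderiv_div (hol_cder Hf' _) (hd z zr) (f0 z zr)); rewrite subr0.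
pose L z := P z + (u0 - P 0).
have HL z : cabs z < r -> cderiv L z (cder f z / f z).
  by move=> zr; apply: (gderiv_eq (gderivD (HP z zr) (gderiv_cst _ _ z))); rewrite addr0.
exists L; split; first by move=> z; rewrite subr0 => zr; exists (cder f z / f z); exact: HL.
  by rewrite /L addrC subrK.
pose g z := f z * cexp (- L z).
have dg z : cabs z < r -> cderiv g z 0.
  move=> zr; apply: (gderiv_eq (gderivM (hd z zr)
    (gderiv_comp (gderivN (HL z zr)) (cderiv_cexp _)))).
  by field; exact: f0.
move=> z zr; have : cabs (g z - g 0) <= 2 * 0 * cabs (z - 0).
  apply: (@hol_lipschitz _ g 0 r); rewrite ?subr0 ?cabs0//.
    by move=> w; rewrite subr0 => wr; exists 0; exact: dg.
  by move=> w; rewrite subr0 => wr; rewrite (cder_val (dg w wr)) cabs0.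
rewrite mulr0 mul0r => h; have {h} : cabs (g z - g 0) == 0.
  by rewrite eq_le h cabs_ge0.
rewrite cabs_eq0 subr_eq0 => /eqP E.
have g0 : g 0 = 1 by rewrite /g /L addrC subrK cexpN fu divff// f0// cabs0.
move: E; rewrite g0 /g cexpN => E.
apply/esym/eqP; rewrite -subr_eq0; apply/eqP.
have := congr1 (fun x => x * cexp (L z)) E; rewrite mulfVK ?cexp_neq0// mul1r => ->.
by rewrite subrr.
Qed.

End compactness_and_logarithms.

(** * The theorems of Harnack, Bloch and Schottky *)

Section distortion.
Variable R : realType.
Local Notation C := R[i].
Implicit Types (f : C -> C) (a z u v w : C) (r s : R).

Lemma sqr_cabs z : cabs z ^+ 2 = complex.Re z ^+ 2 + complex.Im z ^+ 2.
Proof. by rewrite cabs_sqrt sqr_sqrtr// addr_ge0 ?sqr_ge0. Qed.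

(* With [A = e - log g], the function [(A - A 0) / (A + conj (A 0))] maps the
   disc to itself and vanishes at [0]. *)
Lemma harnack (g : C -> C) z : hol g 0 1 ->
  (forall z, cabs z < 1 -> g z != 0) -> (forall z, cabs z < 1 -> cabs (g z) <= 1) ->
  cabs z <= 48^-1 -> cabs (g 0) ^+ 2 <= cabs (g z) /\ cabs (g z) ^+ 2 <= cabs (g 0).
Proof.
move=> Hg g0 g1 z48.
have c01 : cabs (0 : C) < 1 by rewrite cabs0.
have [u0 u0E _] := cexp_surj (g0 0 c01).
have [L [HL L0 LE]] := hol_log ltr01 Hg g0 u0E.
have gE w : cabs w < 1 -> cabs (g w) = expR (complex.Re (L w)).
  by move=> w1; rewrite -LE// cabs_cexp.
have ReL w : cabs w < 1 -> complex.Re (L w) <= 0.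
  by move=> w1; rewrite -ler_expR expR0 -gE// g1.
have z2 : cabs z < 1 / 2 by lra.
have z1 : cabs z < 1 by lra.
set x := complex.Re (L z); set x0 := complex.Re (L 0).
suff [h1 h2] : 2 * x0 <= x /\ 2 * x <= x0.
  rewrite !gE// -/x -/x0 !expr2 -!expRD !ler_expR; split; lra.
(* The shift by [e] makes the real part of [A] strictly positive even where [cabs (g w)] is [1];
   afterwards [e] tends to [0]. *)
have key (e : R) : 0 < e -> e - x <= 2 * (e - x0) /\ e - x0 <= 2 * (e - x).
  move=> e0; pose A w := e%:C - L w; pose A0' := conjc (A 0).
  have ReA w : cabs w < 1 -> 0 < complex.Re (A w).
    by move=> w1; rewrite cReB/=; have := ReL w w1 => ?; lra.
  have conjRe : complex.Re A0' = complex.Re (A 0) by rewrite /A0'; case: (A 0).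
  have conjIm : complex.Im A0' = - complex.Im (A 0) by rewrite /A0'; case: (A 0).
  have ReAE w : complex.Re (A w) = e - complex.Re (L w) by rewrite cReB.
  have dA w : cabs w < 1 -> cderiv A w (0 - cder L w).
    move=> w1; apply: gderivB; first exact: gderiv_cst.
    by apply: (hol_cder HL); rewrite subr0.
  clearbody A0' A.
  have den w : cabs w < 1 -> A w + A0' != 0.
    move=> w1; apply/eqP => /(congr1 (@complex.Re R)); rewrite cReD conjRe.
    by have := ReA w w1; have := ReA 0 c01 => ? ? /= ?; lra.
  pose H w := (A w - A 0) / (A w + A0').
  have HH : hol H 0 1.
    move=> w; rewrite subr0 => w1; eexists.
    exact: (gderiv_div (gderivB (dA w w1) (gderiv_cst _ (A 0) w))
      (gderivD (dA w w1) (gderiv_cst _ A0' w)) (den w w1)).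
  have H1 w : cabs (w - 0) < 1 -> cabs (H w) <= 1.
    rewrite subr0 => w1; rewrite /H cabsM cabsV.
    have p0 : 0 < cabs (A w + A0') by rewrite cabs_gt0 den.
    rewrite ler_pdivrMr// mul1r -(@ler_pXn2r _ 2) ?nnegrE ?cabs_ge0// !sqr_cabs.
    rewrite !(cReD, cImD, cReN, cImN) conjRe conjIm.
    by have := mulr_gt0 (ReA w w1) (ReA 0 c01) => ?; nra.
  have c00 : cabs (0 - 0 : C) < 1 / 2 by rewrite subrr cabs0; lra.
  have zz2 : cabs (z - 0) < 1 / 2 by rewrite subr0.
  have := hol_lip_half ltr01 HH H1 zz2 c00.
  rewrite [X in H z - X](_ : _ = 0); last by rewrite /H subrr mul0r.
  rewrite !subr0 => Hz.
  (* The Lipschitz constant [16] and the radius [48^-1] give one third, which keeps the real parts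
     of [A z] and [A 0] within a factor [2] of each other. *)
  have {}Hz : cabs (H z) <= 3^-1 by lra.
  have p0 : 0 < cabs (A z + A0') by rewrite cabs_gt0 den.
  move: Hz; rewrite /H cabsM cabsV ler_pdivrMr// => Hz.
  have {}Hz : (3 * cabs (A z - A 0)) ^+ 2 <= cabs (A z + A0') ^+ 2.
    by rewrite ler_pXn2r ?nnegrE ?cabs_ge0 ?mulr_ge0 ?cabs_ge0//; lra.
  move: Hz; rewrite exprMn !sqr_cabs !(cReD, cImD, cReN, cImN) conjRe conjIm.
  rewrite !ReAE -/x -/x0.
  have xe : 0 < e - x by have := ReL z z1; rewrite -/x => ?; lra.
  have x0e : 0 < e - x0 by have := ReL 0 c01; rewrite -/x0 => ?; lra.
  move: (e - x) (e - x0) (complex.Im (A z)) (complex.Im (A 0)) xe x0e => p q i j p1 q1 E.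
  have {}E : (3 * (p - q)) ^+ 2 <= (p + q) ^+ 2.
    have := sqr_ge0 (i - j) => ?; rewrite exprMn; lra.
  have : `|3 * (p - q)| <= `|p + q|.
    by rewrite -(@ler_pXn2r _ 2) ?nnegrE// !real_normK ?num_real.
  rewrite (gtr0_norm (addr_gt0 p1 q1)) ler_norml => /andP[? ?]; split; lra.
split; apply/ler_addgt0Pr => e e0.
  by have [h _] := key e e0; lra.
by have [_ h] := key e e0; lra.
Qed.

Section almost_linear.
Variables (f : C -> C) (a b : C) (r : R).
Hypothesis Hf : hol f a r.
Hypothesis fb : forall z, cabs (z - a) < r -> cabs (cder f z - b) <= cabs b / 4.

(** [f - b * id] is Lipschitz with constant [cabs b / 2], so it cancels at most half of the
    expansion by [b]. *)
Lemma almost_linear_expand u v : cabs (u - a) < r -> cabs (v - a) < r ->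
  cabs b / 2 * cabs (u - v) <= cabs (f u - f v).
Proof.
move=> hu hv; pose g z := f z - b * z.
have dg z : cabs (z - a) < r -> cderiv g z (cder f z - b).
  move=> zr; apply: (gderiv_eq (gderivB (hol_cder Hf zr) (gderivZ b (gderiv_id _ z)))).
  by rewrite mulr1.
have : cabs (g u - g v) <= 2 * (cabs b / 4) * cabs (u - v).
  apply: (@hol_lipschitz _ g a r) => //.
    by move=> z zr; exists (cder f z - b); exact: dg.
  by move=> z zr; rewrite (cder_val (dg z zr)); exact: fb.
have -> : g u - g v = (f u - f v) - b * (u - v) by rewrite /g; ring.
have := cabsB_ge (b * (u - v)) (f u - f v).
by rewrite (cabsC (b * (u - v))) cabsM => ? ?; rlra.
Qed.

(* If [w] were not attained, [1 / (f - w)] would violate the mean value bound. *)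
Lemma almost_linear_image w : 0 < r -> cabs (w - f a) < cabs b * r / 12 ->
  exists2 z, cabs (z - a) < r & f z = w.
Proof.
move=> r0 wf; apply: contrapT => H.
have nz z : cabs (z - a) < r -> f z - w != 0.
  by move=> zr; apply/eqP => /subr0_eq E; apply: H; exists z.
have s0 : 0 < r / 2 < r by apply/andP; split; lra.
have aa : cabs (a - a) < r by rewrite subrr cabs0.
set c := cabs b in wf *.
have c0 : 0 < c.
  by rewrite lt_neqAle cabs_ge0 andbT; apply/eqP => E; have := cabs_ge0 (w - f a); rewrite -E in wf; lra.
have cr : 0 < c * r by exact: mulr_gt0.
have m0 : 0 < c * r / 6 by rewrite divr_gt0.
have Hinv : hol (fun z => (f z - w)^-1) a r.
  move=> z zr; eexists.
  exact: (cderivV (gderivB (hol_cder Hf zr) (gderiv_cst _ w z)) (nz z zr)).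
(* On the circle of radius [r / 2], [f] is at distance at least [c * r / 4] from [f a], hence at
   least [c * r / 6] from [w]. The mean value bound then forces [w] to be at least [c * r / 12] away
   from [f a]. *)
have := @mean_value_le _ (fun z => (f z - w)^-1) a r (r / 2) (c * r / 6)^-1 s0 Hinv.
rewrite cabsV => h; have {h} : (cabs (f a - w))^-1 <= 2 * (c * r / 6)^-1.
  apply: h => z zs; have zr : cabs (z - a) < r by lra.
  rewrite cabsV lef_pV2 ?posrE ?cabs_gt0 ?nz//.
  have := almost_linear_expand zr aa; rewrite zs -/c.
  have := cabs_dist_tri w (f z) (f a) => ? ?; rlra.
have fw0 : 0 < cabs (f a - w) by rewrite cabs_gt0 nz.
rewrite -[2]invrK -invfM lef_pV2 ?posrE//; last by rewrite mulr_gt0.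
by rewrite cabsC in wf; lra.
Qed.

End almost_linear.

(** A form of Bloch's theorem. At a point [a] where the weighted derivative
    [(1 / 2 - cabs w) * cabs (cder f w)] is nearly maximal, [f] is almost linear on a disc whose
    image contains one of radius comparable to this maximum. The image meets no omitted value, so
    that radius is at most [D]. *)
Lemma bloch_net : exists2 K : R, 0 <= K & forall f (D : R), hol f 0 1 ->
  (forall p, exists2 q, cabs (q - p) < D & forall z, cabs z < 1 -> f z != q) ->
  forall z, cabs z < 4^-1 -> cabs (cder f z) <= K * D.
Proof.
(* With the bound [4 * cabs b] on a disc of radius [t], [cder f] has Lipschitz constant
   [64 * cabs b / t], so it varies by at most [cabs b / 4] on the disc of radius [t / N]. *)
pose N : R := 256.
have N0 : 0 < N by rewrite ltr0n.
exists (4 * (4 * (N * 12))); first by rewrite !mulr_ge0// ltW.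
move=> f D Hf Hnet z z4.
have Hf' := hol_cder_hol Hf.
have [|B HB] := hol_bounded (s := 1 / 2) Hf'; first by lra.
pose A := [set (1 / 2 - cabs w) * cabs (cder f w) | w in [set w | cabs w < 1 / 2]].
have A0 : A !=set0.
  by exists ((1 / 2 - cabs (0 : C)) * cabs (cder f 0)), 0 => //=; rewrite cabs0; lra.
have D0 : 0 <= D by have [q /ltW qD _] := Hnet 0; exact: le_trans (cabs_ge0 _) qD.
have sA : has_sup A.
  split=> //; exists B => _ [w /= w2 <-].
  have := HB w; rewrite subr0 => /(_ (ltW w2)) h.
  apply: le_trans h; rewrite ler_piMl ?cabs_ge0//.
  by have := cabs_ge0 w => ?; lra.
pose S := sup A.
have AS w : cabs w < 1 / 2 -> (1 / 2 - cabs w) * cabs (cder f w) <= S.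
  by move=> w2; apply: sup_upper_bound => //; exists w.
suff SD : S <= 4 * (N * 12) * D.
  have z2 : cabs z < 1 / 2 by lra.
  have h1 : 4^-1 * cabs (cder f z) <= (1 / 2 - cabs z) * cabs (cder f z).
    by rewrite ler_wpM2r ?cabs_ge0//; lra.
  by have := AS z z2; lra.
have [S0|S0] := leP S 0.
  apply: le_trans S0 _; apply: mulr_ge0 D0; apply: mulr_ge0 => //.
  by apply: mulr_ge0 => //; exact: ltW.
(* The value at [a] exceeds half of the supremum. Within [t] of [a] the weight keeps at least half
   of its value [2 * t], which bounds [cder f] there by [4 * cabs b]. *)
have [_ [a /= a2 <-] aS] := sup_adherent (divr_gt0 S0 (ltr0n _ 2)) sA.
rewrite -/S in aS.
set b := cder f a in aS; pose t := (1 / 2 - cabs a) / 2.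
have t0 : 0 < t by rewrite /t; lra.
have tb : S < 4 * (t * cabs b) by rewrite /t; lra.
have near w : cabs (w - a) < t -> t <= 1 / 2 - cabs w.
  by move=> wa; have := cabsB_ge w a; rewrite /t in wa *; lra.
have bd w : cabs (w - a) < t -> cabs (cder f w) <= 4 * cabs b.
  move=> /near wt; have w2 : cabs w < 1 / 2 by lra.
  rewrite -(ler_pM2l t0); apply: le_trans (_ : S <= _); last by lra.
  by apply: le_trans (AS w w2); rewrite ler_wpM2r// cabs_ge0.
have sub w : cabs (w - a) < t -> cabs (w - 0) < 1.
  by move=> /near ?; rewrite subr0; lra.
have Hfa : hol f a t by apply: hol_sub Hf.
have Hfa' : hol (cder f) a t by apply: hol_sub Hf'.
have aa : cabs (a - a) < t / 2 by rewrite subrr cabs0 divr_gt0.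
have tN0 : 0 < t / N by rewrite divr_gt0.
have tN2 : t / N < t / 2 by rewrite ltr_pM2l// ltf_pV2 ?posrE// ltr_nat.
have lin w : cabs (w - a) < t / N -> cabs (cder f w - b) <= cabs b / 4.
  move=> wN; have w2 := lt_trans wN tN2.
  apply: (le_trans (hol_lip_half t0 Hfa' bd w2 aa)).
  have k0 : 0 <= 16 * (4 * cabs b) / t.
    by apply: natmul_div_ge0; [rewrite mulr_ge0 ?cabs_ge0|exact: ltW].
  apply: (le_trans (ler_wpM2l k0 (ltW wN))).
  rewrite le_eqVlt; apply/orP; left; apply/eqP.
  by rewrite /N; field; rewrite gt_eqF.
have [q qD qf] := Hnet (f a).
rewrite leNgt; apply/negP => DS.
have Hfn : hol f a (t / N) by apply: hol_sub Hfa => w wN; apply: lt_trans wN _; lra.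
have [|x xN fx] := almost_linear_image Hfn lin (w := q) tN0.
  apply: (lt_trans qD); rewrite -(@ltr_pM2l _ (4 * (N * 12))); last by rewrite !mulr_gt0.
  apply: (lt_trans DS); rewrite (_ : 4 * (N * 12) * _ = 4 * (t * cabs b))//.
  by field.
have x1 : cabs x < 1 by rewrite -[x]subr0; apply: sub; lra.
by have := qf x x1; rewrite fx eqxx.
Qed.

Definition ccosh z := (cexp z + cexp (- z)) / 2.

Lemma cis_2pi_nat k : cis (2 * pi * k%:R) = 1 :> C.
Proof.
elim: k => [|k IH]; first by rewrite mulr0 cis0.
by rewrite -(natr1 k) mulrDr mulr1 cisD IH cis2pi mulr1.
Qed.

Lemma cis_2pi_int (m : int) : cis (2 * pi * m%:~R) = 1 :> C.
Proof.
case: m => k; first exact: cis_2pi_nat.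
rewrite NegzE mulrNz mulrN; have := cisD (- (2 * pi * (k.+1%:~R))) (2 * pi * k.+1%:~R) : _ = _ :> C.
by rewrite addNr cis0 cis_2pi_nat mulr1 => <-.
Qed.

(* [cosh] takes odd integer values at points within [5] of any real number, and
   is [2 pi i]-periodic. *)
Lemma ccosh_odd_net (p : C) : exists2 q, cabs (q - p) < 6 + 2 * pi &
  exists j : nat, ccosh q = (2 * j + 1)%:R.
Proof.
pose ch (x : R) := (expR x + expR (- x)) / 2.
have chN x : ch (- x) = ch x by rewrite /ch opprK addrC.
have cch s : {within `[s, s + 5], continuous ch}.
  apply: continuous_subspaceT => x; apply: cvgMl; apply: cvgD.
    exact: continuous_expR.
  by apply: (@continuous_comp _ _ _ (-%R) expR); [exact: opp_continuous|exact: continuous_expR].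
have ch1 x : 1 <= ch x.
  have e0 := expR_gt0 x; rewrite /ch expRN.
  have : 0 <= (expR x)^-1 * (expR x - 1) ^+ 2 by rewrite mulr_ge0 ?invr_ge0 ?sqr_ge0 ?ltW.
  have -> : (expR x)^-1 * (expR x - 1) ^+ 2 = expR x - 2 + (expR x)^-1.
    by field; rewrite gt_eqF.
  by move=> ?; lra.
have gap s : 0 <= s -> ch s + 2 <= ch (s + 5).
  move=> s0; have A1 : 1 <= expR s by rewrite -expR0 ler_expR.
  have B6 : 6 <= expR (5 : R) by have := expR_ge1Dx (5 : R); lra.
  have i1 : expR (- s) <= 1 by rewrite -expR0 ler_expR; lra.
  have i2 := expR_ge0 (- (s + 5)).
  by rewrite /ch expRD; nra.
have odd s : 0 <= s -> exists2 t, s <= t <= s + 5 & exists j : nat, ch t = (2 * j + 1)%:R.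
  (* [2 * j + 1] is the first odd integer above [ch s], hence at most [ch s + 2], and [gap] puts it
     in the range of [ch] on [[s, s + 5]]. *)
  move=> s0; pose j := Num.truncn ((ch s + 1) / 2).
  have /andP[j1 j2] : j%:R <= (ch s + 1) / 2 < j.+1%:R.
    by apply: truncn_itv; rewrite divr_ge0// addr_ge0// (le_trans ler01 (ch1 s)).
  have J : (2 * j + 1)%:R = 2 * j%:R + 1 :> R by rewrite natrD natrM.
  rewrite -(natr1 j) in j2.
  have [||t] := @IVT _ ch s (s + 5) (2 * j + 1)%:R _ (cch s); first by lra.
    rewrite ge_min le_max J; have := gap s s0 => ?.
    by apply/andP; split; apply/orP; [left|right]; lra.
  by rewrite in_itv/= => tI tE; exists t => //; exists j.
have pi0 : 0 < 2 * pi :> R by rewrite mulr_gt0// pi_gt0.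
have [t tp [j tj]] : exists2 t, `|t - complex.Re p| <= 5 & exists j : nat, ch t = (2 * j + 1)%:R.
  have [x0|x0] := leP 0 (complex.Re p).
    by have [t tI tj] := odd _ x0; exists t => //; rewrite ler_norml; lra.
  have [|t tI [j tj]] := odd (- complex.Re p); first by lra.
  by exists (- t); [rewrite ler_norml; lra|exists j; rewrite chN].
pose m := Num.floor (complex.Im p / (2 * pi)).
have m1 : m%:~R * (2 * pi) <= complex.Im p by rewrite -ler_pdivlMr// floor_le.
have m2 : complex.Im p < m%:~R * (2 * pi) + 2 * pi.
  have := floorD1_gt (complex.Im p / (2 * pi)).
  by rewrite -/m ltr_pdivrMr// intrD mulrDl mul1r.
pose q : C := t +i* (2 * pi * m%:~R); exists q.
  apply: (le_lt_trans (cabs_le_ReIm _)); rewrite cReB cImB/=.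
  have : `|2 * pi * m%:~R - complex.Im p| <= 2 * pi by rewrite ler_norml; lra.
  by move=> ?; lra.
exists j; have c1 : cexp q = (expR t)%:C by rewrite /cexp/= cis_2pi_int mulr1.
rewrite /ccosh cexpN c1 -fmorphV -expRN -rmorphD -(rmorph_nat (real_complex R) 2).
by rewrite -fmorph_div/= -(rmorph_nat (real_complex R) (2 * j + 1)) -tj.
Qed.

(** As [f] omits [0] and [1], the function [F] with [f = cexp ('i * pi * (F - 1))] omits the odd
    integers. Since [F ^ 2 - 1] has no zeros, it has a holomorphic square root [Sq]; then
    [W = F + Sq] has inverse [F - Sq], so its logarithm [G] satisfies [F = ccosh G]. Thus [G] omits
    the net of [ccosh_odd_net], its derivative is bounded by [bloch_net], and bounds pass back from
    [G] to [F] and [f]. *)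
Lemma schottky : exists M s : R, 0 < s /\ forall f, hol f 0 1 ->
  (forall z, cabs z < 1 -> f z != 0) -> (forall z, cabs z < 1 -> f z != 1) ->
  1 / 2 <= cabs (f 0) <= 3 / 2 -> forall z, cabs z <= s -> cabs (f z) <= M.
Proof.
have [K K0 HK] := bloch_net.
pose D : R := 6 + 2 * pi.
pose K' := 2 * (K * D) * 8^-1.
exists (expR (pi * (7 * expR K' + 1))), 8^-1; split; first by lra.
move=> f Hf f0 f1 /andP[fl fu] z z8.
have p0 : 0 < pi :> R by exact: pi_gt0.
have c01 : cabs (0 : C) < 1 by rewrite cabs0.
have [u uE uI] := cexp_surj (f0 0 c01).
have uR : `|complex.Re u| <= 1.
  have e2 : 2 <= expR (1 : R) by have := expR_ge1Dx (1 : R); lra.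
  rewrite -uE cabs_cexp in fl fu; rewrite ler_norml; apply/andP; split.
    rewrite -ler_expR; apply: le_trans fl; rewrite expRN div1r.
    by rewrite lef_pV2 ?posrE ?expR_gt0.
  by rewrite -ler_expR; lra.
have [L [HL L0 LE]] := hol_log ltr01 Hf f0 uE.
have ipi0 : 'i * pi%:C != 0 :> C.
  by rewrite -cabs_gt0 cabsM cabs_i mul1r cabs_real gtr0_norm.
pose F w := L w / ('i * pi%:C) + 1.
have LF w : L w = 'i * pi%:C * (F w - 1) by rewrite /F addrK mulrC divfK.
have dL w : cabs w < 1 -> cderiv L w (cder L w).
  by move=> w1; apply: (hol_cder HL); rewrite subr0.
have [dF HdF] : exists dF, forall w, cabs w < 1 -> cderiv F w (dF w).
  exists (fun w => cder L w * ('i * pi%:C)^-1 + L w * 0 + 0) => w w1.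
  apply: gderivD; last exact: gderiv_cst.
  by apply: gderivM; [exact: dL|exact: gderiv_cst].
have cpi (y : R) : cexp ('i * pi%:C * y%:C) = cis (pi * y).
  have -> : 'i * pi%:C * y%:C = 0 +i* (pi * y) :> C.
    by apply: complex_eq; rewrite !(cReM, cImM)/=; ring.
  by rewrite /cexp/= expR0 mul1r.
have Fodd w (j : nat) : cabs w < 1 -> F w != (2 * j + 1)%:R.
  move=> w1; apply/eqP => E; have /eqP := f1 w w1; apply.
  rewrite -LE// LF E natrD addrK -(rmorph_nat (real_complex R)) cpi.
  by rewrite natrM mulrA (mulrC pi) cis_2pi_nat.
have FN1 w : cabs w < 1 -> F w != -1.
  move=> w1; apply/eqP => E; have /eqP := f1 w w1; apply.
  rewrite -LE// LF E (_ : -1 - 1 = (- (2 * 1))%:C).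
    rewrite cpi mulr1 mulrN mulrC; have := cis_2pi_int (- 1); rewrite mulrN1.
    by move=> <-.
  by rewrite mulr1 rmorphN rmorph_nat; ring.
have F21 w : cabs w < 1 -> F w * F w - 1 != 0.
  move=> w1; rewrite (_ : F w * F w - 1 = (F w - 1) * (F w + 1)); last by ring.
  rewrite mulf_neq0// ?subr_eq0 ?addr_eq0 ?FN1//.
  by have := Fodd w 0%N w1; rewrite muln0 add0n.
clearbody F.
have HF2 : hol (fun w => F w * F w - 1) 0 1.
  move=> w; rewrite subr0 => w1; eexists.
  by apply: gderivB (gderiv_cst _ 1 w); apply: gderivM; exact: HdF.
have [u2 u2E _] := cexp_surj (F21 0 c01).
have [L2 [HL2 _ L2E]] := hol_log ltr01 HF2 F21 u2E.
pose Sq w := cexp (2^-1 * L2 w).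
have Sq2 w : cabs w < 1 -> Sq w * Sq w = F w * F w - 1.
  move=> w1; rewrite -L2E// /Sq -cexpD; congr cexp.
  by rewrite ![2^-1 * _]mulrC -splitr.
have [dS HdS] : exists dS, forall w, cabs w < 1 -> cderiv Sq w (dS w).
  exists (fun w => cexp (2^-1 * L2 w) * (2^-1 * cder L2 w)) => w w1.
  apply: gderiv_comp (cderiv_cexp _); apply: gderivZ.
  by apply: (hol_cder HL2); rewrite subr0.
clearbody Sq.
pose W w := F w + Sq w.
have WW w : cabs w < 1 -> W w * (F w - Sq w) = 1.
  move=> w1; rewrite /W (_ : _ * _ = F w * F w - Sq w * Sq w); last by ring.
  by rewrite Sq2//; ring.
have W0 w : cabs w < 1 -> W w != 0.
  by move=> /WW; apply: contra_eq_neq => ->; rewrite mul0r eq_sym oner_neq0.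
have HW : hol W 0 1.
  move=> w; rewrite subr0 => w1; exists (dF w + dS w).
  by apply: gderivD; [exact: HdF|exact: HdS].
have [u3 u3E _] := cexp_surj (W0 0 c01).
have [G [HG _ GE]] := hol_log ltr01 HW W0 u3E.
have WV w : cabs w < 1 -> (W w)^-1 = F w - Sq w.
  by move=> w1; rewrite -[LHS]mulr1 -(WW w w1) mulKf ?W0.
have FG w : cabs w < 1 -> F w = ccosh (G w).
  by move=> w1; rewrite /ccosh cexpN GE// WV// /W; field.
have Gnet p : exists2 q, cabs (q - p) < D & forall w, cabs w < 1 -> G w != q.
  have [q qp [j qj]] := ccosh_odd_net p; exists q => // w w1.
  by apply: contraTneq (Fodd w j w1) => E; rewrite negbK FG// E qj.
have G'le := HK _ _ HG Gnet.
have Glip : cabs (G z - G 0) <= K'.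
  have z4 : cabs (z - 0) < 4^-1 by rewrite subr0; lra.
  have z04 : cabs (0 - 0 : C) < 4^-1 by rewrite subrr cabs0; lra.
  have H4 : hol G 0 4^-1 by apply: hol_sub HG => w w4; lra.
  apply: (le_trans (hol_lipschitz (L := K * D) H4 _ z4 z04)).
    by move=> w; rewrite subr0; exact: G'le.
  rewrite subr0 /K'; apply: ler_wpM2l => //.
  by rewrite !mulr_ge0// /D; have := pi_gt0 R => ?; lra.
have u4 : cabs u <= 1 + pi.
  by apply: (le_trans (cabs_le_ReIm _)); exact: lerD.
have F0 : cabs (F 0) <= 3.
  have : pi * (cabs (F 0) - 1) <= 1 + pi.
    apply: le_trans u4; rewrite -L0 LF cabsM cabsM cabs_i mul1r cabs_real gtr0_norm//.
    rewrite ler_pM2l//; have := cabsB_ge (F 0) 1; rewrite cabs1; exact.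
  have := pi_ge2 R => p2 h; rewrite leNgt; apply/negP => h3.
  have := mulr_gt0 p0 (_ : 0 < cabs (F 0) - 3); rewrite subr_gt0 => /(_ h3) h4.
  lra.
have S0 : cabs (Sq 0) <= 4.
  have : cabs (Sq 0) ^+ 2 <= 10.
    rewrite expr2 -cabsM Sq2// (le_trans (cabsB _ _))// cabs1 cabsM.
    have := ler_pM (cabs_ge0 _) (cabs_ge0 _) F0 F0 => ?; lra.
  have := cabs_ge0 (Sq 0) => ? ?; nra.
(* [W 0 = F 0 + Sq 0] and its inverse [F 0 - Sq 0] have modulus at most [3 + 4]. *)
have Gz7 : expR `|complex.Re (G 0)| <= 7.
  have w1 : expR (complex.Re (G 0)) <= 7.
    rewrite -cabs_cexp GE//; apply: (le_trans (cabsD _ _)); lra.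
  have w2 : expR (- complex.Re (G 0)) <= 7.
    rewrite -cReN -cabs_cexp cexpN GE// WV//; apply: (le_trans (cabsB _ _)); lra.
  by case: ger0P.
have z1 : cabs z < 1 by lra.
have Fz : cabs (F z) <= 7 * expR K'.
  have ReG : `|complex.Re (G z)| <= `|complex.Re (G 0)| + K'.
    rewrite -lerBlDl; apply: le_trans Glip; apply: le_trans (Re_le_cabs _).
    by rewrite cReB; exact: lerB_dist.
  apply: (@le_trans _ _ (expR `|complex.Re (G z)|)).
    rewrite FG// /ccosh cabsM cabsV cabs_nat ler_pdivrMr//.
    apply: (le_trans (cabsD _ _)); rewrite !cabs_cexp cReN mulr_natr mulr2n.
    by apply: lerD; rewrite ler_expR ?ler_norm// -normrN ler_norm.
  apply: (@le_trans _ _ (expR (`|complex.Re (G 0)| + K'))); first by rewrite ler_expR.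
  by rewrite expRD ler_wpM2r// expR_ge0.
rewrite -LE// cabs_cexp ler_expR; apply: le_trans (ler_norm _) _.
apply: le_trans (Re_le_cabs _) _; rewrite LF !cabsM cabs_i mul1r cabs_real gtr0_norm//.
rewrite ler_pM2l//; apply: (le_trans (cabsB _ _)); rewrite cabs1; lra.
Qed.

(** If [f 0] is too small for [schottky], then [1 - f] omits the same two values and has modulus
    between [1 / 2] and [3 / 2] at [0]. *)
Lemma schottky_small : exists M s : R, [/\ 0 <= M, 0 < s & forall f, hol f 0 1 ->
  (forall z, cabs z < 1 -> f z != 0) -> (forall z, cabs z < 1 -> f z != 1) ->
  cabs (f 0) <= 1 -> forall z, cabs z <= s -> cabs (f z) <= M].
Proof.
have [M [s [s0 H]]] := schottky; exists (1 + Num.max 0 M), s; split => //.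
  by rewrite addr_ge0// le_max lexx.
have M1 : M <= Num.max 0 M by rewrite le_max lexx orbT.
move=> f Hf f0 f1 fle z zs; have [h|h] := leP (1 / 2) (cabs (f 0)).
  have : cabs (f z) <= M by apply: H => //; lra.
  by lra.
have : cabs (1 - f z) <= M.
  apply: (H (fun z => 1 - f z)) => //.
  - move=> w /Hf[d hd]; exists (0 - d); apply: gderivB hd; exact: gderiv_cst.
  - by move=> w w1; rewrite subr_eq0 eq_sym f1.
  - by move=> w w1; rewrite -subr_eq0 addrAC subrr add0r oppr_eq0 f0.
  have := cabsB_ge 1 (f 0); have := cabsB 1 (f 0); rewrite cabs1 => ? ?.
  by apply/andP; split; lra.
by have := cabsB_ge (f z) 1; rewrite cabs1 (cabsC (f z)) => ? ?; lra.
Qed.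

End distortion.

(** * Packings by squares and the area of a holomorphic motion *)

Section area.
Variable R : realType.
Local Notation C := R[i].
Local Notation R2 := (measurableTypeR R * measurableTypeR R)%type.
Implicit Types (w z : C) (e : R).

(** [e] is half of the side; half-open sides keep squares that merely touch disjoint. *)
Definition square w e : set R2 :=
  `[complex.Re w - e, complex.Re w + e[%classic `*`
  `[complex.Im w - e, complex.Im w + e[%classic.

Lemma in_square w e (p : R2) : square w e p <->
  complex.Re w - e <= p.1 < complex.Re w + e /\
  complex.Im w - e <= p.2 < complex.Im w + e.
Proof. by rewrite /square /= /setX/= !in_itv/=. Qed.

Lemma measurable_square w e : measurable (square w e).
Proof. by apply: measurableX; exact: measurable_itv. Qed.

Lemma area2_square w e : 0 <= e -> area2 (square w e) = (4 * e ^+ 2)%:E.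
Proof.
move=> e0; have len x : @lebesgue_measure R `[x - e, x + e[ = (2 * e)%:E.
  rewrite lebesgue_measure_itv/= lte_fin; case: ifPn => [_|].
    by rewrite -EFinB; congr EFin; ring.
  by rewrite -leNgt => h; congr EFin; lra.
rewrite /area2 /square product_measure1E; [|exact: measurable_itv..].
apply: (@eq_trans _ _ ((2 * e)%:E * (2 * e)%:E)%E); first by congr (_ * _)%E; exact: len.
by rewrite -EFinM; congr EFin; ring.
Qed.

Lemma square_sub w e w' e' : cabs (w - w') + e <= e' -> square w e `<=` square w' e'.
Proof.
move=> h p /in_square[h1 h2]; apply/in_square.
have := Re_le_cabs (w - w'); have := Im_le_cabs (w - w').
rewrite cReB cImB !ler_norml => /andP[? ?] /andP[? ?].
by split; apply/andP; split; rlra.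
Qed.

Lemma square_disjoint w e w' e' : 2 * (e + e') <= cabs (w - w') ->
  square w e `&` square w' e' = set0.
Proof.
move=> h; rewrite -subset0 => p [/in_square[/andP[a1 a2] /andP[b1 b2]]].
move=> /in_square[/andP[c1 c2] /andP[d1 d2]].
have := cabs_le_ReIm (w - w'); rewrite cReB cImB.
have : `|complex.Re w - complex.Re w'| < e + e' by rewrite ltr_norml; apply/andP; split; lra.
have : `|complex.Im w - complex.Im w'| < e + e' by rewrite ltr_norml; apply/andP; split; lra.
by move=> ? ? ?; exfalso; rlra.
Qed.

Lemma square_packing n (J : {set 'I_n}) (w : 'I_n -> C) (e : 'I_n -> R) (U : set R2) :
  measurable U -> (forall j, j \in J -> 0 <= e j) ->
  (forall j, j \in J -> square (w j) (e j) `<=` U) ->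
  (forall i j, i \in J -> j \in J -> i != j -> 2 * (e i + e j) <= cabs (w i - w j)) ->
  ((\sum_(j in J) 4 * e j ^+ 2)%:E <= area2 U)%E.
Proof.
move=> mU e0 sU sep.
have mB : measurable (\big[setU/set0]_(j < n | j \in J) square (w j) (e j)).
  by apply: bigsetU_measurable => j _; exact: measurable_square.
apply: (@le_trans _ _ (area2 (\big[setU/set0]_(j < n | j \in J) square (w j) (e j)))).
  have := @measure_bigsetU_ord_cond _ _ _ (@area2 R) n (mem J)
    (fun j => square (w j) (e j)) _ _.
  rewrite (_ : (\sum_(i < n | mem J i) _)%E = (\sum_(j in J) 4 * e j ^+ 2)%:E).
    move=> ->//; first by move=> i _; exact: measurable_square.
    apply/trivIsetP => i j /= iJ jJ ij; apply: square_disjoint; exact: sep.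
  by rewrite -sumEFin; apply: eq_bigr => j jJ; apply: area2_square; exact: e0.
apply: le_measure; rewrite ?inE// => p.
by move: p; apply: (big_ind (fun S => S `<=` U)) => // S1 S2; rewrite subUset.
Qed.

Lemma square_covering n (w : nat -> C) e (r : R) (A : set R2) : 0 <= e ->
  (forall U, measurable U -> A `<=` U -> (r%:E <= area2 U)%E) ->
  A `<=` \bigcup_(j < n) square (w j) e -> r <= n%:R * (4 * e ^+ 2).
Proof.
move=> e0 rA; rewrite bigcup_mkord => AU.
have mB : measurable (\big[setU/set0]_(j < n) square (w j) e).
  by apply: bigsetU_measurable => j _; exact: measurable_square.
rewrite -lee_fin; apply: (le_trans (rA _ mB AU)).
apply: (le_trans (@content_subadditive _ _ _ (@area2 R) _
  (fun j => square (w j) e) n _ mB _)) => //.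
  by move=> k _; exact: measurable_square.
rewrite (eq_bigr (fun=> (4 * e ^+ 2)%:E)); last by move=> k _; exact: area2_square.
by rewrite sumEFin lee_fin sumr_const card_ord -[leLHS]mulr_natl.
Qed.

Definition separated (K : set C) (d : R) (s : seq C) :=
  (forall j, (j < size s)%N -> K s`_j) /\
  (forall i j, (i < size s)%N -> (j < size s)%N -> i != j -> d <= cabs (s`_i - s`_j)).

(** Squares of half side [d / 4] about the points are disjoint and lie in [square 0 2], of area
    [16]. *)
Lemma separated_size K d s : 0 < d -> d <= 1 -> (forall x, K x -> cabs x <= 1) ->
  separated K d s -> (size s)%:R <= 64 / d ^+ 2.
Proof.
move=> d0 d1 K1 [sK sd].
have := @square_packing (size s) [set: 'I_(size s)]%SET (fun j => s`_j)
  (fun=> d / 4) (square 0 2) (measurable_square 0 2).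
rewrite area2_square// => h.
have {h} : ((\sum_(j in [set: 'I_(size s)]%SET) 4 * (d / 4) ^+ 2)%:E <= (4 * 2 ^+ 2 : R)%:E)%E.
  apply: h => [j _|j _|i j _ _ ij].
  - by rewrite divr_ge0// ltW.
  - apply: square_sub; rewrite subr0; have := K1 _ (sK j (ltn_ord j)) => ?; lra.
  - by have := sd i j (ltn_ord i) (ltn_ord j) ij => ?; lra.
rewrite lee_fin sumr_const cardsT card_ord -mulr_natl.
rewrite ler_pdivlMr ?exprn_gt0// => ?; lra.
Qed.

(** By [separated_size] some separated list has greatest size; a point of [K] far from all of its
    members could be added to it. *)
Lemma separated_maximal K d : 0 < d -> d <= 1 -> (forall x, K x -> cabs x <= 1) ->
  exists s, separated K d s /\
    forall x, K x -> exists2 j, (j < size s)%N & cabs (x - s`_j) < d.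
Proof.
move=> d0 d1 K1; pose P n := `[< exists s, separated K d s /\ size s = n >].
have exP : exists n, P n by exists 0%N; apply/asboolP; exists [::].
have bP n : P n -> (n <= Num.bound (64 / d ^+ 2))%N.
  move/asboolP => [s [sep <-]]; apply: ltnW; rewrite -(ltr_nat R).
  apply: le_lt_trans (separated_size d0 d1 K1 sep) _.
  by apply: archi_boundP; rewrite divr_ge0// sqr_ge0.
have [n /asboolP[s [[sK sd] sn]] nmax] := ex_maxnP exP bP.
exists s; split => // x Kx; apply: contrapT => far.
have far' j : (j < size s)%N -> d <= cabs (x - s`_j).
  by move=> js; rewrite leNgt; apply/negP => h; apply: far; exists j.
have : P n.+1.
  apply/asboolP; exists (x :: s); split; last by rewrite /= sn.
  split=> [[|j]//= /sK//|[|i] [|j]//= hi hj ij]; first exact: far'.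
    by rewrite cabsC; exact: far'.
  exact: sd.
by move/nmax; rewrite ltnn.
Qed.

Definition holomorphic_motion (K : set C) (h : C -> C -> C) := [/\
  forall x, K x -> hol (h x) 0 1,
  forall x z, K x -> cabs z < 1 -> cabs (h x z) <= 1,
  forall x, K x -> h x 0 = x &
  forall x y z, K x -> K y -> cabs z < 1 -> h x z = h y z -> x = y].

Lemma motion_neq K h x y z : holomorphic_motion K h -> K x -> K y -> cabs z < 1 -> x != y ->
  h x z - h y z != 0.
Proof.
move=> [_ _ _ inj] Kx Ky z1; apply: contra_neq => /subr0_eq; exact: inj.
Qed.

(** The quotient fed to Schottky's theorem omits [1] because [h y] and [h y'] never meet, and has
    modulus at most [1] at [0] because [y] is no farther from [x] than [y']. The case [y = y'] is
    separate, the quotient being [1]. *)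
Lemma motion_distortion : exists M s : R, [/\ 1 <= M, 0 < s, s < 1 &
  forall K h, holomorphic_motion K h -> forall x y y', K x -> K y -> K y' -> x != y -> x != y' ->
  cabs (x - y) <= cabs (x - y') -> forall z, cabs z <= s ->
  cabs (h x z - h y z) <= M * cabs (h x z - h y' z)].
Proof.
have [M [s [M0 s0 H]]] := schottky_small R.
exists (M + 1), (Num.min s 2^-1); split.
- by rewrite lerDr.
- by rewrite lt_min s0/=; lra.
- by rewrite gt_min; apply/orP; right; lra.
move=> K h mo x y y' Kx Ky Ky' xy xy' xyy z; rewrite le_min => /andP[zs z2].
have [Hh h1 h0 inj] := mo.
have z1 : cabs z < 1 by lra.
have [<-|yy'] := eqVneq y y'.
  by rewrite ler_peMl ?cabs_ge0// lerDr.
have nz w : cabs w < 1 -> h x w - h y' w != 0 by move=> w1; exact: motion_neq mo _ _ _ _.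
pose f w := (h x w - h y w) / (h x w - h y' w).
have Hf : hol f 0 1.
  move=> w; rewrite subr0 => w1; eexists.
  have w1' : cabs (w - 0) < 1 by rewrite subr0.
  exact: (gderiv_div (gderivB (hol_cder (Hh _ Kx) w1') (hol_cder (Hh _ Ky) w1'))
    (gderivB (hol_cder (Hh _ Kx) w1') (hol_cder (Hh _ Ky') w1')) (nz _ w1)).
have : cabs (f z) <= M.
  apply: H => //.
  - move=> w w1; rewrite mulf_neq0 ?invr_eq0 ?nz//.
    exact: motion_neq mo _ _ _ _.
  - move=> w w1; apply/eqP => /(congr1 (fun u => u * (h x w - h y' w))).
    rewrite divfK ?nz// mul1r => /(addrI (h x w))/oppr_inj/(inj _ _ _ Ky Ky' w1).
    by move/eqP; rewrite (negbTE yy').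
  - have x0 : 0 < cabs (x - y') by rewrite cabs_gt0 subr_eq0.
    by rewrite /f !h0// cabsM cabsV ler_pdivrMr// mul1r.
rewrite cabsM cabsV ler_pdivrMr ?cabs_gt0 ?nz// => /le_trans; apply.
by rewrite ler_wpM2r ?cabs_ge0// lerDl.
Qed.

Lemma hol_prod (I : finType) (J : {set I}) (G : I -> C -> C) a r :
  (forall j, j \in J -> hol (G j) a r) -> hol (fun z => \prod_(j in J) G j z) a r.
Proof.
move=> HG z zr.
suff H (s : seq I) : {subset s <= J} -> exists d, cderiv (fun z => \prod_(j <- s) G j z) z d.
  have [|d hd] := H (enum J); first by move=> j; rewrite mem_enum.
  exists d; congr (cderiv _ z d): hd.
  by apply/funext => w; rewrite big_enum.
elim: s => [_|j s IH sJ]; first by exists 0; under eq_fun do rewrite big_nil; exact: gderiv_cst.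
have [|d hd] := IH; first by move=> i si; apply: sJ; rewrite inE si orbT.
have [|d' hd'] := HG j _ z zr; first by apply: sJ; rewrite inE eqxx.
eexists; under eq_fun do rewrite big_cons; exact: gderivM hd' hd.
Qed.

Lemma hol_dilate f (s : R) : 0 < s -> s <= 1 -> hol f 0 1 -> hol (fun z => f (s%:C * z)) 0 1.
Proof.
move=> s0 s1 Hf z; rewrite subr0 => z1.
have [|d hd] := Hf (s%:C * z).
  by rewrite subr0 cabsM cabs_real gtr0_norm//; have := cabs_ge0 z => ?; nra.
by eexists; exact: (gderiv_comp (gderivZ s%:C (gderiv_id _ z)) hd).
Qed.

(* Harnack's inequality bounds from below the product of the displacements of
   the points of a separated set from their nearest neighbours; by the
   inequality of arithmetic and geometric means, so is the sum of the areas of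
   disjoint squares centred at these points. *)
Lemma motion_area : exists2 r : R, 0 < r < 1 & forall k : R, 0 < k ->
  exists2 c : R, 0 < c & forall K h, holomorphic_motion K h ->
  (forall U : set R2, measurable U -> @realify R @` K `<=` U -> (k%:E <= area2 U)%E) ->
  forall z, cabs z <= r -> forall t : R, 0 < t -> forall U : set R2, measurable U ->
  (forall x, K x -> square (h x z) t `<=` U) -> (c%:E <= area2 U)%E.
Proof.
have [M [s [M1 s0 s1 Hdist]]] := motion_distortion.
have M0 : 0 < M by lra.
(* Distortion is controlled for [cabs z <= s]; Harnack's inequality, rescaled to this disc, costs
   the factor [48]. *)
exists (s / 48); first by apply/andP; split; lra.
(* Disjoint squares of half side [cabs (G j w) / (4 * M)] will lie in [square 0 2], of area [16], so
   [B] bounds the sum of all [cabs (G j w) ^+ 2]. *)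
move=> k k0; pose B := 64 * M ^+ 2.
have B0 : 0 < B by rewrite mulr_gt0// exprn_gt0.
exists ((k / 8) ^+ 2 / B / (4 * M ^+ 2)).
  by rewrite !divr_gt0 ?exprn_gt0 ?mulr_gt0 ?exprn_gt0// divr_gt0.
move=> K h mo hK z zr t t0 U mU KU.
have [Hh h1 h0 inj] := mo.
have K1 x : K x -> cabs x <= 1 by move=> Kx; rewrite -{1}(h0 _ Kx) h1// cabs0.
(* Harnack's inequality for [G j / 2] turns a displacement below [8 * t ^+ 2] at [0] into one of at
   most [4 * t] at [z], whose square then has half side at most [t]. *)
pose e := 8 * t ^+ 2.
have e0 : 0 < e by rewrite mulr_gt0// exprn_gt0.
(* Among [q] or more points, at most half have a displacement of [e] or more at [0]; the summand [2]
   provides nearest neighbours. *)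
pose q := 2 * B / e ^+ 2 + 2.
have q0 : 0 < q by rewrite addr_gt0// divr_gt0 ?exprn_gt0// mulr_gt0.
(* Fewer than [q] squares of half side [d] cannot cover an outer area of [k]; [d <= 1] allows
   [d ^+ 2] to be replaced by [d]. *)
pose d := Num.min 1 (k / (4 * q)).
have d0 : 0 < d by rewrite lt_min ltr01 divr_gt0// mulr_gt0.
have d1 : d <= 1 by rewrite ge_min lexx.
have dk : d ^+ 2 <= k / (4 * q).
  apply: (@le_trans _ _ d); first by rewrite expr2 ler_piMl// ltW.
  by rewrite ge_min lexx orbT.
have [S [[SK Sd] Smax]] := separated_maximal d0 d1 K1.
pose n := size S; pose x (j : 'I_n) := S`_j.
have Kx j : K (x j) by exact: SK.
have xd i j : i != j -> d <= cabs (x i - x j) by move=> ij; exact: Sd.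
have kn : k <= n%:R * (4 * d ^+ 2).
  apply: (square_covering (w := fun j => S`_j) (ltW d0) hK) => _ [y Ky <-].
  have [j jS yj] := Smax y Ky; exists j => //; apply/in_square => /=.
  have := Re_le_cabs (y - S`_j); have := Im_le_cabs (y - S`_j).
  rewrite cReB cImB !ler_norml => /andP[? ?] /andP[? ?].
  by split; apply/andP; split; rlra.
have qn : q <= n%:R.
  have q4 : 0 < 4 * q by rewrite mulr_gt0.
  have : n%:R * (4 * d ^+ 2) <= n%:R * (4 * (k / (4 * q))) by rewrite !ler_wpM2l.
  move/(le_trans kn).
  rewrite (_ : n%:R * (4 * (k / (4 * q))) = k * (n%:R / q)); last by field; rewrite gt_eqF.
  by rewrite ler_pMr// ler_pdivlMr// mul1r.
have n2 : (2 <= n)%N.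
  rewrite -(ler_nat R); apply: le_trans qn; rewrite lerDr.
  by rewrite divr_ge0 ?sqr_ge0// mulr_ge0// ltW.
have /choice[nb nbP] : forall j : 'I_n, exists i : 'I_n,
    i != j /\ forall l, l != j -> cabs (x j - x i) <= cabs (x j - x l).
  move=> j; have /card_gt0P[i0 i0j] : (0 < #|predC1 j|)%N.
    by rewrite cardC1 card_ord -subn1 subn_gt0.
  have [i ij imin] := @Order.TotalTheory.arg_minP _ _ _ i0 (predC1 j)
    (fun l => cabs (x j - x l)) i0j.
  by exists i; split.
have s1' w : cabs w <= s -> cabs w < 1 by move=> ?; lra.
pose G (j : 'I_n) w := h (x j) w - h (x (nb j)) w.
have xnb j : x j != x (nb j).
  rewrite -subr_eq0 -cabs_gt0; apply: lt_le_trans d0 (xd _ _ _).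
  by rewrite eq_sym; have [] := nbP j.
have Gdist i j w : i != j -> cabs w <= s -> cabs (G j w) <= M * cabs (h (x j) w - h (x i) w).
  move=> ij ws; have [nbj nbmin] := nbP j.
  apply: Hdist mo _ _ _ _ _ _ _ _ _ _ ws => //; last exact: nbmin.
  rewrite -subr_eq0 -cabs_gt0; apply: lt_le_trans d0 (xd _ _ _).
  by rewrite eq_sym.
have pack (J : {set 'I_n}) w (V : set R2) : cabs w <= s -> measurable V ->
    (forall j, j \in J -> square (h (x j) w) (cabs (G j w) / (4 * M)) `<=` V) ->
    (((\sum_(j in J) cabs (G j w) ^+ 2) / (4 * M ^+ 2))%:E <= area2 V)%E.
  move=> ws mV sV.
  have -> : (\sum_(j in J) cabs (G j w) ^+ 2) / (4 * M ^+ 2) =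
      \sum_(j in J) 4 * (cabs (G j w) / (4 * M)) ^+ 2.
    by rewrite mulr_suml; apply: eq_bigr => j _; field; rewrite gt_eqF.
  apply: (square_packing (w := fun j => h (x j) w)) => //.
    by move=> j _; rewrite divr_ge0 ?cabs_ge0// mulr_ge0// ltW.
  move=> i j iJ jJ ij.
  have := Gdist _ _ _ ij ws; rewrite eq_sym in ij; have := Gdist _ _ _ ij ws.
  rewrite (cabsC (h (x j) w)) => g1 g2.
  rewrite -mulrDl mulrA ler_pdivrMr ?mulr_gt0//; lra.
have total w : cabs w <= s -> \sum_j cabs (G j w) ^+ 2 <= B.
  move=> ws; have w1 := s1' _ ws.
  have := pack [set: 'I_n]%SET w (square 0 2) ws (measurable_square 0 2).
  rewrite area2_square// => H; have {H} := H _; rewrite lee_fin.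
  rewrite (eq_bigl xpredT) => [|j]; last by rewrite inE.
  rewrite ler_pdivrMr ?mulr_gt0 ?exprn_gt0// => H.
  apply: le_trans (H _) _; last by rewrite /B le_eqVlt; apply/orP; left; apply/eqP; ring.
  move=> j _; apply: square_sub; rewrite subr0.
  have a1 := h1 _ _ (Kx j) w1; have a2 := h1 _ _ (Kx (nb j)) w1.
  have a3 : cabs (G j w) <= 2.
    by apply: (le_trans (cabsB _ _)); lra.
  have : cabs (G j w) / (4 * M) <= 1.
    by rewrite ler_pdivrMr ?mulr_gt0//; lra.
  lra.
(* Only for these indices are the squares at [z] small enough to lie in [U]. *)
pose J := [set j | cabs (G j 0) < e]%SET.
pose m := #|J|.
have c00 : cabs (0 : C) <= s by rewrite cabs0 ltW.
have mn : n%:R <= 2 * m%:R :> R.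
  have bad : #|~: J|%:R * e ^+ 2 <= B.
    apply: le_trans (total 0 c00); rewrite (bigID (mem J))/= addrC.
    rewrite -[leLHS]addr0; apply: lerD; last by apply: sumr_ge0 => j _; exact: sqr_ge0.
    rewrite mulr_natl -sumr_const [leRHS](eq_bigl (mem (~: J))); last first.
      by move=> j; rewrite !inE.
    apply: ler_sum => j; rewrite !inE -leNgt => ej.
    by rewrite ler_pXn2r ?nnegrE ?cabs_ge0// ltW.
  have : n%:R = m%:R + #|~: J|%:R :> R by rewrite -natrD /m cardsC card_ord.
  move: bad; rewrite -ler_pdivlMr ?exprn_gt0// => bad E.
  move: qn; rewrite /q => qn; lra.
have n0 : 0 < n%:R :> R by rewrite ltr0n (leq_trans _ n2).
have m0 : 0 < m%:R :> R by lra.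
have mk : k / 8 <= m%:R * d ^+ 2.
  have : n%:R * d ^+ 2 <= 2 * m%:R * d ^+ 2 by rewrite ler_wpM2r ?sqr_ge0.
  lra.
have AGM w : \prod_(j in J) cabs (G j w) ^+ 2 <=
    ((\sum_(j in J) cabs (G j w) ^+ 2) / m%:R) ^+ m.
  have := leif_AGM (A := mem J) (E := fun j => cabs (G j w) ^+ 2).
  by case=> [j _|]; [exact: sqr_ge0|move=> H _; exact: H].
pose P w := \prod_(j in J) G j w.
have cP w : cabs (P w) ^+ 2 = \prod_(j in J) cabs (G j w) ^+ 2.
  rewrite prodrXl; congr (_ ^+ 2); rewrite /P.
  by elim/big_rec2: _ => [|j a b _ <-]; rewrite ?cabs1 ?cabsM.
have sumJ w : \sum_(j in J) cabs (G j w) ^+ 2 <= \sum_j cabs (G j w) ^+ 2.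
  rewrite [leRHS](bigID (mem J))/= -[leLHS]addr0 lerD2l.
  by apply: sumr_ge0 => j _; exact: sqr_ge0.
pose b := (B / m%:R) ^+ m.
have b0 : 0 < b by rewrite exprn_gt0// divr_gt0.
have Pb w : cabs w <= s -> cabs (P w) ^+ 2 <= b.
  move=> ws; rewrite cP; apply: (le_trans (AGM w)).
  have S0 : 0 <= \sum_(j in J) cabs (G j w) ^+ 2 by apply: sumr_ge0 => j _; exact: sqr_ge0.
  apply: lerXn2r; rewrite ?nnegrE.
  - by rewrite divr_ge0// ltW.
  - by rewrite divr_ge0// ltW.
  by rewrite ler_pM2r ?invr_gt0//; exact: le_trans (sumJ w) (total w ws).
have HG j : hol (G j) 0 1.
  move=> w w1; have [l hl] := Hh _ (Kx j) w w1; have [l' hl'] := Hh _ (Kx (nb j)) w w1.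
  by exists (l - l'); exact: gderivB.
have G0 j w : cabs w < 1 -> G j w != 0 by move=> w1; exact: motion_neq mo _ _ _ _.
have sw w : cabs w < 1 -> cabs (s%:C * w) <= s.
  by move=> w1; rewrite cabsM cabs_real gtr0_norm// ler_piMr// ltW.
pose v := s%:C^-1 * z.
have sC0 : s%:C != 0 :> C by rewrite -cabs_gt0 cabs_real normr_gt0 gt_eqF.
have sv : s%:C * v = z by rewrite /v mulrA divff// mul1r.
have v48 : cabs v <= 48^-1.
  by rewrite /v cabsM cabsV cabs_real gtr0_norm// mulrC ler_pdivrMr// mulrC.
have Gsmall j : j \in J -> cabs (G j z) <= 4 * t.
  rewrite inE => je.
  have HQ : hol (fun w => 2^-1 * G j (s%:C * w)) 0 1.
    move=> w w1; have [l hl] := hol_dilate s0 (ltW s1) (HG j) w1.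
    by exists (2^-1 * l); exact: gderivZ.
  have [w w1|w w1|_] := harnack HQ _ _ v48.
  - by rewrite mulf_neq0 ?invr_eq0 ?pnatr_eq0// G0// s1'// sw.
  - rewrite cabsM cabsV cabs_nat; apply: (@le_trans _ _ (2^-1 * 2)); last by rewrite mulVf.
    have w2 := s1' _ (sw _ w1).
    rewrite ler_pM2l ?invr_gt0//; apply: (le_trans (cabsB _ _)).
    by have := h1 _ _ (Kx j) w2; have := h1 _ _ (Kx (nb j)) w2 => ? ?; lra.
  rewrite mulr0 sv !cabsM cabsV cabs_nat exprMn => H.
  rewrite -(@ler_pXn2r _ 2) ?nnegrE ?cabs_ge0 ?mulr_ge0 ?ltW//.
  by rewrite exprMn; move: je; rewrite /e => je; lra.
(* Dividing by [sb] bounds [P] by [1] on the disc of radius [s], as [harnack] requires. *)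
pose sb := Num.sqrt b.
have sb0 : 0 < sb by rewrite sqrtr_gt0.
have sb2 : sb ^+ 2 = b by rewrite sqr_sqrtr// ltW.
have HQ : hol (fun w => sb%:C^-1 * P (s%:C * w)) 0 1.
  have HP : hol P 0 1 by apply: hol_prod => j _; exact: HG.
  move=> w w1; have [l hl] := hol_dilate s0 (ltW s1) HP w1.
  by exists (sb%:C^-1 * l); exact: gderivZ.
have csb (y : C) : cabs (sb%:C^-1 * y) = cabs y / sb.
  by rewrite cabsM cabsV cabs_real gtr0_norm// mulrC.
have [w w1|w w1|H _] := harnack HQ _ _ v48.
- rewrite mulf_neq0//; first by rewrite invr_eq0 -cabs_gt0 cabs_real normr_gt0 gt_eqF.
  by apply/prodf_neq0 => j _; rewrite G0// s1'// sw.
- rewrite csb ler_pdivrMr// mul1r -(@ler_pXn2r _ 2) ?nnegrE ?cabs_ge0 ?(ltW sb0)//.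
  by rewrite sb2; apply: Pb; exact: sw.
rewrite mulr0 sv !csb in H.
have {}H : (cabs (P 0) ^+ 2) ^+ 2 / b <= cabs (P z) ^+ 2.
  have H2 : ((cabs (P 0) / sb) ^+ 2) ^+ 2 <= (cabs (P z) / sb) ^+ 2.
    by rewrite ler_pXn2r ?nnegrE ?sqr_ge0 ?divr_ge0 ?cabs_ge0 ?(ltW sb0).
  rewrite -(@ler_pM2r _ b^-1) ?invr_gt0//.
  rewrite -sb2 [leLHS](_ : _ = ((cabs (P 0) / sb) ^+ 2) ^+ 2); last first.
    by field; rewrite gt_eqF.
  by rewrite [leRHS](_ : _ = (cabs (P z) / sb) ^+ 2)//; field; rewrite gt_eqF.
have zs : cabs z <= s by lra.
have P0d : (d ^+ 2) ^+ m <= cabs (P 0) ^+ 2.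
  rewrite cP /m -prodr_const; apply: ler_prod => j _; rewrite sqr_ge0/=.
  rewrite ler_pXn2r ?nnegrE ?cabs_ge0 ?(ltW d0)// /G !h0//; apply: xd.
  by rewrite eq_sym; have [] := nbP j.
pose Sz := \sum_(j in J) cabs (G j z) ^+ 2.
have Sz0 : 0 <= Sz by apply: sumr_ge0 => j _; exact: sqr_ge0.
(* Harnack's lower bound for [P z], where [P 0] has modulus at least [d ^+ m], meets the means
   inequality at [z]. Taking the [m]-th root leaves only [m * d ^+ 2], which [mk] bounds below. *)
have : (d ^+ 2 * d ^+ 2 * (m%:R / B)) ^+ m <= (Sz / m%:R) ^+ m.
  apply: le_trans (AGM z); rewrite -cP; apply: le_trans H.
  rewrite exprMn (_ : (m%:R / B) ^+ m = b^-1); last by rewrite /b -exprVn invf_div.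
  rewrite ler_pM2r ?invr_gt0// exprMn [leRHS]expr2.
  by apply: ler_pM => //; rewrite exprn_ge0// sqr_ge0.
have mg0 : (0 < m)%N by rewrite -(ltr0n R).
rewrite ler_pXn2r ?nnegrE//; last 2 first.
- by apply: mulr_ge0; [apply: mulr_ge0; exact: sqr_ge0|apply: divr_ge0; exact: ltW].
- by apply: divr_ge0 => //; exact: ltW.
rewrite ler_pdivlMr// => HS.
have {}HS : (k / 8) ^+ 2 / B <= Sz.
  apply: le_trans HS; rewrite (_ : _ * _ * m%:R = (m%:R * d ^+ 2) ^+ 2 / B).
    rewrite ler_pM2r ?invr_gt0// ler_pXn2r ?nnegrE//.
      by rewrite divr_ge0// ltW.
    by rewrite mulr_ge0 ?sqr_ge0.
  by field; rewrite gt_eqF.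
have := pack J z U zs mU; rewrite -/Sz => H2; have {}H2 := H2 _.
apply: le_trans (H2 _); first by rewrite lee_fin ler_pM2r ?invr_gt0 ?mulr_gt0 ?exprn_gt0.
move=> j jJ; apply: subset_trans (KU _ (Kx j)).
apply: square_sub; rewrite subrr cabs0 add0r ler_pdivrMr ?mulr_gt0//.
by apply: le_trans (Gsmall _ jJ) _; rewrite mulrCA ler_pM2l// ler_peMr// ltW.
Qed.

End area.

(** * Inner regularity and Lusin's theorem in the plane *)

Section regularity.
Variable R : realType.
Local Notation R1 := (measurableTypeR R).
Local Notation R2 := (R1 * R1)%type.
Local Notation mu := (@lebesgue_measure R).
Local Notation oarea := ((@area2 R)^*)%mu.

(** A countable base for the topology made of members of [M]: it puts the open sets into the
    sigma-algebra [M], and it passes to products. *)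
Definition measurable_base (T : topologicalType) (M : set (set T)) :=
  exists D : nat -> set T, (forall n, M (D n)) /\
    forall x N, nbhs x N -> exists n, D n x /\ D n `<=` N.

Lemma measurable_baseR : @measurable_base R (@measurable _ R1).
Proof.
exists (fun n => if unpickle n is Some ab then
  `](ratr ab.1 : R), (ratr ab.2 : R)[%classic else set0); split.
  by move=> n; case: unpickle => [ab|]; [exact: measurable_itv|exact: measurable0].
move=> x N /nbhs_ballP[e /= e0 eN].
have [|a] := @rat_in_itvoo R (x - e) x; first by lra.
rewrite in_itv/= => /andP[a1 a2].
have [|b] := @rat_in_itvoo R x (x + e); first by lra.
rewrite in_itv/= => /andP[b1 b2].
exists (pickle (a, b)); rewrite pickleK/= in_itv/= a2 b1; split => // y.
rewrite /= in_itv/= => /andP[y1 y2]; apply: eN.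
by rewrite /ball/= ltr_norml; lra.
Qed.

Lemma measurable_base_prod (T1 T2 : topologicalType) M1 M2 (M : set (set (T1 * T2))) :
  (forall A B, M1 A -> M2 B -> M (A `*` B)) -> M set0 ->
  measurable_base M1 -> measurable_base M2 -> measurable_base M.
Proof.
move=> MX M0 [D1 [mD1 H1]] [D2 [mD2 H2]].
exists (fun n => if unpickle n is Some ij then D1 ij.1 `*` D2 ij.2 else set0); split.
  by move=> n; case: unpickle => // ij; exact: MX.
move=> [x y] N [[A B] /= [nA nB] ABN].
have [i [ix iA]] := H1 _ _ nA; have [j [jy jB]] := H2 _ _ nB.
exists (pickle (i, j)); rewrite pickleK; split => // -[u v] [/= /iA Au /jB Bv].
exact: ABN.
Qed.

Lemma measurable_base_open (T : topologicalType) (M : set (set T)) (U : set T) :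
  M set0 -> (forall F : nat -> set T, (forall n, M (F n)) -> M (\bigcup_n F n)) ->
  measurable_base M -> open U -> M U.
Proof.
move=> M0 MU [D [mD HD]] oU.
have -> : U = \bigcup_n (if pselect (D n `<=` U) then D n else set0).
  apply/seteqP; split => [x Ux|x [n _]]; last by case: pselect => // nU /nU.
  have [n [nx nU]] := HD x U (open_nbhs_nbhs (conj oU Ux)).
  by exists n => //; case: pselect.
by apply: MU => n; case: (pselect (D n `<=` U)) => ? /=; [exact: mD|exact: M0].
Qed.

Lemma measurable_base2 : @measurable_base (R * R)%type (@measurable _ R2).
Proof.
apply: measurable_base_prod measurable_baseR measurable_baseR; last exact: measurable0.
by move=> A B mA mB; exact: measurableX.
Qed.

Lemma open_measurable2 (U : set (R * R)) : open U -> @measurable _ R2 U.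
Proof.
apply: measurable_base_open measurable_base2; first exact: measurable0.
by move=> F mF; exact: bigcupT_measurable.
Qed.

Lemma closed_measurable2 (U : set (R * R)) : closed U -> @measurable _ R2 U.
Proof.
by move=> /closed_openC/open_measurable2/measurableC; rewrite setCK.
Qed.

Lemma closed_measurable4 (U : set ((R * R) * (R * R))) : closed U ->
  @measurable _ (R2 * R2)%type U.
Proof.
move=> /closed_openC oU; rewrite -[U]setCK; apply: measurableC.
apply: measurable_base_open oU.
- exact: measurable0.
- by move=> F mF; exact: bigcupT_measurable.
apply: measurable_base_prod measurable_base2 measurable_base2; last exact: measurable0.
by move=> A B mA mB; exact: measurableX.
Qed.

Let I2 := `[(-2 : R), 2[%classic.
Let Q : set R2 := square 0 2.

Let QE : Q = I2 `*` I2.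
Proof.
rewrite /Q /square (_ : complex.Re 0 = 0 :> R)// (_ : complex.Im 0 = 0 :> R)//.
congr (_ `*` _); apply/seteqP; split => x; rewrite /I2 /= !in_itv/= => ?; lra.
Qed.

Let Qfin : (area2 Q < +oo)%E.
Proof. by rewrite area2_square// ltry. Qed.

(** Approximating a set and its complement together, from within, makes the notion symmetric under
    complements, so that regular sets form a sigma-algebra. *)
Definition regular (X : set R2) := forall e : R, 0 < e ->
  exists F F' : set (R * R), [/\ closed F, closed F', F `<=` X, F' `<=` ~` X &
    (area2 (Q `\` (F `|` F')) < e%:E)%E].

Let regular1 (A : set R) (e : R) : measurable (A : set R1) -> 0 < e ->
  exists V V' : set R, [/\ closed V, closed V', V `<=` A, V' `<=` ~` A &
    (mu (I2 `\` (V `|` V')) < (2 * e)%:E)%E].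
Proof.
move=> mA e0.
have mI : measurable (I2 : set R1) by exact: measurable_itv.
have fin B : measurable (B : set R1) -> (mu (B `&` I2) < +oo)%E.
  move=> mB; apply: (@le_lt_trans _ _ (mu I2)).
    by apply: le_measure; rewrite ?inE//; exact: measurableI.
  by rewrite lebesgue_measure_itv/=; case: ifP => _; rewrite ?ltry// -EFinB ltry.
have mA' : measurable (~` A : set R1) by exact: measurableC.
have [V [cV VA mV]] := lebesgue_regularity_inner (measurableI _ _ mA mI) (fin _ mA) e0.
have [W [cW WA mW]] := lebesgue_regularity_inner (measurableI _ _ mA' mI) (fin _ mA') e0.
have clV := compact_closed (@Rhausdorff R) cV.
have clW := compact_closed (@Rhausdorff R) cW.
have mVs := measurable_realfun.closed_measurable clV; have mWs := measurable_realfun.closed_measurable clW.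
exists V, W; split => //; [by move=> x /VA[]|by move=> x /WA[]|].
have m1 : measurable ((A `&` I2) `\` V : set R1).
  by apply: measurableD => //; exact: measurableI.
have m2 : measurable ((~` A `&` I2) `\` W : set R1).
  by apply: measurableD => //; exact: measurableI.
apply: (@le_lt_trans _ _ (mu ((A `&` I2) `\` V `|` (~` A `&` I2) `\` W))).
  apply: le_measure; rewrite ?inE//.
  - by apply: measurableD => //; exact: measurableU.
  - exact: measurableU.
  move=> x [Ix nVW]; have [Ax|nAx] := pselect (A x); [left|right]; split => //.
    by move=> Vx; apply: nVW; left.
  by move=> Wx; apply: nVW; right.
apply: (le_lt_trans (measureU2 mu m1 m2)).
by rewrite mulr_natl mulr2n EFinD; exact: lteD.
Qed.

Let regular_rect (A B : set R) : measurable (A : set R1) -> measurable (B : set R1) ->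
  regular (A `*` B).
Proof.
move=> mA mB e e0.
have e16 : 0 < e / 32 by rewrite divr_gt0.
have [V [V' [cV cV' VA VA' mV]]] := regular1 mA e16.
have [W [W' [cW cW' WB WB' mW]]] := regular1 mB e16.
have cfst (X : set R) : closed X -> closed (@fst R R @^-1` X).
  by move=> cX; apply: closed_comp cX => x _; exact: cvg_fst.
have csnd (X : set R) : closed X -> closed (@snd R R @^-1` X).
  by move=> cX; apply: closed_comp cX => x _; exact: cvg_snd.
exists ((@fst R R @^-1` V) `&` (@snd R R @^-1` W)),
  ((@fst R R @^-1` V') `|` (@snd R R @^-1` W')); split.
- by apply: closedI; [exact: cfst|exact: csnd].
- by apply: closedU; [exact: cfst|exact: csnd].
- by move=> p [/VA ? /WB ?].
- by move=> p [/VA' nA [/nA]|/WB' nB [_ /nB]].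
have mI : measurable (I2 : set R1) by exact: measurable_itv.
pose N1 : set R1 := I2 `\` (V `|` V'); pose N2 : set R1 := I2 `\` (W `|` W').
have mN1 : measurable N1.
  by apply: measurableD => //; apply: measurableU; exact: measurable_realfun.closed_measurable.
have mN2 : measurable N2.
  by apply: measurableD => //; apply: measurableU; exact: measurable_realfun.closed_measurable.
have mL : @measurable _ R2 (N1 `*` I2) by exact: measurableX.
have mR : @measurable _ R2 (I2 `*` N2) by exact: measurableX.
apply: (@le_lt_trans _ _ (area2 (N1 `*` I2 `|` I2 `*` N2))).
  apply: le_measure; rewrite ?inE//.
  - apply: measurableD; first exact: measurable_square.
    apply: measurableU; apply: closed_measurable2.
      by apply: closedI; [exact: cfst|exact: csnd].
    by apply: closedU; [exact: cfst|exact: csnd].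
  - exact: measurableU.
  rewrite QE => p [[I1 I1'] np].
  have [VV|nVV] := pselect ((V `|` V') p.1); last by left.
  right; split => //; split => // -[WW|WW]; apply: np; last by right; right.
  by case: VV => VV; [left|right; left].
apply: (le_lt_trans (measureU2 (@area2 R) mL mR)).
have muI : mu I2 = 4%:E.
  rewrite lebesgue_measure_itv/= lte_fin; case: ifPn => [_|].
    by rewrite -EFinB; congr EFin; ring.
  by rewrite -leNgt => ?; exfalso; lra.
have l1 : (area2 (N1 `*` I2) < (e / 2)%:E)%E.
  rewrite /area2 product_measure1E//.
  apply: (@lt_le_trans _ _ ((2 * (e / 32))%:E * 4%:E)%E).
    by rewrite [X in (_ * X < _)%E]muI lte_pmul2r ?lte_fin.
  by rewrite -EFinM lee_fin; lra.
have l2 : (area2 (I2 `*` N2) < (e / 2)%:E)%E.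
  rewrite /area2 product_measure1E//.
  apply: (@lt_le_trans _ _ (4%:E * (2 * (e / 32))%:E)%E).
    by rewrite [X in (X * _ < _)%E]muI lte_pmul2l ?lte_fin.
  by rewrite -EFinM lee_fin; lra.
by apply: (lt_le_trans (lteD l1 l2)); rewrite -EFinD lee_fin; lra.
Qed.

Lemma measurable_regular (X : set R2) : measurable X -> regular X.
Proof.
rewrite measurable_prod_measurableType; apply: smallest_sub; last first.
  by move=> _ [A mA [B mB <-]]; exact: regular_rect.
split.
- move=> e e0; exists set0, setT; split.
  + exact: closed0.
  + exact: closedT.
  + by [].
  + by move=> x _ [].
  + by rewrite set0U setDT measure0.
- move=> A rA e e0; have [F [F' [cF cF' FA FA' lt]]] := rA e e0.
  exists F', F; split => //; first by move=> x /FA' ?; split.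
    by move=> x /FA Ax [_ nA]; exact: nA.
  by rewrite setUC.
move=> A rA e e0.
have /choice[FF FFP] : forall n, exists FF : set (R * R) * set (R * R),
    [/\ closed FF.1, closed FF.2, FF.1 `<=` A n, FF.2 `<=` ~` A n &
    (area2 (Q `\` (FF.1 `|` FF.2)) < (e / 2 / (2 ^ n.+1)%:R)%:E)%E].
  move=> n; have [|F [F' H]] := rA n (e / 2 / (2 ^ n.+1)%:R); last by exists (F, F').
  by rewrite !divr_gt0// ltr0n expn_gt0.
(* The union of all the sets [(FF i).1] need not be closed, so it is cut at an [n] for which the
   lost part [D n] is small. On the side of the complement the intersection [G] is already
   closed. *)
pose U n := \bigcup_(i < n) (FF i).1.
pose G := \bigcap_n (FF n).2.
have cU n : closed (U n).
  rewrite /U bigcup_mkord; apply: (big_ind closed); [exact: closed0|by move=> ? ?; exact: closedU|].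
  by move=> i _; have [] := FFP i.
have cG : closed G by apply: closed_bigI => i _; have [] := FFP i.
have mQ : @measurable _ R2 Q by exact: measurable_square.
pose D n : set R2 := Q `&` (\bigcup_i (FF i).1) `\` U n.
have mF i : @measurable _ R2 (FF i).1 by apply: closed_measurable2; have [] := FFP i.
have mF' i : @measurable _ R2 (FF i).2 by apply: closed_measurable2; have [] := FFP i.
have mD n : measurable (D n).
  apply: measurableD; last exact: closed_measurable2.
  by apply: measurableI => //; exact: bigcupT_measurable.
have D0 : \bigcap_n D n = set0.
  rewrite -subset0 => p Dp; have [[_ [i _ ip]] _] := Dp 0%N I.
  have [_] := Dp i.+1 I; by apply; exists i => /=.
have Dle : (fun n => area2 (D n)) @ \oo --> area2 (\bigcap_n D n).
  apply: (@nonincreasing_cvg_mu _ _ _ (@area2 R)) => //.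
  - apply: le_lt_trans Qfin; apply: le_measure; rewrite ?inE//.
    by move=> p [[]].
  - by rewrite D0; exact: measurable0.
  move=> i j ij; apply/subsetPset => p [Qp nU]; split => // iU; apply: nU.
  move: iU => -[k /= ki kp]; exists k => //=.
  exact: leq_trans ij.
rewrite D0 measure0 in Dle.
have [n Dn] : exists n, (area2 (D n) < (e / 2)%:E)%E.
  have e2 : (0 < (e / 2)%:E)%E by rewrite lte_fin divr_gt0.
  have [n _ Hn] := Dle _ (open_ereal_lt' e2).
  by exists n; exact: (Hn n (leqnn n)).
exists (U n), G; split => //.
- move=> p [i _ ip]; exists i => //.
  by have [_ _ FA _ _] := FFP i; exact: FA.
- move=> p Gp [i _ Ai]; have [_ _ _ FA' _] := FFP i; exact: (FA' _ (Gp i I)).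
pose E i : set R2 := Q `\` ((FF i).1 `|` (FF i).2).
have mE i : measurable (E i) by apply: measurableD => //; exact: measurableU.
have mUE : measurable (\bigcup_i E i) by exact: bigcupT_measurable.
apply: (@le_lt_trans _ _ (area2 (D n `|` \bigcup_i E i))).
  apply: le_measure; rewrite ?inE//.
  - apply: measurableD => //; apply: measurableU; first exact: closed_measurable2.
    exact: closed_measurable2.
  - exact: measurableU.
  move=> p [Qp np]; have [[i _ ip]|nF] := pselect ((\bigcup_i (FF i).1) p).
    by left; split; [split => //; exists i|move=> Up; apply: np; left].
  right; apply: contrapT => nE; apply: np; right => i _.
  apply: contrapT => nF'; apply: nE; exists i => //; split => // -[ip|//].
  by apply: nF; exists i.
have UEe : (area2 (\bigcup_i E i) <= (e / 2)%:E)%E.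
  apply: (le_trans (@measure_sigma_subadditive _ _ _ (@area2 R) (\bigcup_i E i) E mE mUE _)) => //.
  apply: le_trans (epsilon_trick0 xpredT (_ : 0 <= e / 2)); last by lra.
  by apply: lee_nneseries => // i _; have [_ _ _ _ /ltW] := FFP i.
apply: (le_lt_trans (measureU2 (@area2 R) (mD n) mUE)).
rewrite (_ : e = e / 2 + e / 2) ?EFinD; last by lra.
apply: lte_leD => //.
by rewrite ge0_fin_numE//; exact: le_lt_trans UEe (ltry _).
Qed.

Lemma oarea_measurable (X : set R2) : measurable X -> oarea X = area2 X.
Proof. exact: measurable_mu_extE. Qed.

(** A Borel set [G] covers the complement of [A] in [Q] with little excess; the rest of [Q] is a
    Borel subset of [A], to which [measurable_regular] applies. *)
Lemma closed_inner_regular (A : set R2) (e : R) : oarea.-cara.-measurable A ->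
  A `<=` Q -> 0 < e ->
  exists F : set (R * R), [/\ closed F, F `<=` A & (oarea (A `\` F) < e%:E)%E].
Proof.
move=> mA AQ e0; have e2 : 0 < e / 2 by rewrite divr_gt0.
have mQ : @measurable _ R2 Q by exact: measurable_square.
have fin : oarea (Q `\` A) \is a fin_num.
  rewrite ge0_fin_numE ?mu_ext_ge0//; apply: le_lt_trans Qfin.
  by rewrite -oarea_measurable//; apply: le_mu_ext => p [].
have [_ [B [mB QB] <-] Be] := lb_ereal_inf_adherent e2 fin.
pose G := \bigcup_n B n.
have mG : measurable G by apply: bigcupT_measurable.
have Ge : (oarea G < oarea (Q `\` A) + (e / 2)%:E)%E.
  apply: le_lt_trans Be.
  apply: (le_trans (outer_measure_sigma_subadditive oarea B)).
  apply: lee_nneseries => // n _.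
  by rewrite le_eqVlt; apply/orP; left; apply/eqP; exact: oarea_measurable.
(* Caratheodory's condition splits [G] along [A]. The part outside [A] accounts for the outer area
   of the complement, so the part inside is below the excess. *)
have GA : (oarea (G `&` A) < (e / 2)%:E)%E.
  have := mA G; rewrite /= => E; rewrite E in Ge.
  have : (oarea (Q `\` A) <= oarea (G `&` ~` A))%E.
    by apply: le_mu_ext => p [Qp nA]; split => //; exact: QB.
  move=> /(leeD2l (oarea (G `&` A)))/le_lt_trans/(_ Ge).
  by rewrite addeC lteD2lE.
pose X : set R2 := Q `\` G.
have mX : measurable X by exact: measurableD.
have XA : X `<=` A.
  by move=> p [Qp nG]; apply: contrapT => nA; apply: nG; exact: QB.
have [F [F' [cF cF' FX F'X lt]]] := measurable_regular mX e2.
exists F; split => //; first by move=> p /FX /XA.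
have mF := closed_measurable2 cF; have mF' := closed_measurable2 cF'.
have mN : @measurable _ R2 (Q `\` (F `|` F')).
  by apply: measurableD => //; exact: measurableU.
apply: (@le_lt_trans _ _ (oarea ((G `&` A) `|` (Q `\` (F `|` F'))))).
  apply: le_mu_ext => p [Ap nF]; have [Gp|nG] := pselect (G p); first by left.
  right; split; first exact: AQ.
  by move=> [//|/F'X]; apply; split => //; exact: AQ.
apply: (le_lt_trans (outer_measureU2 oarea _ _)).
rewrite (_ : e = e / 2 + e / 2) ?EFinD; last by lra.
by rewrite -(oarea_measurable mN) in lt; apply: lteD; [exact: GA|exact: lt].
Qed.

(** Lusin's theorem for countably many sets instead of a function. Up to a small error [A] is the
    union of a closed part of [S n] and a closed part of its complement; on the intersection [K] of
    these unions every [S n] is relatively clopen. *)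
Lemma lusin_clopen (A : set R2) (S : nat -> set R2) : oarea.-cara.-measurable A ->
  A `<=` Q -> (0 < oarea A)%E -> (forall n, oarea.-cara.-measurable (S n)) ->
  exists K : set (R * R), [/\ closed K, K `<=` A, (0 < oarea K)%E &
    forall n (p : R * R), K p ->
      \forall q \near p, K q -> (S n q <-> S n p)].
Proof.
move=> mA AQ A0 mS.
have Afin : (oarea A < +oo)%E.
  apply: le_lt_trans Qfin; rewrite -oarea_measurable; last exact: measurable_square.
  exact: le_mu_ext.
have [m mE] : exists m, oarea A = m%:E.
  by exists (fine (oarea A)); rewrite fineK// ge0_fin_numE// ltW.
have m0 : 0 < m by rewrite -lte_fin -mE.
(* These errors add up to [m / 2], so at least half of the outer area of [A] remains in [K]. *)
pose d n : R := m / 2 / (2 ^ n.+1)%:R.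
have d0 n : 0 < d n by rewrite /d !divr_gt0// ltr0n expn_gt0.
have /choice[FF FFP] : forall n, exists FF : set (R * R) * set (R * R),
   [/\ closed FF.1, closed FF.2, FF.1 `<=` A `&` S n, FF.2 `<=` A `\` S n &
    (oarea (A `\` (FF.1 `|` FF.2)) <= (d n)%:E)%E].
  move=> n; have d2 : 0 < d n / 2 by rewrite divr_gt0.
  have m1 : oarea.-cara.-measurable (A `&` S n) by exact: measurableI.
  have m2 : oarea.-cara.-measurable (A `\` S n) by exact: measurableD.
  have [F [cF FA lt]] := closed_inner_regular m1 (fun p h => AQ p h.1) d2.
  have [F' [cF' FA' lt']] := closed_inner_regular m2 (fun p h => AQ p h.1) d2.
  exists (F, F'); split => //=.
  apply: (@le_trans _ _ (oarea ((A `&` S n) `\` F `|` (A `\` S n) `\` F'))).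
    apply: le_mu_ext => p [Ap np]; have [Sp|nSp] := pselect (S n p); [left|right]; split => //.
      by move=> Fp; apply: np; left.
    by move=> Fp; apply: np; right.
  apply: (le_trans (outer_measureU2 oarea _ _)).
  rewrite (_ : d n = d n / 2 + d n / 2) ?EFinD; last by lra.
  by apply: leeD; exact: ltW.
pose K := \bigcap_n ((FF n).1 `|` (FF n).2).
have KA : K `<=` A.
  move=> p /(_ 0%N I); have [_ _ F1 F2 _] := FFP 0%N.
  by case=> [/F1[]|/F2[]].
exists K; split => //.
- by apply: closed_bigI => n _; have [? ? _ _ _] := FFP n; exact: closedU.
- have AK : (oarea (A `\` K) <= (m / 2)%:E)%E.
    apply: (@le_trans _ _ (oarea (\bigcup_n (A `\` ((FF n).1 `|` (FF n).2))))).
      apply: le_mu_ext => p [Ap nK]; apply: contrapT => nU; apply: nK => n _.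
      by apply: contrapT => nF; apply: nU; exists n.
    apply: (le_trans (outer_measure_sigma_subadditive oarea _)).
    apply: le_trans (epsilon_trick0 xpredT (_ : 0 <= m / 2)); last by lra.
    by apply: lee_nneseries => // n _; have [] := FFP n.
  rewrite ltNge; apply/negP => K0.
  have : (oarea A <= (m / 2)%:E)%E.
    apply: (@le_trans _ _ (oarea (K `|` A `\` K))).
      by apply: le_mu_ext => p Ap; have [Kp|nK] := pselect (K p); [left|right].
    apply: (le_trans (outer_measureU2 oarea _ _)).
    by rewrite -[leRHS]add0e; apply: leeD.
  by rewrite mE lee_fin; lra.
move=> n p Kp; have [c1 c2 F1 F2 _] := FFP n.
have [Sp|nSp] := pselect (S n p).
  have : open_nbhs p (~` (FF n).2).
    by split; [exact: closed_openC|move=> /F2[_]].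
  move=> /open_nbhs_nbhs; apply: filterS => q nq Kq; split => // _.
  by case: (Kq n I) => [/F1[]|].
have : open_nbhs p (~` (FF n).1).
  by split; [exact: closed_openC|move=> /F1[_]].
move=> /open_nbhs_nbhs; apply: filterS => q nq Kq; split => // Sq.
by case: (Kq n I) => [//|/F2[_]].
Qed.

End regularity.

(** * From transverse disks to a holomorphic motion *)

Section graphs.
Variable R : realType.
Local Notation C := R[i].
Implicit Types (f : C -> C) (b z w : C).

(** Values of [g] are chosen pointwise from [almost_linear_image]. The expansion bound makes [g]
    Lipschitz and gives [g 0 = 0]; differentiability of [g] follows from that of [f] at [g w0]. *)
Lemma local_inverse f b (r : R) : 0 < r -> hol f 0 r -> f 0 = 0 -> b != 0 ->
  (forall z, cabs (z - 0) < r -> cabs (cder f z - b) <= cabs b / 4) ->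
  exists g, [/\ hol g 0 (cabs b * r / 12), g 0 = 0 &
    forall w, cabs w < cabs b * r / 12 -> cabs (g w) < r /\ f (g w) = w].
Proof.
move=> r0 Hf f0 b0 fb; have b1 : 0 < cabs b by rewrite cabs_gt0.
set s := cabs b * r / 12; have s0 : 0 < s by rewrite divr_gt0// mulr_gt0.
have /choice[g gP] : forall w, exists z, cabs w < s -> cabs z < r /\ f z = w.
  move=> w; have [ws|nws] := pselect (cabs w < s); last by exists 0.
  have wf : cabs (w - f 0) < cabs b * r / 12 by rewrite f0 subr0.
  have [z zr fz] := almost_linear_image Hf fb r0 wf.
  by exists z => _; rewrite subr0 in zr.
have expand u v : cabs u < r -> cabs v < r -> cabs b / 2 * cabs (u - v) <= cabs (f u - f v).
  by move=> ur vr; apply: (almost_linear_expand Hf fb); rewrite subr0.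
exists g; split => //; last first.
  have c0s : cabs (0 : C) < s by rewrite cabs0.
  have c0r : cabs (0 : C) < r by rewrite cabs0.
  have [g0 fg0] := gP 0 c0s.
  have := expand _ _ g0 c0r; rewrite fg0 f0 !subr0 cabs0 => h; apply/eqP; rewrite -cabs_eq0.
  have := cabs_ge0 (g 0) => h'; rewrite eq_le h' andbT.
  by rewrite -(ler_pM2l (_ : 0 < cabs b / 2)) ?mulr0// divr_gt0.
move=> w0; rewrite subr0 => w0s; have [z0r fz0] := gP _ w0s.
set d := cder f (g w0).
have dd : cderiv f (g w0) d by apply: (hol_cder Hf); rewrite subr0.
have d0 : 0 < cabs d.
  have := fb (g w0); rewrite subr0 => /(_ z0r); rewrite -/d cabsC.
  by have := cabsB_ge b d => ? ?; rlra.
exists d^-1; apply: (@gderiv_bigeps _ _ _ _ _ _ (2 / cabs d / cabs b)).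
  by rewrite !divr_ge0// ltW.
move=> e e0 _; have [t t0 ft] := dd e e0.
exists (Num.min (t * cabs b / 2) (s - cabs w0)).
  by rewrite lt_min subr_gt0 w0s divr_gt0// mulr_gt0.
move=> w /=; rewrite lt_min => /andP[wt ws].
have {}ws : cabs w < s by have := cabsB_ge w w0 => ?; rlra.
have [zr fz] := gP _ ws.
have := expand _ _ zr z0r; rewrite fz fz0 => D.
have D2 : cabs (g w - g w0) <= 2 / cabs b * cabs (w - w0).
  rewrite -(ler_pM2l (_ : 0 < cabs b / 2)); last by rewrite divr_gt0.
  apply: (le_trans D); rewrite mulrA (_ : cabs b / 2 * (2 / cabs b) = 1) ?mul1r//.
  by field; rewrite gt_eqF.
have zt : cabs (g w - g w0) < t.
  apply: (le_lt_trans D2); rewrite -(@ltr_pM2l _ (cabs b / 2)); last by rewrite divr_gt0.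
  rewrite mulrA (_ : cabs b / 2 * (2 / cabs b) = 1) ?mul1r; last by field; rewrite gt_eqF.
  by rlra.
have := ft _ zt; rewrite /= fz fz0 => T.
have nd : d != 0 by rewrite -cabs_gt0.
rewrite (_ : _ - _ - _ = - (d^-1 * (w - w0 - d * (g w - g w0)))); last by field.
rewrite cabsN cabsM cabsV.
apply: (@le_trans _ _ ((cabs d)^-1 * (e * (2 / cabs b * cabs (w - w0))))).
  rewrite ler_pM2l ?invr_gt0//; apply: (le_trans T); rewrite ler_wpM2l//; exact: ltW.
by rewrite le_eqVlt; apply/orP; left; apply/eqP; field; rewrite !gt_eqF.
Qed.

Lemma graph_motion (e : R) : 0 < e -> e <= 1 -> exists2 s : R, 0 < s &
  forall (K : set C) (a b : C -> C -> C),
  (forall x, K x -> hol (a x) 0 1) -> (forall x, K x -> hol (b x) 0 1) ->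
  (forall x t, K x -> cabs t < 1 -> cabs (a x t) <= 1) ->
  (forall x t, K x -> cabs t < 1 -> cabs (b x t) <= 1) ->
  (forall x, K x -> a x 0 = 0) -> (forall x, K x -> b x 0 = x) ->
  (forall x, K x -> e <= cabs (cder (a x) 0)) ->
  (forall x y t u, K x -> K y -> cabs t < 1 -> cabs u < 1 ->
     a x t = a y u -> b x t = b y u -> x = y) ->
  exists2 h, holomorphic_motion K h & forall x z, K x -> cabs z < 1 ->
    exists t, [/\ cabs t <= 8^-1, a x t = s%:C * z & b x t = h x z].
Proof.
(* [cder_lip] gives the derivative of [a x] the Lipschitz constant [256], so on the disc of radius
   [r] it varies by at most [e / 4]; [s] is the radius then provided by [local_inverse]. *)
move=> e0 e1; pose r : R := e / 1024; have r0 : 0 < r by rewrite /r; lra.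
have r8 : r <= 8^-1 by rewrite /r; lra.
pose s := e * r / 12; have s0 : 0 < s by rewrite divr_gt0// mulr_gt0.
exists s => // K a b Ha Hb a1 b1 a0 b0 ae disj.
have /choice[g gP] : forall x, exists g, K x ->
    [/\ hol g 0 s, g 0 = 0 & forall w, cabs w < s -> cabs (g w) < r /\ a x (g w) = w].
  move=> x; have [Kx|nKx] := pselect (K x); last by exists id => /nKx.
  set l := cder (a x) 0; have le := ae _ Kx; rewrite -/l in le.
  have a1' z : cabs (z - 0) < 1 -> cabs (a x z) <= 1 by rewrite subr0 => ?; exact: a1.
  have lin z : cabs (z - 0) < r -> cabs (cder (a x) z - l) <= cabs l / 4.
    rewrite subr0 => zr.
    have z4 : cabs (z - 0) < 1 / 4 by rewrite subr0; lra.
    have z04 : cabs (0 - 0 : C) < 1 / 4 by rewrite subr0 cabs0; lra.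
    apply: (le_trans (cder_lip ltr01 (Ha _ Kx) a1' z4 z04)); rewrite subr0.
    rewrite /r in zr; lra.
  have Hr : hol (a x) 0 r.
    by apply: hol_sub (Ha _ Kx) => z /lt_le_trans; apply; lra.
  have l0 : l != 0 by rewrite -cabs_gt0; exact: lt_le_trans le.
  have [g [Hg g0 gK]] := local_inverse r0 Hr (a0 _ Kx) l0 lin.
  have sl : s <= cabs l * r / 12 by rewrite /s ler_pM2r ?invr_gt0// ler_pM2r.
  exists g => _; split => //; first by apply: hol_sub Hg => z /lt_le_trans; exact.
  by move=> w ws; apply: gK; exact: lt_le_trans sl.
have sz z : cabs z < 1 -> cabs (s%:C * z) < s.
  by move=> z1; rewrite cabsM cabs_real gtr0_norm// gtr_pMr.
have r1 w : cabs w < r -> cabs w < 1 by move=> ?; lra.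
exists (fun x z => b x (g x (s%:C * z))).
  split.
  - move=> x Kx z; rewrite subr0 => z1; have [Hg g0 gK] := gP x Kx.
    have [|l hl] := Hg (s%:C * z); first by rewrite subr0 sz.
    have [|m hm] := Hb x Kx (g x (s%:C * z)); first by rewrite subr0 r1// (gK _ (sz _ z1)).1.
    by eexists; exact: (gderiv_comp (gderiv_comp (gderivZ s%:C (gderiv_id _ z)) hl) hm).
  - move=> x z Kx z1; have [Hg g0 gK] := gP x Kx.
    by apply: b1 => //; rewrite r1// (gK _ (sz _ z1)).1.
  - by move=> x Kx; have [Hg g0 gK] := gP x Kx; rewrite mulr0 g0 b0.
  - move=> x y z Kx Ky z1 E; have [_ _ gK] := gP x Kx; have [_ _ gK'] := gP y Ky.
    have [x1 x2] := gK _ (sz _ z1); have [y1 y2] := gK' _ (sz _ z1).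
    apply: (disj _ _ _ _ Kx Ky (r1 _ x1) (r1 _ y1) _ E).
    by rewrite x2 y2.
move=> x z Kx z1; have [_ _ gK] := gP x Kx; have [x1 x2] := gK _ (sz _ z1).
by exists (g x (s%:C * z)); split => //; lra.
Qed.

End graphs.

(** * From lower bounds on slices to positive volume *)

Lemma product_measure_gt0 (R : realType) d1 d2 (T1 : measurableType d1)
    (T2 : measurableType d2) (m1 : {measure set T1 -> \bar R})
    (m2 : {sigma_finite_measure set T2 -> \bar R}) (A : set (T1 * T2)) (P : set T1) (c : R) :
  measurable A -> measurable P -> 0 < c -> (0 < m1 P)%E ->
  (forall x, P x -> (c%:E <= m2 (xsection A x))%E) -> (0 < (m1 \x m2)%E A)%E.
Proof.
move=> mA mP c0 P0 H; have mf := measurable_fun_xsection m2 mA.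
apply: (@lt_le_trans _ _ (c%:E * m1 P)%E); first by rewrite mule_gt0// lte_fin.
rewrite -integral_cst// /product_measure1.
apply: (@le_trans _ _ (\int[m1]_(x in P) (m2 \o xsection A) x)%E).
  apply: ge0_le_integral => //.
  - by move=> x _; rewrite lee_fin ltW.
  - exact: measurable_funS measurableT (@subsetT _ _) mf.
exact: ge0_subset_integral mf _ _.
Qed.

Section volume.
Variable R : realType.
Local Notation C := R[i].
Local Notation R1 := (measurableTypeR R).
Local Notation R2 := (R1 * R1)%type.

(** A closed set is the decreasing intersection of its open neighbourhoods [U n], of finite area
    here, so a lower bound for every neighbourhood passes to the set. *)
Lemma area2_closed_ge (S : set (R * R)) (c : \bar R) : closed S ->
  S `<=` square (0 : C) 2 ->
  (forall t : R, 0 < t -> forall U : set R2, measurable U ->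
    (forall q : R * R, S q -> square (q.1 +i* q.2) t `<=` U) -> (c <= area2 U)%E) ->
  (c <= area2 S)%E.
Proof.
move=> cS S2 H; pose U n : set (R * R) := \bigcup_(q in S) ball q (n.+1%:R^-1).
have inv0 n : 0 < n.+1%:R^-1 :> R by rewrite invr_gt0 ltr0n.
have oU n : open (U n) by apply: bigcup_open => q _; exact: ball_open.
have mU n : @measurable _ R2 (U n) by exact: open_measurable2.
have capU : \bigcap_n U n = S.
  apply/seteqP; split => [p Up|p Sp n _]; last by exists p => //; exact: ballxx.
  apply: cS => N /nbhs_ballP[e /= e0 eN].
  have [n ne] : exists n, n.+1%:R^-1 < e.
    exists (Num.bound e^-1); rewrite invf_plt ?posrE ?ltr0n//.
    apply: lt_trans (archi_boundP _) _; first by rewrite invr_ge0 ltW.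
    by rewrite ltr_nat.
  have [q Sq qp] := Up n I; exists q; split => //; apply: eN.
  by apply: ball_sym; apply: le_ball qp; exact: ltW.
have Ule n : (c <= area2 (U n))%E.
  apply: (H (n.+1%:R^-1 / 2)) => //.
  have near_side (x y w : R) : 0 < w -> x - w / 2 <= y < x + w / 2 -> `|x - y| < w.
    by move=> ? ?; rewrite ltr_norml; lra.
  by move=> q Sq p /in_square[/= p1 p2]; exists q => //; split; exact: near_side.
have U0 : (area2 (U 0%N) < +oo)%E.
  apply: (@le_lt_trans _ _ (area2 (square (0 : C) 4))); last by rewrite area2_square// ltry.
  apply: le_measure; rewrite ?inE//; first exact: measurable_square.
  move=> p [q /S2/in_square[q1 q2]]; rewrite invr1 => -[/= b1 b2]; apply/in_square.
  by move: b1 b2; rewrite /ball/= !ltr_norml => ? ?; split; lra.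
have cv : (fun n => area2 (U n)) @ \oo --> area2 (\bigcap_n U n).
  apply: (@nonincreasing_cvg_mu _ _ _ (@area2 R)) => //.
    by rewrite capU; exact: closed_measurable2.
  move=> i j ij; apply/subsetPset => p [q Sq qp]; exists q => //.
  by apply: le_ball qp; rewrite lef_pV2 ?posrE ?ltr0n// ler_nat.
rewrite -capU; rewrite -(cvg_lim _ cv)//; apply: lime_ge; first by apply/cvg_ex; eexists; exact: cv.
exact: nearW.
Qed.

Lemma volume4_gt0 (B : set ((R * R) * (R * R))) (c r : R) : closed B -> 0 < c -> 0 < r ->
  (forall p : R * R, cabs (p.1 +i* p.2) <= r -> (c%:E <= area2 (xsection B p))%E) ->
  (0 < volume4 B)%E.
Proof.
move=> cB c0 r0 H; have mB := closed_measurable4 cB.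
pose P : set R2 := square (0 : C) (r / 2).
have mP : measurable P by exact: measurable_square.
have Pr (p : R2) : P p -> cabs (p.1 +i* p.2) <= r.
  move=> /in_square[/= p1 p2]; apply: (le_trans (cabs_le_ReIm _)) => /=.
  have : `|p.1| <= r / 2 by rewrite ler_norml; lra.
  have : `|p.2| <= r / 2 by rewrite ler_norml; lra.
  lra.
have P0 : (0 < area2 P)%E.
  rewrite /P area2_square; last by rewrite divr_ge0// ltW.
  by rewrite lte_fin mulr_gt0// exprn_gt0// divr_gt0.
apply: (@product_measure_gt0 R _ _ R2 R2 (@area2 R) (@area2 R) B P c mB mP c0 P0).
by move=> x /Pr; exact: H.
Qed.

End volume.

(** * The topology of [R[i]^o] in terms of [cabs], and evaluation of families *)

Section topology_of_C.
Variable R : realType.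
Local Notation C := R[i]^o.
Local Notation R1 := (measurableTypeR R).
Local Notation R2 := (R1 * R1)%type.
Local Notation oarea := ((@area2 R)^*)%mu.

Lemma disk_cabs (t : C) : disk t <-> cabs t < 1.
Proof. by rewrite /disk /= cabsE -(rmorph1 (real_complex R)) ltcR. Qed.

Lemma nbhs_cabs (z : C) (N : set C) : nbhs z N <->
  exists2 r : R, 0 < r & forall w : C, cabs (w - z) < r -> N w.
Proof.
split=> [/nbhs_ballP[e /= e0 eN]|[r r0 H]].
  have eE : e = (complex.Re e)%:C by rewrite RRe_real// gtr0_real.
  exists (complex.Re e); first by rewrite -ltcR -eE.
  move=> w wz; apply: eN; rewrite -ball_normE /ball_/= eE cabsE ltcR.
  by rewrite cabsC.
apply/nbhs_ballP; exists r%:C => /=; first by rewrite ltcR.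
by move=> w; rewrite -ball_normE /ball_/= cabsE ltcR cabsC => /H.
Qed.

Lemma open_pair_cabs (O : set (C * C)) : (forall p, O p -> exists2 r : R, 0 < r &
   forall q : C * C, cabs (q.1 - p.1) < r -> cabs (q.2 - p.2) < r -> O q) -> open O.
Proof.
move=> H; rewrite openE => p /H[r r0 {}H].
exists ([set w : C | cabs (w - p.1) < r], [set w : C | cabs (w - p.2) < r]).
  by split; apply/nbhs_cabs; exists r.
by move=> q [/= q1 q2]; exact: H.
Qed.

Lemma cvg_cderiv (g : C -> C) (t l : C) :
  (fun h : C => (h : R[i])^-1 *: ((g \o shift t) (h *: (1 : C)) - g t)) @ (0 : C)^' --> l -> cderiv g t l.
Proof.
move=> /cvgrPdist_le H e e0.
have := H e%:C; rewrite ltcR => /(_ e0)/nbhs_cabs[r r0 {}H].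
exists r => // w wt; have [->|wnt] := eqVneq w t.
  by rewrite !subrr mulr0 subr0 cabs0 mulr0.
have h0 : w - t != 0 by rewrite subr_eq0.
have := H (w - t); rewrite subr0 => /(_ wt h0).
have one (h : C) : h *: (1 : C) = h by rewrite /GRing.scale/= mulr1.
rewrite /= one subrK cabsE lecR => {}H.
have -> : g w - g t - l * (w - t) = - ((l - (w - t)^-1 *: (g w - g t)) * (w - t)).
  by rewrite /GRing.scale/= mulrBl mulrAC mulVf// mul1r opprB.
by rewrite cabsN cabsM; apply: ler_wpM2r => //; exact: cabs_ge0.
Qed.

Lemma derivable_pair_cderiv (f : C -> C * C) (t : C) : derivable f t 1 ->
  cderiv (fun z => (f z).1) t ('D_1 (fst \o f) t) /\
  exists d, cderiv (fun z => (f z).2) t d.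
Proof.
move=> /cvg_ex[/= l fl].
have f1 : (fun h : C => (h : R[i])^-1 *: (((fst \o f) \o shift t) (h *: (1 : C)) - (fst \o f) t)) @ (0 : C)^' --> l.1.
  move=> N nN; apply: (fl [set p | N p.1]).
  exact: (@cvg_fst _ _ (nbhs l.1) (nbhs l.2) _ N nN).
have f2 : (fun h : C => (h : R[i])^-1 *: (((snd \o f) \o shift t) (h *: (1 : C)) - (snd \o f) t)) @ (0 : C)^' --> l.2.
  move=> N nN; apply: (fl [set p | N p.2]).
  exact: (@cvg_snd _ _ (nbhs l.1) (nbhs l.2) _ N nN).
split; last by exists l.2; exact: cvg_cderiv f2.
have -> : 'D_1 (fst \o f) t = l.1 by rewrite /derive; exact: cvg_lim f1.
exact: cvg_cderiv f1.
Qed.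

(** Evaluation at [t] is continuous on [disk_maps] because [[set t]] is one of the compact sets of
    the family. *)
Lemma measurable_family_eval (E : set C) rho t (O : set (C * C)) :
  measurable_family E rho -> disk t -> open O ->
  lebesgue_measurable1 (E `&` [set x | O (rho x t)]).
Proof.
move=> mrho dt oO; apply: (mrho [set f : disk_maps R | O (f t)]).
apply: sub_sigma_algebra; rewrite /= openE => f Of.
have /fam_cvgP/(_ [set t]) : {family [set K : set C | compact K /\ K `<=` disk (R := R)],
    nbhs (f : disk_maps R) --> f} by [].
rewrite uniform_set1 => H; apply: H; last exact: open_nbhs_nbhs.
by split; [exact: compact_set1|move=> _ ->].
Qed.

Lemma realify_image (X : set R[i]) :
  @realify R @` X = [set p : R * R | X (p.1 +i* p.2)].
Proof.
apply/seteqP; split => [_ [z Xz <-]|p Xp]; first by case: z Xz.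
by exists (p.1 +i* p.2) => //; case: p Xp.
Qed.

Lemma ball_cabs (p q : R * R) (r : R) : ball p (r / 2) q ->
  cabs ((q.1 +i* q.2) - (p.1 +i* p.2)) < r.
Proof.
move=> [/= b1 b2]; rewrite cabsC; apply: (le_lt_trans (cabs_le_ReIm _)).
by rewrite cReB cImB/=; move: b1 b2; rewrite /ball/= => b1 b2; lra.
Qed.

(** The four real coordinates of [C * C], indexed by a type whose elements can be pickled in
    [eval_set]. *)
Definition coord (k : bool * bool) (p : R[i] * R[i]) : R :=
  let w := if k.1 then p.1 else p.2 in if k.2 then complex.Re w else complex.Im w.

Lemma coord_le k p q r : cabs (p.1 - q.1) <= r -> cabs (p.2 - q.2) <= r ->
  `|coord k p - coord k q| <= r.
Proof.
move=> h1 h2; case: k => -[] []; rewrite /coord/= -?cReB -?cImB.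
- exact: le_trans (Re_le_cabs _) h1.
- exact: le_trans (Im_le_cabs _) h1.
- exact: le_trans (Re_le_cabs _) h2.
- exact: le_trans (Im_le_cabs _) h2.
Qed.

Lemma open_coord_lt k (r : R) : open [set p : C * C | coord k p < r].
Proof.
apply: open_pair_cabs => p /= pr; exists ((r - coord k p) / 2).
  by rewrite divr_gt0// subr_gt0.
move=> q q1 q2; have := coord_le k (ltW q1) (ltW q2).
by rewrite ler_norml => ?; lra.
Qed.

Lemma open_fst_lt (r : R) : open [set p : C * C | cabs p.1 < r].
Proof.
apply: open_pair_cabs => p /= pr; exists (r - cabs p.1); first by rewrite subr_gt0.
by move=> q q1 _; have := cabsB_ge q.1 p.1 => ?; lra.
Qed.

Lemma rational_near (x e : R) : 0 < e -> exists q : rat, `|ratr q - x| < e.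
Proof.
move=> e0; have [|q] := @rat_in_itvoo R (x - e) (x + e); first by lra.
by rewrite in_itv/= => ?; exists q; rewrite ltr_norml; lra.
Qed.

Lemma hausdorff_pair (T U : topologicalType) :
  hausdorff_space T -> hausdorff_space U -> hausdorff_space (T * U)%type.
Proof.
move=> hT hU [p1 p2] [q1 q2] H; congr pair.
  apply: hT => A B nA nB; have [[u v] [/= uA uB]] := H (fst @^-1` A) (fst @^-1` B)
    (@cvg_fst _ _ (nbhs p1) (nbhs p2) _ A nA) (@cvg_fst _ _ (nbhs q1) (nbhs q2) _ B nB).
  by exists u.
apply: hU => A B nA nB; have [[u v] [/= vA vB]] := H (snd @^-1` A) (snd @^-1` B)
  (@cvg_snd _ _ (nbhs p1) (nbhs p2) _ A nA) (@cvg_snd _ _ (nbhs q1) (nbhs q2) _ B nB).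
by exists v.
Qed.

End topology_of_C.

(** * The set swept by the given family of disks *)

Section disks.
Variable R : realType.
Local Notation C := R[i]^o.
Local Notation R1 := (measurableTypeR R).
Local Notation R2 := (R1 * R1)%type.
Local Notation oarea := ((@area2 R)^*)%mu.
Variables (E : set C) (rho : C -> C -> C * C).
Hypothesis sub_E : E `<=` @disk R.
Hypothesis meas_E : lebesgue_measurable1 E.
Hypothesis pos_E : (0 < lebesgue1 E)%E.
Hypothesis holo : forall x, E x -> holomorphic_disk (rho x).
Hypothesis meas_rho : measurable_family E rho.
Hypothesis transv : forall x, E x -> transverse_to_axis (rho x).
Hypothesis base : forall x, E x -> rho x 0 = (0, x).

Let a (x t : R[i]) : R[i] := (rho x t).1.
Let b (x t : R[i]) : R[i] := (rho x t).2.
Let c (p : R * R) : R[i] := p.1 +i* p.2.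

Let Ha x : E x -> hol (a x) 0 1.
Proof.
move=> Ex t; rewrite subr0 => /disk_cabs dt; have [H _] := holo Ex.
by have [h _] := derivable_pair_cderiv (H t dt); eexists; exact: h.
Qed.

Let Hb x : E x -> hol (b x) 0 1.
Proof.
move=> Ex t; rewrite subr0 => /disk_cabs dt; have [H _] := holo Ex.
by have [_ h] := derivable_pair_cderiv (H t dt).
Qed.

Let a1 x t : E x -> cabs t < 1 -> cabs (a x t) <= 1.
Proof.
move=> Ex /disk_cabs dt; have [_ H] := holo Ex.
by have [/disk_cabs/ltW] := H t dt.
Qed.

Let b1 x t : E x -> cabs t < 1 -> cabs (b x t) <= 1.
Proof.
move=> Ex /disk_cabs dt; have [_ H] := holo Ex.
by have [_ /disk_cabs/ltW] := H t dt.
Qed.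

Let a0 x : E x -> a x 0 = 0.
Proof. by move=> Ex; rewrite /a base. Qed.

Let b0 x : E x -> b x 0 = x.
Proof. by move=> Ex; rewrite /b base. Qed.

Let da0 x : E x -> cder (a x) 0 != 0.
Proof.
move=> Ex; have d0 : disk (0 : C) by apply/disk_cabs; rewrite cabs0.
have [H _] := holo Ex.
have [h _] := derivable_pair_cderiv (H 0 d0).
rewrite (cder_val h); apply: (transv Ex d0).
by rewrite base//; split => //; exact: sub_E.
Qed.

(** Test points tending to [0]; the shift by [2] keeps the first of them inside the disc. *)
Let t_ k : C := (k.+2%:R^-1)%:C.

Let cabs_t k : cabs (t_ k) = k.+2%:R^-1.
Proof. by rewrite cabs_real ger0_norm// invr_ge0. Qed.

Let t_disk k : disk (t_ k).
Proof. by apply/disk_cabs; rewrite cabs_t invf_lt1 ?ltr0n// ltr1n. Qed.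

Let ninv n : 0 < n.+1%:R^-1 :> R.
Proof. by rewrite invr_gt0 ltr0n. Qed.

Let small (e : R) : 0 < e -> exists n : nat, forall k, (n <= k)%N -> k.+1%:R^-1 < e.
Proof.
move=> e0; exists (Num.bound e^-1) => k nk; rewrite invf_plt ?posrE ?ltr0n//.
apply: lt_le_trans (archi_boundP _) _; first by rewrite invr_ge0 ltW.
by rewrite ler_nat ltnW// ltnS.
Qed.

(* The points at which [|a x t| >= |t| / (n + 1)] for [t = 1 / (k + 2)] and
   [k >= n], a measurable way to bound the derivative of [a x] at [0] below. *)
Let good n : set R2 := [set p | E (c p) /\
  forall k, (n <= k)%N -> n.+1%:R^-1 <= k.+2%:R * cabs (a (c p) (t_ k))].

Let good_measurable n : oarea.-cara.-measurable (good n).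
Proof.
pose S k : set R2 := if (n <= k)%N then
  @realify R @` (E `&` [set x | cabs (rho x (t_ k)).1 < n.+1%:R^-1 / k.+2%:R]) else set0.
have mS k : oarea.-cara.-measurable (S k).
  rewrite /S; case: ifP => _; last exact: measurable0.
  exact: (measurable_family_eval meas_rho (t_disk k) (@open_fst_lt R (n.+1%:R^-1 / k.+2%:R))).
have -> : good n = @realify R @` E `\` \bigcup_k S k.
  rewrite realify_image; apply/seteqP; split => p.
    move=> [Ep H]; split => // -[k _]; rewrite /S; case: ifP => // nk.
    rewrite realify_image => -[_ /=]; rewrite ltr_pdivlMr ?ltr0n// mulrC.
    by apply/negP; rewrite -leNgt; exact: H.
  move=> [Ep nS]; split => // k nk; rewrite leNgt; apply/negP => h; apply: nS.
  exists k => //; rewrite /S nk realify_image; split => //=.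
  by rewrite ltr_pdivlMr ?ltr0n// mulrC.
by apply: measurableD => //; apply: bigcupT_measurable.
Qed.

(** The derivative of [a x] at [0] is some [l != 0], so [cabs (a x t)] is at least
    [cabs l * cabs t / 2] for small [t]. A single large [n] serves as threshold for [k] and as lower
    bound for the slope. *)
Let good_cover : @realify R @` E `<=` \bigcup_n good n.
Proof.
rewrite realify_image => p /= Ep; set x := c p in Ep.
have l0 : 0 < cabs (cder (a x) 0) by rewrite cabs_gt0 da0.
have d0 : cderiv (a x) 0 (cder (a x) 0).
  by apply: (hol_cder (Ha Ep)); rewrite subrr cabs0.
have l20 : 0 < cabs (cder (a x) 0) / 2 by rewrite divr_gt0.
have [r r0 ar] := d0 _ l20.
have m0 : 0 < Num.min r (cabs (cder (a x) 0) / 2) by rewrite lt_min r0.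
have [n nP] := small m0; exists n => //; split => // k nk.
have k1 := nP k.+1 (leqW nk); have n1 := nP n (leqnn n).
rewrite lt_min in k1; case/andP: k1 => kr _.
rewrite lt_min in n1; case/andP: n1 => _ nl.
have := ar (t_ k); rewrite /= subr0 cabs_t a0// subr0 => /(_ kr) h.
apply: (le_trans (ltW nl)).
have h2 := cabsB_ge (cder (a x) 0 * t_ k) (a x (t_ k)).
rewrite (cabsC (_ * _)) cabsM cabs_t in h2.
rewrite -ler_pdivrMl ?ltr0n//.
by move: h h2; rewrite /x; set u := k.+2%:R^-1 => h h2; lra.
Qed.

Let good_derivative n p : good n p -> n.+1%:R^-1 <= cabs (cder (a (c p)) 0).
Proof.
move=> [Ep H]; apply/ler_addgt0Pr => e e0.
have d0 : cderiv (a (c p)) 0 (cder (a (c p)) 0).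
  by apply: (hol_cder (Ha Ep)); rewrite subrr cabs0.
have [r r0 ar] := d0 _ e0; have [m mP] := small r0.
pose k := maxn n m; apply: (le_trans (H k (leq_maxl _ _))).
have kr := mP k.+1 (leqW (leq_maxr n m)).
have := ar (t_ k); rewrite /= subr0 cabs_t a0// subr0 => /(_ kr) h.
have h2 := cabsB_ge (a (c p) (t_ k)) (cder (a (c p)) 0 * t_ k).
rewrite (cabsM (cder _ _)) cabs_t in h2.
rewrite -ler_pdivlMl ?ltr0n//.
by move: h h2; set u := k.+2%:R^-1 => h h2; lra.
Qed.

Let good_pos : exists n, (0 < oarea (good n))%E.
Proof.
apply: contrapT => H.
have H0 n : oarea (good n) = 0%E.
  apply/eqP; rewrite eq_le mu_ext_ge0// andbT leNgt; apply/negP => h.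
  by apply: H; exists n.
have : (oarea (@realify R @` E) <= 0)%E.
  apply: (@le_trans _ _ (oarea (\bigcup_n good n))); first exact: le_mu_ext good_cover.
  apply: (le_trans (outer_measure_sigma_subadditive oarea _)).
  by rewrite eseries0// => n _ _; exact: H0.
by apply/negP; rewrite -ltNge; exact: pos_E.
Qed.

Let coord_lip k x t u : E x -> cabs t < 1 / 2 -> cabs u < 1 / 2 ->
  `|coord k (rho x t) - coord k (rho x u)| <= 16 * cabs (t - u).
Proof.
move=> Ex t2 u2.
have t2' : cabs (t - 0) < 1 / 2 by rewrite subr0.
have u2' : cabs (u - 0) < 1 / 2 by rewrite subr0.
have B1 z : cabs (z - 0) < 1 -> cabs (a x z) <= 1 by rewrite subr0 => ?; exact: a1.
have B2 z : cabs (z - 0) < 1 -> cabs (b x z) <= 1 by rewrite subr0 => ?; exact: b1.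
have := hol_lip_half ltr01 (Ha Ex) B1 t2' u2'.
have := hol_lip_half ltr01 (Hb Ex) B2 t2' u2'.
by rewrite mulr1 divr1 => h2 h1; exact: coord_le.
Qed.

(** Countably many sets that determine [rho] near [0]: sublevel sets, with rational levels, of each
    coordinate at each rational point of the disc of radius [1 / 2]. Where all are relatively
    clopen, evaluation at these points is continuous, and [coord_lip] extends this to the other
    points. *)
Let eval_set (m : nat) : set R2 :=
  if unpickle m is Some ((q1, q2), k, r) then
    if cabs ((ratr q1 : R) +i* ratr q2) < 1 / 2 then
      @realify R @` (E `&` [set x | coord k (rho x (ratr q1 +i* ratr q2)) < ratr r])
    else set0
  else set0.

Let eval_set_measurable m : oarea.-cara.-measurable (eval_set m).
Proof.
rewrite /eval_set; case: unpickle => [[[[q1 q2] k] r]|]; last exact: measurable0.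
case: ifPn => [h|_]; last exact: measurable0.
apply: (measurable_family_eval meas_rho _ (@open_coord_lt R k (ratr r))).
by apply/disk_cabs; lra.
Qed.

Let Phi (pt : (R * R) * (R * R)) := @realify2 R (rho (c pt.1) (c pt.2)).

(** The radius is the bound on parameters in [graph_motion]; it leaves room inside the disc of
    radius [1 / 2] of [coord_lip]. *)
Let Delta : set (R * R) := [set t | cabs (c t) <= 8^-1].

Let Delta_compact : compact Delta.
Proof.
have cQ : compact (`[-1 : R, 1]%classic `*` `[-1 : R, 1]%classic).
  by apply: compact_setX; exact: segment_compact.
apply: subclosed_compact cQ _.
  rewrite -[Delta]setCK; apply: open_closedC; rewrite openE => p /= /negP; rewrite -ltNge => h.
  apply/nbhs_ballP; exists ((cabs (c p) - 8^-1) / 2) => /=; first by rewrite divr_gt0// subr_gt0.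
  move=> q /ball_cabs pq; rewrite /setC/= => h2.
  have h1 := cabsB_ge (c p) (c q); rewrite (cabsC (c p)) in h1.
  by have := le_lt_trans h1 pq; move: h2; rewrite /Delta/= => ? ?; lra.
move=> p; rewrite /Delta/= => h; have := Re_le_cabs (c p); have := Im_le_cabs (c p).
by rewrite !ler_norml/= !in_itv/= => ? ?; split; lra.
Qed.

Let Phi_continuous (K : set (R * R)) : (forall p, K p -> E (c p)) ->
  (forall n (p : R * R), K p -> \forall q \near p, K q -> (eval_set n q <-> eval_set n p)) ->
  {within K `*` Delta, continuous Phi}.
Proof.
move=> KE KS; apply/subspace_continuousP => -[p0 t0] [/= Kp0 Dt0].
apply/cvg_ballP => e e0; rewrite /within/=.
(* Replacing [t0] and [t] by a rational point costs at most [16 * d] and [32 * d], which with the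
   [e / 4] of [near_coord] stays below [e]; the bound [8^-1] keeps that point in the disc of radius
   [1 / 2]. *)
pose d := Num.min (e / 100) 8^-1.
have d0 : 0 < d by rewrite lt_min; apply/andP; split; [apply: divr_gt0; rewrite ?ltr0n|lra].
have d8 : d <= 8^-1 by rewrite ge_min lexx orbT.
have de : d <= e / 100 by rewrite ge_min lexx.
have [q1 hq1] := rational_near (t0.1) (divr_gt0 d0 (ltr0n _ 2)).
have [q2 hq2] := rational_near (t0.2) (divr_gt0 d0 (ltr0n _ 2)).
pose t1 : R[i] := ratr q1 +i* ratr q2.
have t1d : cabs (t1 - c t0) < d.
  apply: (le_lt_trans (cabs_le_ReIm _)); rewrite cReB cImB/=; lra.
have Dt0' : cabs (c t0) <= 8^-1 := Dt0.
have t12 : cabs t1 < 1 / 2 by have := cabsB_ge t1 (c t0) => ?; lra.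
have near_coord k : \forall p \near p0, K p ->
    `|coord k (rho (c p) t1) - coord k (rho (c p0) t1)| < e / 4.
  set v := coord k (rho (c p0) t1).
  (* The levels [r1 < v < r2] give two of the sets [eval_set]; as membership in them is locally
     constant on [K], the coordinate stays between these levels near [p0]. *)
  have [|r1] := @rat_in_itvoo R (v - e / 4) v; first by lra.
  rewrite in_itv/= => /andP[l1 u1].
  have [|r2] := @rat_in_itvoo R v (v + e / 4); first by lra.
  rewrite in_itv/= => /andP[l2 u2].
  have index r : exists N, forall p : R * R,
      eval_set N p <-> E (c p) /\ coord k (rho (c p) t1) < ratr r.
    exists (pickle ((q1, q2), k, r)) => p.
    by rewrite /eval_set pickleK t12 realify_image.
  have [N1 evalE1] := index r1; have [N2 evalE2] := index r2.
  apply: filterS2 (KS N1 p0 Kp0) (KS N2 p0 Kp0) => p h1 h2 Kp.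
  have Ep := KE _ Kp; have Ep0 := KE _ Kp0.
  have [_ h3] := (evalE2 p).1 ((h2 Kp).2 ((evalE2 p0).2 (conj Ep0 l2))).
  have h4 : ratr r1 <= coord k (rho (c p) t1).
    rewrite leNgt; apply/negP => h.
    have [_] := (evalE1 p0).1 ((h1 Kp).1 ((evalE1 p).2 (conj Ep h))).
    by rewrite -/v => ?; lra.
  by rewrite ltr_norml; apply/andP; split; lra.
pose W : set (R * R) := [set p | K p -> forall k,
    `|coord k (rho (c p) t1) - coord k (rho (c p0) t1)| < e / 4].
have nW : nbhs p0 W.
  apply: filterS2 (filterI (near_coord (true, true)) (near_coord (true, false)))
    (filterI (near_coord (false, true)) (near_coord (false, false))).
  by move=> p [h1 h2] [h3 h4] Kp -[[] []]; [exact: h1|exact: h2|exact: h3|exact: h4].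
exists (W, ball t0 (d / 2)) => /=.
  by split => //; apply: nbhsx_ballx; rewrite divr_gt0.
move=> [p t] [/= Wp /ball_cabs td] [/= Kp Dt].
have Dt' : cabs (c t) <= 8^-1 := Dt.
have main k : `|coord k (rho (c p0) (c t0)) - coord k (rho (c p) (c t))| < e.
  have h1 := coord_lip k (KE _ Kp0) (_ : cabs (c t0) < 1 / 2) t12.
  have h2 := coord_lip k (KE _ Kp) (_ : cabs (c t) < 1 / 2) t12.
  have {}h1 : `|coord k (rho (c p0) (c t0)) - coord k (rho (c p0) t1)| <= 16 * d.
    apply: le_trans (h1 _) _; first by lra.
    by rewrite cabsC; apply: ler_wpM2l => //; exact: ltW.
  have {}h2 : `|coord k (rho (c p) (c t)) - coord k (rho (c p) t1)| <= 16 * (2 * d).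
    apply: le_trans (h2 _) _; first by lra.
    apply: ler_wpM2l => //; apply: (le_trans (cabs_dist_tri (c t0) _ _)).
    by rewrite (cabsC (c t0)); rewrite /c/= in td t1d *; lra.
  have h3 := Wp Kp k.
  have := ler_distD (coord k (rho (c p0) t1)) (coord k (rho (c p0) (c t0))) (coord k (rho (c p) (c t))).
  have := ler_distD (coord k (rho (c p) t1)) (coord k (rho (c p0) t1)) (coord k (rho (c p) (c t))).
  rewrite [`|coord k (rho (c p) t1) - coord k (rho (c p) (c t))|]distrC.
  rewrite [`|coord k (rho (c p0) t1) - coord k (rho (c p) t1)|]distrC.
  by move=> ? ?; lra.
by split; split; [exact: (main (true, true))|exact: (main (true, false))|
  exact: (main (false, true))|exact: (main (false, false))].
Qed.

Hypothesis disj : trivIset E (fun x => rho x @` @disk R).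

Lemma disks_positive : positive_lebesgue2 (\bigcup_(x in E) (rho x @` @disk R)).
Proof.
have [n gn0] := good_pos.
have gQ : good n `<=` square (0 : R[i]) 2.
  move=> p [/sub_E/disk_cabs h _]; apply/in_square => /=.
  have := Re_le_cabs (c p); have := Im_le_cabs (c p); rewrite !ler_norml /= => ? ?.
  by split; lra.
have [K [cK Kg K0 KS]] := lusin_clopen (good_measurable n) gQ gn0 eval_set_measurable.
have KE p : K p -> E (c p) by move/Kg => [].
pose K' : set R[i] := [set x | K (complex.Re x, complex.Im x)].
have K'E x : K' x -> E x by move/KE; case: x.
have K'g x : K' x -> n.+1%:R^-1 <= cabs (cder (a x) 0) by move/Kg/good_derivative; case: x.
have mK := closed_measurable2 cK.
have [k0 k00 hk0] : exists2 k0 : R, 0 < k0 & forall U : set R2, measurable U ->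
    @realify R @` K' `<=` U -> (k0%:E <= area2 U)%E.
  have [k0 k00 k0K] : exists2 k0 : R, 0 < k0 & (k0%:E <= area2 K)%E.
    rewrite oarea_measurable// in K0; case: (area2 K) K0 => [r| |].
    - by rewrite lte_fin => r0; exists r.
    - by move=> _; exists 1 => //; rewrite leey.
    - by [].
  exists k0 => // U mU KU; apply: (le_trans k0K); apply: le_measure; rewrite ?inE//.
  by move=> p Kp; apply: KU; rewrite realify_image /K' /=; case: p Kp.
have n1 : n.+1%:R^-1 <= 1 :> R by rewrite invf_le1 ?ltr0n// ler1n.
have [s s0 Hs] := graph_motion (ninv n) n1.
have [h mo hP] : exists2 h, holomorphic_motion K' h & forall x z, K' x -> cabs z < 1 ->
    exists t, [/\ cabs t <= 8^-1, a x t = s%:C * z & b x t = h x z].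
  apply: Hs => [x /K'E|x /K'E|x t /K'E|x t /K'E|x /K'E|x /K'E|x /K'g|] //.
  - exact: Ha.
  - exact: Hb.
  - exact: a1.
  - exact: b1.
  - exact: a0.
  - exact: b0.
  move=> x y t u /K'E Ex /K'E Ey t1 u1 axy bxy; apply: (disj Ex Ey).
  exists (rho x t); split; first by exists t => //; exact/disk_cabs.
  exists u; first exact/disk_cabs.
  by move: axy bxy; rewrite /a /b; case: (rho x t) (rho y u) => [? ?] [? ?] /= -> ->.
have [r /andP[r0 r1] Hr] := motion_area R.
have [m m0 Hm] := Hr k0 k00.
have KQ : compact K.
  have cQ : compact (`[-2 : R, 2]%classic `*` `[-2 : R, 2]%classic).
    by apply: compact_setX; exact: segment_compact.
  apply: subclosed_compact cK cQ _ => p /Kg/gQ/in_square[p1 p2].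
  move: p1 p2; rewrite /= => p1 p2; split; rewrite /= in_itv/=; lra.
pose B := Phi @` (K `*` Delta).
(* As a compact image, this part of the union is closed, hence Borel, although measurability of the
   whole union is unknown. *)
have cB : closed B.
  apply: compact_closed.
    by apply: hausdorff_pair; apply: hausdorff_pair; exact: Rhausdorff.
  apply: continuous_compact; first exact: Phi_continuous.
  exact: compact_setX KQ Delta_compact.
(* The graphs of [h] lie over [s * z] and [motion_area] holds for [cabs z <= r], whence the radius
   [s * r]. *)
have slice (p : R * R) : cabs (p.1 +i* p.2) <= s * r -> (m%:E <= area2 (xsection B p))%E.
  move=> pr; pose z : R[i] := s^-1%:C * (p.1 +i* p.2).
  have sz : s%:C * z = p.1 +i* p.2.
    by rewrite mulrA -rmorphM/= divff ?gt_eqF// mul1r.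
  have zr : cabs z <= r.
    by rewrite cabsM cabs_real gtr0_norm ?invr_gt0// ler_pdivrMl.
  apply: area2_closed_ge.
  - have -> : xsection B p = (fun q : R * R => (p, q)) @^-1` B.
      by apply/seteqP; split => q; rewrite /xsection/= ?inE.
    apply: closed_comp => // q _; apply: (@cvg_pair _ _ _ (nbhs q) (nbhs p) (nbhs q) _ _ _ (fun=> p) id).
      exact: cvg_cst.
    exact: cvg_id.
  - move=> q; rewrite /xsection/= inE => -[[x t] [/= Kx Dt] E1].
    have t1 : cabs (c t) < 1 by move: Dt; rewrite /Delta/= => ?; lra.
    have := b1 (KE _ Kx) t1; have : q = realify (b (c x) (c t)) by case: E1.
    move=> -> bb; apply/in_square; rewrite /realify /=.
    have := Re_le_cabs (b (c x) (c t)); have := Im_le_cabs (b (c x) (c t)).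
    by move: bb; rewrite !ler_norml => ? ? ?; split; lra.
  (* The point [(s * z, h x z)] is the value of [rho x] at a parameter in [Delta], so the slice
     contains [h x z] for every [x] in [K'] and [motion_area] applies to its neighbourhoods. *)
  - move=> t t0 U mU HU; apply: (Hm K' h mo hk0 z zr t t0 U mU) => x Kx.
    have z1 : cabs z < 1 by exact: le_lt_trans r1.
    have [u [u8 au bu]] := hP x z Kx z1.
    suff Bx : xsection B p (realify (h x z)).
      by have := HU _ Bx; rewrite /realify /=; case: (h x z).
    rewrite /xsection/= inE; exists (realify x, realify u).
      by split => //=; rewrite /Delta/= /c/=; case: (u) u8.
    rewrite /Phi /c/= /realify2 -bu.
    have -> : p = realify (a x u) by rewrite au sz /realify; case: (p).
    by rewrite /a /b; case: (x) => ? ?; case: (u) => ? ?.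
have B0 : (0 < volume4 B)%E by apply: (volume4_gt0 cB m0 _ slice); exact: mulr_gt0.
have mB := closed_measurable4 cB.
exists [set P | B (@realify2 R P)].
have BE : @realify2 R @` [set P | B (realify2 P)] = B.
  apply/seteqP; split => [_ [P BP <-]//|[[p1 p2] [q1 q2]] Bp].
  by exists (p1 +i* p2, q1 +i* q2).
split.
- by rewrite /lebesgue_measurable2/= BE; exact: caratheodory_measurable_mu_ext.
- move=> P [[x t] [/= Kx Dt] E1]; exists (c x); first exact: KE.
  exists (c t); first by apply/disk_cabs; move: Dt; rewrite /Delta/= => ?; lra.
  move: E1; rewrite /Phi/= /realify2 /realify; case: (rho _ _) P => [[? ?] [? ?]] [[? ?] [? ?]].
  by move=> /= [-> -> -> ->].
- rewrite /lebesgue2 /completed_measure_extension BE.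
  by apply: (lt_le_trans B0); rewrite measurable_mu_extE.
Qed.

End disks.

Theorem lemma1p2 (R : realType) (E : set R[i]^o)
    (rho : R[i]^o -> R[i]^o -> R[i]^o * R[i]^o)
    (sub_E : E `<=` @disk R)
    (meas_E : lebesgue_measurable1 E)
    (pos_E : (0 < lebesgue1 E)%E)
    (holo : forall x, E x -> holomorphic_disk (rho x))
    (meas_rho : measurable_family E rho)
    (disj : trivIset E (fun x => rho x @` @disk R))
    (transv : forall x, E x -> transverse_to_axis (rho x))
    (base : forall x, E x -> rho x 0 = (0, x)) :
  positive_lebesgue2 (\bigcup_(x in E) (rho x @` @disk R)).
Proof.
exact: (disks_positive sub_E meas_E pos_E holo meas_rho transv base disj).
Qed.
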